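(* Consider problem (P) with $g(x)=\mathcal{B}x-B$. Let $x^*$ be a local optimal solution of (P), and suppose $\nabla^2\varphi(x)\succeq 0$ for all $x$ in an open neighborhood $\mathcal{N}^*\subset\mathcal{O}$ of $x^*$. Let $v^*:=-\nabla\varphi(x^* )$ and $X^*:=g(x^* )$. Suppose that $\mathcal{G}$ is metrically regular at $(x^*,(0,0))$, and that $\mathcal{M}(x^*,v^* )=(\mathcal{A}^* )^{-1}(v^*-\mathcal{B}^*S^* )\times\{S^*\}$ for some $S^*\in\mathcal{N}_{\mathbb{S}^n_+}(X^* )$. Let $\alpha^*,\beta^*,\gamma^*$, $\alpha_1,\ldots,\alpha_p$ and $\gamma_1,\ldots,\gamma_s$ be the index sets associated with $(X,S)=(X^*,S^* )$. Let $K^*:=\mathcal{T}_{\mathbb{S}^n_+}(X^* )\cap\mathrm{Sp}(\mathcal{N}_{\mathbb{S}^n_+}(-S^* ))$. Suppose that $\mathcal{B}\mathbb{X}\supset K^*$, that $\mathcal{B}$ is injective on the set $\mathcal{B}^{-1}(K^* )$, and that at least one of the following two conditions holds: (A) $\mathrm{Sp}(\mathcal{N}_{\mathbb{S}^n_+}(X^* ))\cap(\mathcal{B}^* )^{-1}(\mathrm{Im}\,\mathcal{A}^* )=\{0\}$; (B) $\mathcal{B}^*[\mathrm{Sp}(\mathcal{N}_{\mathbb{S}^n_+}(X^* ))]\subset\mathcal{A}^*\mathbb{R}^m$. Then $x^*$ is a tilt-stable solution of (P) if and only if $$\operatorname{Ker}\nabla^2\varphi(x^* )\cap\operatorname{Ker}\mathcal{A}\cap\widehat\Upsilon=\{0\},$$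 where $\widehat\Upsilon$ is the set of all $w\in\mathbb{X}$ for which there exist index sets $\beta_-^*,\beta_+^*,\beta_0^*,\widetilde\gamma^*\subset[n]$ with $\gamma^*\subset\widetilde\gamma^*$, a matrix $P^*\in\mathbb{O}(X^* )\cap\mathbb{O}(S^* )$ and a block diagonal matrix $Q=\mathrm{BlkDiag}(Q_1,\ldots,Q_p)$ with $Q_j\in\mathbb{O}^{|\alpha_j|}$ and $Q_p=\mathrm{BlkDiag}(Q_p^1,\ldots,Q_p^s)$, $Q_p^1\in\mathbb{O}^{|\beta^*|}$, $Q_p^j\in\mathbb{O}^{|\gamma_j|}$ for $j\in\{2,\ldots,s\}$, such that $P^*Q\in\mathbb{O}(X^* )\cap\mathbb{O}(S^* )$ and, with $\widetilde W:=(P^*Q)^\top(\mathcal{B}w)P^*Q$, $$\beta^*=\beta_-^*\cup\beta_+^*\cup\beta_0^*\cup[\widetilde\gamma^*\setminus\gamma^*],\quad \widetilde W_{\beta_0^*\beta_0^*}\succeq 0,\quad \widetilde W_{[\beta_0^*\cup\beta_-^*\cup\widetilde\gamma^*][\beta_-^*\cup\widetilde\gamma^*]}=0,\quad \widetilde W_{[\alpha^*\cup\beta_+^*]\widetilde\gamma^*}=0.$$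
   Context: $\mathbb{X}$ is a finite-dimensional real Euclidean space with inner product $\langle\cdot,\cdot\rangle$; $\mathbb{S}^n$ is the space of real symmetric $n\times n$ matrices with the trace inner product and Frobenius norm; $\mathbb{S}^n_+$ is the cone of positive semidefinite matrices; $\mathbb{O}^k$ is the set of $k\times k$ real orthogonal matrices; $[n]=\{1,\ldots,n\}$; $\mathbb{B}(x,\delta)$ is the closed ball. Problem (P): $\min_{x\in\mathbb{X}}\{\varphi(x):\ \mathcal{A}x=b,\ g(x)\in\mathbb{S}^n_+\}$ with $g(x)=\mathcal{B}x-B$, and feasible set $\Gamma:=\mathcal{A}^{-1}(b)\cap g^{-1}(\mathbb{S}^n_+)$. Here $\varphi:\mathbb{X}\to(-\infty,\infty]$ is proper, lower semicontinuous and twice continuously differentiable on an open set $\mathcal{O}\supset\Gamma$; $\mathcal{A}:\mathbb{X}\to\mathbb{R}^m$ and $\mathcal{B}:\mathbb{X}\to\mathbb{S}^n$ are linear, with adjoints $\mathcal{A}^*,\mathcal{B}^*$; $b\in\mathbb{R}^m$ and $B\in\mathbb{S}^n$; $(\mathcal{A}^* )^{-1}(u)=\{y:\mathcal{A}^*y=u\}$. Tilt stability: for $f:\mathbb{X}\to(-\infty,\infty]$ proper, $\bar x\in\mathrm{dom}\,f$ is a tilt-stable local minimum of $f$ if there is $\delta>0$ such that $M_\delta(v):=\arg\min_{x\in\mathbb{B}(\bar x,\delta)}\{f(x)-f(\bar x)-\langle v,x-\bar x\rangle\}$ is single-valued and Lipschitz continuous on some neighborhood of $v=0$ with $M_\delta(0)=\{\bar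 x\}$. ''$x^*$ is a tilt-stable solution of (P)'' means that $x^*$ is a tilt-stable local minimum of $\varphi+\delta_\Gamma$, $\delta_\Gamma$ the indicator function of $\Gamma$. Metric regularity: $\mathcal{F}:\mathbb{X}\rightrightarrows\mathbb{Z}$ is metrically regular at $(x,z)\in\mathrm{gph}\,\mathcal{F}$ if there are $\delta,\kappa>0$ with $\mathrm{dist}(x',\mathcal{F}^{-1}(z'))\le\kappa\,\mathrm{dist}(z',\mathcal{F}(x'))$ for all $(x',z')\in\mathbb{B}((x,z),\delta)$. The multifunction $\mathcal{G}:\mathbb{X}\rightrightarrows\mathbb{R}^m\times\mathbb{S}^n$ is $\mathcal{G}(z):=(\mathcal{A}z-b,\,g(z))-\{0\}^m\times\mathbb{S}^n_+$. $\mathcal{T}_\Omega$ and $\mathcal{N}_\Omega$ are the tangent and normal cones of convex analysis ($\mathcal{N}_\Omega(x)=\{v:\langle v,x'-x\rangle\le0\ \forall x'\in\Omega\}$). For a closed convex cone $K$, $\mathrm{Sp}(K):=\mathbb{R}_+(K-K)$ is the linear space generated by $K$. Multipliers: $\mathcal{M}(x,v):=\{(y,S)\in\mathbb{R}^m\times\mathcal{N}_{\mathbb{S}^n_+}(g(x)):\mathcal{A}^*y+\mathcal{B}^*S=v\}$ if $v\in\mathcal{N}_\Gamma(x)$, and $\mathcal{M}(x,v):=\emptyset$ otherwise. Spectral notation: $\lambda_1(X)\ge\cdots\ge\lambda_n(X)$ are the eigenvalues of $X\in\mathbb{S}^n$, $\lambda(X)=(\lambda_1(X),\ldots,\lambda_n(X))^\top$,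 $\mathbb{O}(X):=\{P\in\mathbb{O}^n: X=P\,\mathrm{Diag}(\lambda(X))P^\top\}$. For $X\in\mathbb{S}^n_+$, $S\in\mathcal{N}_{\mathbb{S}^n_+}(X)$, the distinct eigenvalues of $X$ and $S$ are denoted $\mu_1>\cdots>\mu_p=0$ and $0=\nu_1>\nu_2>\cdots>\nu_s$ (the class for the eigenvalue $0$ being empty if the matrix is nonsingular), and $\alpha_j:=\{i\in[n]:\lambda_i(X)=\mu_j\}$ for $j\in[p]$, $\gamma_j:=\{i\in[n]:\lambda_i(S)=\nu_j\}$ for $j\in[s]$; $\alpha:=\{i:\lambda_i(X)>0\}$, $\beta:=\{i:\lambda_i(X)=0=\lambda_i(S)\}$, $\gamma:=\{i:\lambda_i(S)<0\}$ (so $\alpha_p=\beta\cup\gamma_2\cup\cdots\cup\gamma_s$); $\alpha^*,\beta^*,\gamma^*$ are these sets for $(X^*,S^* )$. For a matrix $M$, $M_{J_1J_2}$ is the submatrix with row indices $J_1$ and column indices $J_2$. *)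

(* Defs.v *)
From HB Require Import structures.
From mathcomp Require Import all_boot all_order all_algebra.
From mathcomp Require Import all_classical all_reals all_analysis.
From mathcomp Require Import ring lra.

Set Implicit Arguments.
Unset Strict Implicit.
Unset Printing Implicit Defensive.
Import Order.TTheory GRing.Theory Num.Theory.
Import numFieldNormedType.Exports.

Local Open Scope classical_set_scope.
Local Open Scope ring_scope.

(* A finite-dimensional real inner product space.  The norm (hence the
   topology) of the underlying normed module is the one of the inner product. *)
HB.mixin Record NormedVector_isEuclidean (R : realType) V
    & NormedModule R V & Vector R V := {
  dotp : V -> V -> R;
  dotpC : forall u v, dotp u v = dotp v u;
  dotpDl : forall u v w, dotp (u + v) w = dotp u w + dotp v w;
  dotpZl : forall a u v, dotp (a *: u) v = a * dotp u v;
  dotpvv : forall u, dotp u u = `|u| ^+ 2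
}.

#[short(type="euclideanType")]
HB.structure Definition Euclidean (R : realType) :=
  {V of NormedModule R V & Vector R V & NormedVector_isEuclidean R V}.

HB.factory Record Vector_hasDotp (R : realType) V & Vector R V := {
  form : V -> V -> R;
  formC : forall u v, form u v = form v u;
  formDl : forall u v w, form (u + v) w = form u w + form v w;
  formZl : forall a u v, form (a *: u) v = a * form u v;
  form_ge0 : forall u, 0 <= form u u;
  form_eq0 : forall u, form u u = 0 -> u = 0
}.

HB.builders Context R V & Vector_hasDotp R V.

Let nrm (u : V) : R := Num.sqrt (form u u).

Let formDD u v : form (u + v) (u + v) = form u u + 2 * form u v + form v v.
Proof. by rewrite formDl ![form _ (u + v)]formC !formDl (formC v u); ring. Qed.

Let form_quad (a : R) u v : form (a *: u + v) (a *: u + v) =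
  a ^+ 2 * form u u + 2 * a * form u v + form v v.
Proof. by rewrite formDD formZl (formC u (a *: u)) !formZl; ring. Qed.

Let form_CS u v : form u v <= nrm u * nrm v.
Proof.
rewrite /nrm -sqrtrM ?form_ge0//.
have [uv0|uv0] := leP (form u v) 0; first exact: le_trans (sqrtr_ge0 _).
rewrite -[leLHS]gtr0_norm// -sqrtr_sqr ler_sqrt ?mulr_ge0 ?form_ge0//.
have [u0|u0] := eqVneq (form u u) 0.
  have := form_ge0 ((- (form v v + 1) / (2 * form u v)) *: u + v).
  rewrite form_quad u0 mulr0 add0r.
  rewrite (_ : _ + _ = -1); first by lra.
  by field; lra.
have ugt0 : 0 < form u u by rewrite lt_def u0 form_ge0.
have := form_ge0 ((- form u v / form u u) *: u + v).
rewrite form_quad (_ : _ + _ =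
  (form u u * form v v - form u v ^+ 2) / form u u); last by field.
by rewrite pmulr_lge0 ?invr_gt0// subr_ge0.
Qed.

Let nrmD u v : nrm (u + v) <= nrm u + nrm v.
Proof.
rewrite -(ler_pXn2r (n := 2)) ?nnegrE ?addr_ge0 ?sqrtr_ge0//.
rewrite sqr_sqrtr ?form_ge0// formDD sqrrD !sqr_sqrtr ?form_ge0//.
by rewrite lerD2r lerD2l mulr2n; have := form_CS u v; lra.
Qed.

Let nrmZ (a : R) u : nrm (a *: u) = `|a| * nrm u.
Proof.
by rewrite /nrm formZl formC formZl mulrA -expr2 sqrtrM ?sqr_ge0// sqrtr_sqr.
Qed.

Let nrm_eq0 u : nrm u = 0 -> u = 0.
Proof.
move=> /eqP; rewrite sqrtr_eq0 => u0; apply: form_eq0.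
by apply/eqP; rewrite eq_le u0 form_ge0.
Qed.

HB.instance Definition _ := Lmodule_isNormed.Build R V nrmD nrmZ nrm_eq0.

Let formvv u : form u u = `|u| ^+ 2.
Proof. by rewrite /Num.norm/= sqr_sqrtr ?form_ge0. Qed.

HB.instance Definition _ :=
  NormedVector_isEuclidean.Build R V formC formDl formZl formvv.

HB.end.

(* Column vectors, with the Euclidean norm instead of the sup norm that the
   library puts on ['cV[R]_m]. *)
Definition evec (R : realType) (m : nat) := 'cV[R]_m.

HB.instance Definition _ (R : realType) (m : nat) := Vector.on (evec R m).

Section EvecEuclidean.
Variables (R : realType) (m : nat).
Implicit Types u v w : evec R m.

Let form u v : R := \sum_i u i 0 * v i 0.

Let formC u v : form u v = form v u.
Proof. by apply: eq_bigr => i _; rewrite mulrC. Qed.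

Let formDl u v w : form (u + v) w = form u w + form v w.
Proof. by rewrite -big_split; apply: eq_bigr => i _; rewrite mxE mulrDl. Qed.

Let formZl a u v : form (a *: u) v = a * form u v.
Proof. by rewrite mulr_sumr; apply: eq_bigr => i _; rewrite mxE mulrA. Qed.

Let form_ge0 u : 0 <= form u u.
Proof. by apply: sumr_ge0 => i _; rewrite -expr2 sqr_ge0. Qed.

Let form_eq0 u : form u u = 0 -> u = 0.
Proof.
move=> /eqP; rewrite psumr_eq0 => [/allP u0|i _]; last by rewrite -expr2 sqr_ge0.
apply/matrixP => i j; rewrite ord1 mxE; have := u0 i (mem_index_enum i).
by rewrite mulf_eq0 orbb => /eqP.
Qed.

HB.instance Definition _ :=
  Vector_hasDotp.Build R (evec R m) formC formDl formZl form_ge0 form_eq0.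

End EvecEuclidean.

(* Symmetric matrices, with the trace inner product and the Frobenius norm. *)
Definition symmx (R : realType) (n : nat) :=
  subvs_of (fixedSpace (linfun (@trmx R n n))).

HB.instance Definition _ (R : realType) (n : nat) := Vector.on (symmx R n).

Definition symval (R : realType) (n : nat) (S : symmx R n) : 'M[R]_n := vsval S.
Coercion symval : symmx >-> matrix.

HB.instance Definition _ (R : realType) (n : nat) :=
  GRing.Linear.copy (@symval R n) (@vsval _ _ _).

Section SymmxEuclidean.
Variables (R : realType) (n : nat).
Implicit Types S T U : symmx R n.

Lemma symval_tr S : (S : 'M[R]_n)^T = S.
Proof. by have /fixedSpaceP := valP S; rewrite lfunE. Qed.

Let form S T : R := \tr ((S : 'M[R]_n)^T *m T).

Let formE S T : form S T = \sum_i \sum_j (S : 'M[R]_n) j i * (T : 'M[R]_n) j i.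
Proof.
by apply: eq_bigr => i _; rewrite mxE; apply: eq_bigr => j _; rewrite mxE.
Qed.

Let formC S T : form S T = form T S.
Proof.
by rewrite !formE; apply: eq_bigr => i _; apply: eq_bigr => j _; rewrite mulrC.
Qed.

Let formDl S T U : form (S + T) U = form S U + form T U.
Proof. by rewrite /form !symval_tr raddfD mulmxDl mxtraceD. Qed.

Let formZl a S T : form (a *: S) T = a * form S T.
Proof. by rewrite /form !symval_tr linearZ -scalemxAl mxtraceZ. Qed.

Let form_ge0 S : 0 <= form S S.
Proof.
by rewrite formE; do 2!apply: sumr_ge0 => ? _; rewrite -expr2 sqr_ge0.
Qed.

Let form_eq0 S : form S S = 0 -> S = 0.
Proof.
rewrite formE => /eqP; rewrite psumr_eq0 => [/allP S0|i _]; last first.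
  by apply: sumr_ge0 => ? _; rewrite -expr2 sqr_ge0.
apply: val_inj; apply/matrixP => i j; rewrite linear0 mxE.
have := S0 j (mem_index_enum j); rewrite psumr_eq0 => [/allP|k _]; last first.
  by rewrite -expr2 sqr_ge0.
by move=> /(_ i (mem_index_enum i)); rewrite mulf_eq0 orbb => /eqP.
Qed.

HB.instance Definition _ :=
  Vector_hasDotp.Build R (symmx R n) formC formDl formZl form_ge0 form_eq0.

End SymmxEuclidean.

Section Calculus.
Variable R : realType.

(* The vector that represents a linear form; 0 if [l] is not linear. *)
Definition riesz (U : euclideanType R) (l : U -> R) : U :=
  xget 0 [set u | forall x, dotp u x = l x].

Definition adjoint (U V : euclideanType R) (f : U -> V) (v : V) : U :=
  riesz (fun u => dotp v (f u)).

Variable U : euclideanType R.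

Definition grad (f : U -> R) (x : U) : U := riesz ('d f x).

Definition hess (f : U -> R) (x : U) : U -> U := 'd (grad f) x.

Definition psd_op (T : U -> U) : Prop := forall h, 0 <= dotp (T h) h.

(* In finite dimension, continuity of the operator-valued Hessian is continuity
   of its values on each fixed direction. *)
Definition C2_on (O : set U) (phi : U -> \bar R) : Prop :=
  forall x, O x -> [/\ phi x \is a fin_num,
    differentiable (fine \o phi) x,
    differentiable (grad (fine \o phi)) x &
    forall h, {for x, continuous (fun y => hess (fine \o phi) y h)}].

End Calculus.

Section Variational.
Variable R : realType.

Section OneSpace.
Variable U : euclideanType R.
Implicit Types (f : U -> \bar R) (Om K : set U) (x v : U).

Definition proper_fun f : Prop :=
  (forall x, f x != -oo%E) /\ exists x, (f x < +oo)%E.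

Definition indicator Om x : \bar R := if `[< Om x >] then 0%E else +oo%E.

Definition tilt_argmin f xbar (delta : R) v : set U :=
  let tilted x := (f x - f xbar - (dotp v (x - xbar))%:E)%E in
  [set x | closed_ball xbar delta x /\
    forall y, closed_ball xbar delta y -> (tilted x <= tilted y)%E].

Definition tilt_stable f xbar : Prop :=
  [/\ proper_fun f, (f xbar < +oo)%E &
  exists delta : R, [/\ 0 < delta,
    tilt_argmin f xbar delta 0 = [set xbar] &
    exists (N : set U) (m : U -> U) (k : R), [/\ nbhs 0 N,
      forall v, N v -> tilt_argmin f xbar delta v = [set m v] &
      k.-lipschitz_N m]]].

Definition normal_cone Om x : set U :=
  [set v | forall x', Om x' -> dotp v (x' - x) <= 0].

Definition tangent_cone Om x : set U :=
  closure [set w | exists t x', [/\ 0 <= t, Om x' & w = t *: (x' - x)]].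

Definition cone_span K : set U :=
  [set w | exists t u v, [/\ 0 <= t, K u, K v & w = t *: (u - v)]].

End OneSpace.

(* The library puts the max norm on products, which is equivalent to the
   Euclidean one: only the constants [delta] and [kappa] depend on the choice. *)
Definition metrically_regular (V W : normedModType R)
    (F : V -> set W) (x : V) (z : W) : Prop :=
  F x z /\ exists delta kappa : R, [/\ 0 < delta, 0 < kappa &
    forall x' z', closed_ball x delta x' -> closed_ball z delta z' ->
      (edist_inf [set y | F y z'] x' <= kappa%:E * edist_inf (F x') z')%E].

End Variational.

Section Spectral.
Variable R : realType.

Definition psd (k : nat) (M : 'M[R]_k) : Prop :=
  M^T = M /\ forall u : 'cV[R]_k, 0 <= (u^T *m M *m u) 0 0.

Definition psd_cone (n : nat) : set (symmx R n) := [set S | psd S].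

Definition orthogonal_mx (k : nat) : set 'M[R]_k := [set P | P^T *m P = 1%:M].

Variable n : nat.
Implicit Types (X S M P Q : 'M[R]_n) (I J : {set 'I_n}).

(* The eigenvalues of a symmetric matrix, with multiplicity, in nonincreasing
   order. *)
Definition eigvals M : 'rV[R]_n :=
  xget 0 [set l : 'rV[R]_n | (forall i j : 'I_n, (i <= j)%N -> l 0 j <= l 0 i) /\
                char_poly M = \prod_i ('X - (l 0 i)%:P)].

Definition eigbases M : set 'M[R]_n :=
  [set P | orthogonal_mx P /\ M = P *m diag_mx (eigvals M) *m P^T].

Definition eigclass M (i : 'I_n) : {set 'I_n} :=
  [set k | eigvals M 0 k == eigvals M 0 i]%SET.

Definition idx_alpha X : {set 'I_n} := [set i | 0 < eigvals X 0 i]%SET.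

Definition idx_beta X S : {set 'I_n} :=
  [set i | (eigvals X 0 i == 0) && (eigvals S 0 i == 0)]%SET.

Definition idx_gamma S : {set 'I_n} := [set i | eigvals S 0 i < 0]%SET.

(* The sets alpha_1, ..., alpha_(p-1), beta, gamma_2, ..., gamma_s: the class
   alpha_p of the eigenvalue 0 of [X] is replaced by the sets that split it, so
   that block diagonality along [eigblocks X S] is the nested condition
   Q = BlkDiag(Q_1, ..., Q_p) with Q_p = BlkDiag(Q_p^1, ..., Q_p^s). *)
Definition eigblocks X S : {set {set 'I_n}} :=
  ([set eigclass X i | i in idx_alpha X] :|: [set idx_beta X S]
   :|: [set eigclass S i | i in idx_gamma S])%SET.

Definition submatrix I J M : 'M[R]_(#|I|, #|J|) :=
  mxsub (@enum_val _ (mem I)) (@enum_val _ (mem J)) M.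

(* [Q] is BlkDiag of orthogonal matrices, one for each index set in [Js]. *)
Definition orthogonal_blkdiag (Js : {set {set 'I_n}}) Q : Prop :=
  forall I J, I \in Js -> J \in Js ->
    (I = J -> orthogonal_mx (submatrix I I Q)) /\
    (I <> J -> submatrix I J Q = 0).

End Spectral.

Section Problem.
Variables (R : realType) (X : euclideanType R) (m n : nat).
Variables (A : X -> evec R m) (B : X -> symmx R n).
Variables (b : evec R m) (B0 : symmx R n).

Definition constraint (x : X) : symmx R n := B x - B0.

Definition feasible : set X :=
  [set x | A x = b /\ psd_cone (constraint x)].

Definition local_solution (phi : X -> \bar R) (x : X) : Prop :=
  feasible x /\ \forall x' \near x, feasible x' -> (phi x <= phi x')%E.

Definition tilt_stable_solution (phi : X -> \bar R) (x : X) : Prop :=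
  tilt_stable (fun x' => phi x' + indicator feasible x')%E x.

Definition constraint_map (x : X) : set (evec R m * symmx R n) :=
  [set (A x - b, constraint x - S) | S in @psd_cone R n].

Definition multipliers (x v : X) : set (evec R m * symmx R n) :=
  [set yS | [/\ normal_cone feasible x v,
    normal_cone (@psd_cone R n) (constraint x) yS.2 &
    adjoint A yS.1 + adjoint B yS.2 = v]].

Definition Upsilon_hat (Xs Ss : symmx R n) : set X :=
  let al := idx_alpha Xs in
  let be := idx_beta Xs Ss in
  let ga := idx_gamma Ss in
  [set w | exists (be_m be_p be_0 ga_t : {set 'I_n}) (P Q : 'M[R]_n),
    [/\ ga \subset ga_t,
        (eigbases Xs `&` eigbases Ss) P,
        orthogonal_blkdiag (eigblocks Xs Ss) Q,
        (eigbases Xs `&` eigbases Ss) (P *m Q) &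
        let W := (P *m Q)^T *m B w *m (P *m Q) in
        [/\ be = (be_m :|: be_p :|: be_0 :|: (ga_t :\: ga))%SET,
            psd (submatrix be_0 be_0 W),
            submatrix (be_0 :|: be_m :|: ga_t) (be_m :|: ga_t) W = 0 &
            submatrix (al :|: be_p) ga_t W = 0]]].

End Problem.

(* Main.v *)
From HB Require Import structures.
Require Import Defs.
From mathcomp Require Import all_boot all_order all_algebra.
From mathcomp Require Import all_classical all_reals all_analysis.
From mathcomp Require Import ring lra.

(** The set [Upsilon_hat] has a simple description.  The conditions on its index
  sets always make the columns of [W] indexed by [ga] vanish, and they ask for
  nothing more when [be_p] is all of [be]; hence [Upsilon_hat] is the set of [w]
  with [(B w) Ss = 0] ([Upsilon_hatE]).  With [H] the Hessian of the objective at
  [xs], the claim becomes: [xs] is tilt stable if and only if [H w = 0], [A w = 0]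
  and [(B w) Ss = 0] imply [w = 0].

  Metric regularity makes zero the only multiplier of zero, and with either
  alternative it yields nondegeneracy: [A^* y + B^* S = 0] with [Xs S = 0] forces
  [y = 0] and [S = 0] ([nondegeneracy]).  This injectivity has three consequences.
  Multipliers near [(xs, Ss)] depend on the data in a Lipschitz way
  ([multiplier_stability]); the multiplier rule holds at all feasible points near
  [xs] ([normal_multiplier]); and, dually, the compression of [B] to the kernel of
  [Xs] maps the kernel of [A] onto all symmetric matrices on that kernel
  ([compressed_surjective]).

  Sufficiency.  For semidefinite [S] and [T] the trace of [S T] is at least a
  positive multiple of [|S T|^2] ([psd_inn_ge]).  If [S1] is a multiplier at [x1]
  and [x] is feasible, this bounds [- <S1, B (x - x1)>] below by a multiple of
  [|B (x - x1) S1|^2].  Together with the Taylor expansion of the objective, the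
  kernel condition, which by homogeneity is a coercivity estimate, gives quadratic
  growth with a uniform constant around every point that obeys the multiplier rule
  for a small tilt ([uniform_growth]).  Growth at the minimisers of all small tilts
  makes them unique and Lipschitz ([growth_tilt_stable]).

  Necessity.  Conversely tilt stability gives uniform growth at the minimisers of
  the tilted problems, by an argument with the conjugate function
  ([tilt_stable_growth]).  Let [w] be in the three kernels, with [B w] small.  The
  direction [w] itself need not be feasible at [xs], because [B w] may be
  indefinite on the common kernel of [Xs] and [Ss].  The base point is therefore
  moved along a curve [xs + s z + s^2 q], where [z] makes that common kernel
  positive at first order and [q] corrects the constraint at second order; a
  semidefiniteness test on the scales [1], [s] and [s^2] ([psd_two_scale]) shows
  that this curve and its translate by [s w] are feasible.  Both points are almost
  complementary to one negative semidefinite [S1] close to [Ss]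
  ([complementary_curves]), so by convexity of the objective both almost minimise
  the same tilted function.  Growth then bounds their distance [s |w|] by an
  arbitrarily small multiple of [s] ([growth_second_order]), and [w = 0]. *)

Set Implicit Arguments.
Unset Strict Implicit.
Unset Printing Implicit Defensive.
Import Order.TTheory GRing.Theory Num.Theory.
Import numFieldNormedType.Exports.
Local Open Scope classical_set_scope.
Local Open Scope ring_scope.


(** * Inner product spaces *)

Section InnerProduct.
Context {R : realType} {U : euclideanType R}.
Implicit Types u v w : U.

Lemma dotpDr u v w : dotp u (v + w) = dotp u v + dotp u w.
Proof. by rewrite dotpC dotpDl !(dotpC u). Qed.

Lemma dotpZr a u v : dotp u (a *: v) = a * dotp u v.
Proof. by rewrite dotpC dotpZl dotpC. Qed.

Lemma dotpNl u v : dotp (- u) v = - dotp u v.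
Proof. by rewrite -scaleN1r dotpZl mulN1r. Qed.

Lemma dotpNr u v : dotp u (- v) = - dotp u v.
Proof. by rewrite dotpC dotpNl dotpC. Qed.

Lemma dotpBl u v w : dotp (u - v) w = dotp u w - dotp v w.
Proof. by rewrite dotpDl dotpNl. Qed.

Lemma dotpBr u v w : dotp u (v - w) = dotp u v - dotp u w.
Proof. by rewrite dotpDr dotpNr. Qed.

Lemma dotp0l u : dotp 0 u = 0.
Proof. by rewrite -(scale0r 0) dotpZl mul0r. Qed.

Lemma dotp0r u : dotp u 0 = 0.
Proof. by rewrite dotpC dotp0l. Qed.

Definition dotpE := (@dotpDl R U, dotpDr, dotpNl, dotpNr, @dotpZl R U, dotpZr, dotp0l, dotp0r).

Lemma dotp_suml I (r : seq I) (F : I -> U) v :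
  dotp (\sum_(i <- r) F i) v = \sum_(i <- r) dotp (F i) v.
Proof.
elim: r => [|i r IH]; first by rewrite !big_nil dotp0l.
by rewrite !big_cons dotpDl IH.
Qed.

Lemma dotpvv_eq0 u : dotp u u = 0 -> u = 0.
Proof. by move/eqP; rewrite dotpvv expf_eq0/= => /eqP; exact: normr0_eq0. Qed.

Lemma dotp_eq0 u : (forall v, dotp u v = 0) -> u = 0.
Proof. by move=> /(_ u); exact: dotpvv_eq0. Qed.

Lemma dotp_le u v : dotp u v <= `|u| * `|v|.
Proof.
have [->|v0] := eqVneq v 0; first by rewrite dotp0r normr0 mulr0.
have vp : 0 < `|v| ^+ 2 by rewrite exprn_gt0// normr_gt0.
have : 0 <= `| u - (dotp u v / `|v| ^+ 2) *: v | ^+ 2 by rewrite sqr_ge0.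
rewrite -dotpvv.
have -> : dotp (u - (dotp u v / `|v| ^+ 2) *: v) (u - (dotp u v / `|v| ^+ 2) *: v) =
    (`|u| ^+ 2 * `|v| ^+ 2 - dotp u v ^+ 2) / `|v| ^+ 2.
  by rewrite !dotpE !dotpvv (dotpC v u); field; rewrite normr_eq0.
rewrite pmulr_lge0 ?invr_gt0// subr_ge0 -exprMn => h.
apply: le_trans (ler_norm _) _.
by rewrite -(ler_pXn2r (n := 2)) ?nnegrE ?mulr_ge0// real_normK ?num_real.
Qed.

Lemma dotp_norm_le u v : `|dotp u v| <= `|u| * `|v|.
Proof. by rewrite ler_norml dotp_le andbT lerNl -dotpNl -(normrN u) dotp_le. Qed.

Lemma dotp_ge u v : - (`|u| * `|v|) <= dotp u v.
Proof. by have := dotp_norm_le u v; rewrite ler_norml => /andP[]. Qed.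

Lemma normDsq u v : `|u + v| ^+ 2 = `|u| ^+ 2 + 2 * dotp u v + `|v| ^+ 2.
Proof. by rewrite -!dotpvv !dotpE (dotpC v u); ring. Qed.

Lemma normBsq u v : `|u - v| ^+ 2 = `|u| ^+ 2 - 2 * dotp u v + `|v| ^+ 2.
Proof. by rewrite normDsq normrN dotpNr; ring. Qed.

(** Riesz representation: [u |-> dotp u] is an injective linear map into the
  row of values on a basis, and both spaces have the same dimension. *)
Lemma riesz_exists (l : {linear U -> R^o}) : exists u, forall x, dotp u x = l x.
Proof.
pose e := vbasis {:U}.
pose rho u : 'rV[R]_(\dim {:U}) := \row_i dotp u e`_i.
have rhol : linear rho.
  by move=> a u v; apply/rowP => i; rewrite !mxE !dotpE.
pose rhoL := GRing.isLinear.Build R U 'rV[R]_(\dim {:U}) *:%R rho rhol.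
pose rho' : {linear U -> 'rV[R]_(\dim {:U})} := HB.pack rho rhoL.
have dotE u (k : U -> R) : (forall a x y, k (a *: x + y) = a * k x + k y) ->
    (forall i : 'I_(\dim {:U}), dotp u e`_i = k e`_i) -> forall x, dotp u x = k x.
  move=> kl ke x; have k0 : k 0 = 0.
    by have := kl 1 0 0; rewrite scale1r addr0 mul1r => /eqP; rewrite addrC -subr_eq subrr eq_sym => /eqP.
  have := coord_vbasis (memvf x) => ->.
  rewrite dotpC dotp_suml.
  have -> : forall f : 'I_(\dim {:U}) -> R, k (\sum_i f i *: e`_i) = \sum_i f i * k e`_i.
    move=> f; elim: (index_enum _) => [|i r IH]; first by rewrite !big_nil.
    by rewrite !big_cons kl IH.
  by apply: eq_bigr => i _; rewrite dotpZl dotpC -ke.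
have inj : (lker (linfun rho') == 0)%VS.
  rewrite -subv0; apply/subvP => u; rewrite memv_ker lfunE/= => /eqP/rowP u0.
  rewrite memv0; apply/eqP/dotp_eq0 => v.
  rewrite (dotE u (fun=> 0)) => [//|a x y|i].
    by rewrite mulr0 addr0.
  by have := u0 i; rewrite !mxE.
have surj : (limg (linfun rho') = fullv)%VS.
  apply/eqP; rewrite eqEdim subvf/= limg_dim_eq; last by rewrite (eqP inj) capv0.
  by rewrite [X in (X <= _)%N]dimvf/= /dim/= mul1n.
have : \row_i l e`_i \in limg (linfun rho') by rewrite surj memvf.
move=> /memv_imgP[u _]; rewrite lfunE/= => /rowP ur; exists u.
apply: dotE => [a x y|i]; first by rewrite linearP.
by have := ur i; rewrite !mxE.
Qed.

Lemma dotp_riesz (l : U -> R) : linear (l : U -> R^o) ->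
  forall x, dotp (riesz l) x = l x.
Proof.
move=> ll; pose lL := GRing.isLinear.Build R U R^o *:%R l ll.
have [u ul] := riesz_exists (HB.pack (l : U -> R^o) lL : {linear U -> R^o}).
by rewrite /riesz; case: xgetP => [v -> //|] /(_ u) [].
Qed.

End InnerProduct.

Section Adjoint.
Context {R : realType} {U V : euclideanType R}.
Variable f : {linear U -> V}.

Lemma dotp_adjoint v u : dotp (adjoint f v) u = dotp v (f u).
Proof.
by apply: dotp_riesz => a x y; rewrite linearP dotpDr dotpZr.
Qed.

Lemma adjoint_is_linear : linear (adjoint f : V -> U).
Proof.
move=> a x y; apply/eqP; rewrite -subr_eq0; apply/eqP/dotp_eq0 => v.
by rewrite !(dotpE, dotp_adjoint) subrr.
Qed.

HB.instance Definition _ := GRing.isLinear.Build R V U *:%R (adjoint f) adjoint_is_linear.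

End Adjoint.

Section LinearMaps.
Context {R : realType} {U V : euclideanType R}.

(** Coordinates in a basis are inner products with fixed vectors, so the
  Cauchy-Schwarz inequality bounds them. *)
Lemma linear_bound (f : {linear U -> V}) :
  exists2 C, 0 < C & forall u, `|f u| <= C * `|u|.
Proof.
pose e := vbasis {:U}.
pose c i : U := riesz (fun x => coord e i x).
have cE i x : dotp (c i) x = coord e i x.
  by apply: dotp_riesz => a y z; rewrite linearP.
exists (1 + \sum_i `|c i| * `|f e`_i|).
  by rewrite ltr_pwDl// sumr_ge0// => i _; rewrite mulr_ge0.
move=> u; rewrite {1}(coord_vbasis (memvf u)) linear_sum mulrDl mul1r.
rewrite -[leLHS]add0r lerD// mulr_suml.
apply: le_trans (ler_norm_sum _ _ _) _; apply: ler_sum => i _.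
by rewrite linearZ normrZ -/e -cE mulrAC ler_wpM2r// dotp_norm_le.
Qed.

Lemma euclid_linear_continuous (f : {linear U -> V}) : continuous f.
Proof.
have [C C0 fC] := linear_bound f.
apply: bounded_linear_continuous; apply/linear_boundedP.
near=> r => x; apply: le_trans (fC x) _; rewrite ler_wpM2r//.
Unshelve. all: by end_near. Qed.

(** The endomorphism [f \o adjoint f] of [V] is injective, hence onto. *)
Lemma linear_surjective (f : {linear U -> V}) :
  (forall v, adjoint f v = 0 -> v = 0) -> forall v, exists u, f u = v.
Proof.
move=> inj v.
pose g : {linear V -> V} := f \o adjoint f.
have kg : (lker (linfun g) == 0)%VS.
  rewrite -subv0; apply/subvP => u; rewrite memv_ker lfunE/= => /eqP u0.
  rewrite memv0; apply/eqP/inj/dotpvv_eq0.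
  by rewrite dotp_adjoint u0 dotp0r.
have : v \in limg (linfun g).
  suff -> : limg (linfun g) = fullv by rewrite memvf.
  by apply/eqP; rewrite eqEdim subvf/= limg_dim_eq// (eqP kg) capv0.
move=> /memv_imgP[u _]; rewrite lfunE/= => ->.
by exists (adjoint f u).
Qed.

End LinearMaps.

(** The constant is a bound of a linear left inverse. *)
Lemma linear_bounded_below {R : realType} {U V : euclideanType R} (f : {linear U -> V}) :
  (forall u, f u = 0 -> u = 0) -> exists2 C, 0 < C & forall u, `|u| <= C * `|f u|.
Proof.
move=> inj.
have kf : (lker (linfun f) == 0)%VS.
  rewrite -subv0; apply/subvP => u; rewrite memv_ker lfunE/= => /eqP u0.
  by rewrite memv0; apply/eqP/inj.
have [C C0 gC] := linear_bound (((linfun f)^-1)%VF : {linear V -> U}).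
exists C => // u; have := gC (f u).
by have := lker0_lfunK kf u; rewrite lfunE/= => ->.
Qed.

(** An alias, because the norm of the product type is the maximum norm, which
  comes from no inner product. *)
Definition eprod {R : realType} (U V : euclideanType R) := (U * V)%type.

HB.instance Definition _ (R : realType) (U V : euclideanType R) :=
  Vector.on (eprod U V).

Section EuclideanProduct.
Context {R : realType} {U V : euclideanType R}.
Implicit Types p q : eprod U V.

Let form p q : R := dotp p.1 q.1 + dotp p.2 q.2.

Let formC p q : form p q = form q p.
Proof. by rewrite /form dotpC (dotpC p.2). Qed.

Let formDl p q r : form (p + q) r = form p r + form q r.
Proof. by rewrite /form !dotpDl; ring. Qed.

Let formZl a p q : form (a *: p) q = a * form p q.
Proof. by rewrite /form !dotpZl; ring. Qed.

Let form_ge0 p : 0 <= form p p.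
Proof. by rewrite /form !dotpvv addr_ge0 ?sqr_ge0. Qed.

Let form_eq0 p : form p p = 0 -> p = 0.
Proof.
rewrite /form !dotpvv => /eqP; rewrite paddr_eq0 ?sqr_ge0// !expf_eq0/= !normr_eq0.
by case: p => a b /= /andP[/eqP-> /eqP->].
Qed.

HB.instance Definition _ :=
  Vector_hasDotp.Build R (eprod U V) formC formDl formZl form_ge0 form_eq0.

Lemma eprod_dotp p q : dotp p q = dotp p.1 q.1 + dotp p.2 q.2.
Proof. by []. Qed.

Lemma eprod_normsq p : `|p| ^+ 2 = `|p.1| ^+ 2 + `|p.2| ^+ 2.
Proof. by rewrite -!dotpvv. Qed.

Lemma eprod_norm1 p : `|p.1| <= `|p|.
Proof. by rewrite -(ler_pXn2r (n := 2)) ?nnegrE// eprod_normsq lerDl sqr_ge0. Qed.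

Lemma eprod_norm2 p : `|p.2| <= `|p|.
Proof. by rewrite -(ler_pXn2r (n := 2)) ?nnegrE// eprod_normsq lerDr sqr_ge0. Qed.

Lemma eprod_norm_le p : `|p| <= `|p.1| + `|p.2|.
Proof.
rewrite -(ler_pXn2r (n := 2)) ?nnegrE ?addr_ge0// eprod_normsq.
by rewrite sqrrD lerD2r lerDl mulrn_wge0// mulr_ge0.
Qed.

End EuclideanProduct.


(** * Compactness *)

Lemma continuous_add {K : numFieldType} {T : topologicalType} {V : normedModType K}
  (f g : T -> V) : continuous f -> continuous g -> continuous (fun x => f x + g x).
Proof. by move=> fc gc x; apply: cvgD; [exact: fc|exact: gc]. Qed.

Lemma continuous_sub {K : numFieldType} {T : topologicalType} {V : normedModType K}
  (f g : T -> V) : continuous f -> continuous g -> continuous (fun x => f x - g x).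
Proof. by move=> fc gc x; apply: cvgB; [exact: fc|exact: gc]. Qed.

Lemma continuous_normsq {K : realType} {T : topologicalType} {V : normedModType K}
  (f : T -> V) : continuous f -> continuous (fun x => `|f x| ^+ 2).
Proof.
move=> fc x; rewrite (_ : (fun u => _) = (fun x : K => x ^+ 2) \o (fun u => `|f u|))//.
apply: continuous_comp; last exact: exprn_continuous.
by apply: continuous_comp; [exact: fc|exact: norm_continuous].
Qed.

Lemma closed_fun_le {R : realType} {U : topologicalType} (f : U -> R) (r : R) :
  continuous f -> closed [set u | f u <= r].
Proof.
move=> fc; rewrite -/(f @^-1` [set x | x <= r]).
by apply: (preimage_closed _ (@closed_le _ _)) => u _; exact: fc.
Qed.

(** The ball is a closed part of the image of a box of coordinates, because the
  coordinate functionals are bounded. *)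
Lemma compact_norm_le {R : realType} {U : euclideanType R} (r : R) :
  compact [set u : U | `|u| <= r].
Proof.
pose e := vbasis {:U}.
pose c i : U := riesz (fun x => coord e i x).
have cE i x : dotp (c i) x = coord e i x.
  by apply: dotp_riesz => a y z; rewrite linearP.
pose f (a : 'rV[R]_(\dim {:U})) : U := \sum_i a 0 i *: e`_i.
have fl : linear f.
  move=> a u v; rewrite /f scaler_sumr -big_split; apply: eq_bigr => i _ /=.
  by rewrite !mxE scalerDl scalerA.
pose fL := GRing.isLinear.Build R 'rV[R]_(\dim {:U}) U *:%R f fl.
pose f' : {linear 'rV[R]_(\dim {:U}) -> U} := HB.pack f fL.
have fc : continuous f'.
  apply: bounded_linear_continuous; apply/linear_boundedP.
  exists (\sum_(i < \dim {:U}) `|e`_i|); split; first exact: num_real.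
  move=> M /ltW Mlt x; rewrite /f'/= /f; apply: le_trans (ler_norm_sum _ _ _) _.
  apply: (@le_trans _ _ ((\sum_(i < \dim {:U}) `|e`_i|) * `|x|)); last by rewrite ler_wpM2r.
  rewrite mulr_suml; apply: ler_sum => i _; rewrite normrZ mulrC ler_wpM2l//.
  by rewrite [leRHS]/Num.norm/= mx_normrE; apply/bigmax_geP; right; exists (0, i).
pose K := [set a : 'rV[R]_(\dim {:U}) |
  forall i, `[- (`|c i| * r), `|c i| * r]%classic (a ord0 i)].
have Kc : compact K.
  apply: (@rV_compact R _ (fun i => `[- (`|c i| * r), `|c i| * r]%classic)) => i.
  exact: segment_compact.
have fKc : compact (f' @` K).
  by apply: continuous_compact => //; apply: continuous_subspaceT.
apply: subclosed_compact fKc _.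
  by apply: closed_fun_le; exact: norm_continuous.
move=> u /= ur; exists (\row_i coord e i u).
  move=> i; rewrite /= in_itv/= mxE -cE -ler_norml.
  by apply: le_trans (dotp_norm_le _ _) _; rewrite ler_wpM2l.
by rewrite /f'/= /f {2}(coord_vbasis (memvf u)); apply: eq_bigr => i _; rewrite mxE.
Qed.

Lemma exists_argmin {R : realType} {U : euclideanType R} (C : set U) (r : R)
    (F : U -> R) :
  C !=set0 -> closed C -> (forall u, C u -> `|u| <= r) ->
  (forall u, C u -> {for u, continuous F}) ->
  exists2 u, C u & forall v, C v -> F u <= F v.
Proof.
move=> C0 Cc Cr Fc.
have Ccomp : compact C by apply: subclosed_compact (@compact_norm_le _ _ r) _.
have FC : {within C, continuous F}.
  apply: continuous_in_subspaceT => u; rewrite inE; exact: Fc.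
have [u uC ule] := compact_EVT_min C0 Ccomp FC.
by exists u; [rewrite inE in uC|move=> v Cv; apply: ule; rewrite inE].
Qed.

(** The bound of [p] by [L p] makes the sublevel sets of the distance to [u]
  compact, so that the infimum is attained; the conclusions are its optimality
  conditions along the ray of [p] and in the directions of the cone. *)
Lemma cone_image_projection {R : realType} {U V : euclideanType R}
    (C : set U) (L : {linear U -> V}) (K : R) (u : V) :
  closed C -> C 0 -> (forall p q, C p -> C q -> C (p + q)) ->
  (forall a p, 0 <= a -> C p -> C (a *: p)) ->
  0 < K -> (forall p, C p -> `|p| <= K * `|L p|) ->
  exists2 p, C p & dotp (u - L p) (L p) = 0 /\
    forall q, C q -> dotp (u - L p) (L q) <= 0.
Proof.
move=> Cc C0 CD CZ K0 LK.
pose D := C `&` [set p | `|p| <= K * (2 * `|u|)].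
have [||||p [Cp pr] pmin] := @exists_argmin R U D (K * (2 * `|u|)) (fun p => `|u - L p|).
- by exists 0; split => //=; rewrite normr0 mulr_ge0 ?mulr_ge0// ltW.
- apply: closedI => //.
  by apply: closed_fun_le; exact: norm_continuous.
- by move=> p [].
- move=> p _; apply: (@continuous_comp _ _ _ (fun p => u - L p) (fun x => `|x|)).
    by apply: (@continuousB _ _ _ (cst u) L); [exact: cst_continuous|exact: euclid_linear_continuous].
  exact: norm_continuous.
have pmin' q : C q -> `|u - L p| <= `|u - L q|.
  move=> Cq; have [h|h] := leP `|q| (K * (2 * `|u|)); first by apply: pmin; split.
  have : `|u - L p| <= `|u - L 0|.
    by apply: pmin; split => //=; rewrite normr0 mulr_ge0 ?mulr_ge0// ltW.
  rewrite linear0 subr0 => /le_trans; apply.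
  have := lt_le_trans h (LK q Cq); rewrite ltr_pM2l// => h2.
  have := lerB_dist (L q) u; rewrite distrC; lra.
have pmin2 (d : V) : (exists2 t, 0 < t & forall s, 0 <= s <= t -> exists2 q, C q & L q = L p + s *: d) ->
    dotp (u - L p) d <= 0.
  move=> [t t0 td]; rewrite leNgt; apply/negP => pos.
  have key s : 0 <= s <= t -> 2 * s * dotp (u - L p) d <= s ^+ 2 * `|d| ^+ 2.
    move=> st; have [q Cq qE] := td s st.
    have : `|u - L p| ^+ 2 <= `|(u - L p) - s *: d| ^+ 2.
      by rewrite ler_pXn2r ?nnegrE// -addrA -opprD -qE; exact: pmin'.
    rewrite (normBsq (u - L p) (s *: d)) dotpZr normrZ exprMn real_normK ?num_real//.
    by lra.
  set a := dotp _ _ in pos key; set b := `|d| ^+ 2 in key.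
  have b0 : 0 <= b by rewrite sqr_ge0.
  pose s := Num.min t (a / (b + 1)).
  have s0 : 0 < s by rewrite lt_min t0 divr_gt0//; lra.
  have sa : s * (b + 1) <= a by rewrite -ler_pdivlMr ?ge_min ?lexx ?orbT//; lra.
  have := key s; rewrite ltW// /s ge_min lexx -/s => /(_ isT).
  rewrite expr2 -[leRHS]mulrA -[X in X <= _]mulrA (mulrCA 2) ler_pM2l//; nra.
exists p => //; split.
  apply/eqP; rewrite eq_le; apply/andP; split.
    apply: pmin2; exists 1 => // s /andP[s0 s1]; exists ((1 + s) *: p).
      by apply: CZ => //; rewrite addr_ge0.
    by rewrite linearZ/= scalerDl scale1r.
  rewrite -oppr_le0 -dotpNr; apply: pmin2; exists 1 => // s /andP[s0 s1].
  exists ((1 - s) *: p); first by apply: CZ => //; rewrite subr_ge0.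
  by rewrite linearZ/= scalerBl scale1r scalerN.
move=> q Cq; apply: pmin2; exists 1 => // s /andP[s0 s1]; exists (p + s *: q).
  by apply: CD => //; apply: CZ.
by rewrite linearD linearZ.
Qed.


(** * Matrices: Frobenius norm, spectral theorem, semidefiniteness *)

(** An alias, because the norm of ['M_(m, n)] is the maximum norm. *)
Definition fmx (R : realType) (m n : nat) := 'M[R]_(m, n).

HB.instance Definition _ (R : realType) (m n : nat) := Vector.on (fmx R m n).

Section FmxEuclidean.
Variables (R : realType) (m n : nat).
Implicit Types M N K : fmx R m n.

Let form M N : R := \tr ((M : 'M[R]_(m, n))^T *m (N : 'M[R]_(m, n))).

Let formE M N : form M N = \sum_j \sum_i M i j * N i j.
Proof.
by apply: eq_bigr => i _; rewrite mxE; apply: eq_bigr => j _; rewrite mxE.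
Qed.

Let formC M N : form M N = form N M.
Proof.
by rewrite !formE; apply: eq_bigr => i _; apply: eq_bigr => j _; rewrite mulrC.
Qed.

Let formDl M N K : form (M + N) K = form M K + form N K.
Proof. by rewrite /form linearD mulmxDl mxtraceD. Qed.

Let formZl a M N : form (a *: M) N = a * form M N.
Proof. by rewrite /form linearZ -scalemxAl mxtraceZ. Qed.

Let form_ge0 M : 0 <= form M M.
Proof.
by rewrite formE; do 2!apply: sumr_ge0 => ? _; rewrite -expr2 sqr_ge0.
Qed.

Let form_eq0 M : form M M = 0 -> M = 0.
Proof.
rewrite formE => /eqP; rewrite psumr_eq0 => [/allP M0|i _]; last first.
  by apply: sumr_ge0 => ? _; rewrite -expr2 sqr_ge0.
apply/matrixP => i j; rewrite mxE.
have := M0 j (mem_index_enum j); rewrite psumr_eq0 => [/allP|k _]; last first.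
  by rewrite -expr2 sqr_ge0.
by move=> /(_ i (mem_index_enum i)); rewrite mulf_eq0 orbb => /eqP.
Qed.

HB.instance Definition _ :=
  Vector_hasDotp.Build R (fmx R m n) formC formDl formZl form_ge0 form_eq0.

End FmxEuclidean.

Definition fro {R : realType} {m n} (M : 'M[R]_(m, n)) : R := `|(M : fmx R m n)|.

Definition inn {R : realType} {m n} (M N : 'M[R]_(m, n)) : R := \tr (M^T *m N).

Section Frobenius.
Context {R : realType}.

Section Basic.
Context {m n : nat}.
Implicit Types M N K : 'M[R]_(m, n).

Lemma innC M N : inn M N = inn N M.
Proof. exact: (@dotpC _ (fmx R m n)). Qed.
Lemma innDl M N K : inn (M + N) K = inn M K + inn N K.
Proof. exact: (@dotpDl _ (fmx R m n)). Qed.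
Lemma innDr M N K : inn M (N + K) = inn M N + inn M K.
Proof. exact: (@dotpDr _ (fmx R m n)). Qed.
Lemma innNl M N : inn (- M) N = - inn M N.
Proof. exact: (@dotpNl _ (fmx R m n)). Qed.
Lemma innNr M N : inn M (- N) = - inn M N.
Proof. exact: (@dotpNr _ (fmx R m n)). Qed.
Lemma innZl a M N : inn (a *: M) N = a * inn M N.
Proof. exact: (@dotpZl _ (fmx R m n)). Qed.
Lemma innZr a M N : inn M (a *: N) = a * inn M N.
Proof. exact: (@dotpZr _ (fmx R m n)). Qed.
Lemma inn0l M : inn 0 M = 0.
Proof. exact: (@dotp0l _ (fmx R m n)). Qed.
Lemma inn0r M : inn M 0 = 0.
Proof. exact: (@dotp0r _ (fmx R m n)). Qed.
Definition innE := (innDl, innDr, innNl, innNr, innZl, innZr, inn0l, inn0r).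
Lemma innMM M : inn M M = fro M ^+ 2.
Proof. exact: (@dotpvv _ (fmx R m n)). Qed.
Lemma inn_le M N : inn M N <= fro M * fro N.
Proof. exact: (@dotp_le _ (fmx R m n)). Qed.
Lemma inn_norm_le M N : `|inn M N| <= fro M * fro N.
Proof. exact: (@dotp_norm_le _ (fmx R m n)). Qed.
Lemma fro_ge0 M : 0 <= fro M. Proof. exact: normr_ge0. Qed.
Lemma froD M N : fro (M + N) <= fro M + fro N.
Proof. exact: (@ler_normD _ (fmx R m n)). Qed.
Lemma froB M N : fro (M - N) <= fro M + fro N.
Proof. exact: (@ler_normB _ (fmx R m n)). Qed.
Lemma froN M : fro (- M) = fro M.
Proof. exact: (@normrN _ (fmx R m n)). Qed.
Lemma froZ a M : fro (a *: M) = `|a| * fro M.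
Proof. exact: (@normrZ _ (fmx R m n)). Qed.
Lemma fro0 : fro (0 : 'M[R]_(m, n)) = 0.
Proof. exact: (@normr0 _ (fmx R m n)). Qed.
Lemma fro0_eq0 M : fro M = 0 -> M = 0.
Proof. exact: (@normr0_eq0 _ (fmx R m n)). Qed.
Lemma inn_eq0 M : inn M M = 0 -> M = 0.
Proof. exact: (@dotpvv_eq0 _ (fmx R m n)). Qed.
Lemma fro_sq M : fro M ^+ 2 = \sum_i \sum_j (M i j ^+ 2).
Proof.
rewrite -innMM exchange_big; apply: eq_bigr => i _; rewrite mxE.
by apply: eq_bigr => j _; rewrite mxE expr2.
Qed.
End Basic.

Lemma fro_tr {m n} (M : 'M[R]_(m, n)) : fro (M^T) = fro M.
Proof.
apply/eqP; rewrite -(@eqrXn2 _ 2%N) ?fro_ge0// -!innMM /inn trmxK.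
by rewrite mxtrace_mulC.
Qed.

Lemma inn_mull {m n p} (M : 'M[R]_(m, n)) (N : 'M[R]_(n, p)) K :
  inn (M *m N) K = inn N (M^T *m K).
Proof. by rewrite /inn trmx_mul mulmxA. Qed.

Lemma inn_mulr {m n p} (M : 'M[R]_(m, n)) (N : 'M[R]_(n, p)) K :
  inn (M *m N) K = inn M (K *m N^T).
Proof. by rewrite /inn trmx_mul -mulmxA mxtrace_mulC mulmxA. Qed.

Lemma fro_mul {m n p} (M : 'M[R]_(m, n)) (N : 'M[R]_(n, p)) :
  fro (M *m N) <= fro M * fro N.
Proof.
rewrite -(ler_pXn2r (n := 2)) ?nnegrE ?mulr_ge0 ?fro_ge0// exprMn !fro_sq.
rewrite [X in _ * X]exchange_big mulr_suml; apply: ler_sum => i _ /=.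
rewrite mulr_sumr; apply: ler_sum => j _.
have -> : (M *m N) i j = inn ((row i M)^T) (col j N).
  rewrite /inn trmxK /mxtrace big_ord1 !mxE.
  by apply: eq_bigr => k _; rewrite !mxE.
have -> : \sum_k (M i k ^+ 2) = fro ((row i M)^T) ^+ 2.
  by rewrite fro_tr fro_sq big_ord1; apply: eq_bigr => k _; rewrite mxE.
have -> : \sum_k (N k j ^+ 2) = fro (col j N) ^+ 2.
  by rewrite fro_sq; apply: eq_bigr => k _; rewrite big_ord1 mxE.
rewrite -exprMn -ler_sqrt ?exprn_ge0 ?mulr_ge0 ?fro_ge0// !sqrtr_sqr.
by rewrite [leRHS]ger0_norm ?mulr_ge0 ?fro_ge0// inn_norm_le.
Qed.

Lemma symmx_norm {n} (S : symmx R n) : `|S| = fro S.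
Proof.
by apply/eqP; rewrite -(@eqrXn2 _ 2%N) ?fro_ge0// -innMM -dotpvv.
Qed.

Lemma symmx_dotp {n} (S T : symmx R n) : dotp S T = inn S T.
Proof. by []. Qed.

Lemma symmx_exists {n} (M : 'M[R]_n) : M^T = M -> exists S : symmx R n, (S : 'M[R]_n) = M.
Proof.
move=> MT; have MF : M \in fixedSpace (linfun (@trmx R n n)).
  by apply/fixedSpaceP; rewrite lfunE/= MT.
by exists (Subvs MF).
Qed.

End Frobenius.

Section Spectral.
Context {R : realType}.

Definition quad {n} (M : 'M[R]_n) (u : 'cV[R]_n) : R := inn u (M *m u).

Lemma quadE n (M : 'M[R]_n) u : (u^T *m M *m u) 0 0 = quad M u.
Proof. by rewrite /quad /inn /mxtrace big_ord1 mulmxA. Qed.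

Lemma psdP n (M : 'M[R]_n) : psd M <-> M^T = M /\ forall u, 0 <= quad M u.
Proof. by split=> -[MT h]; split=> // u; have := h u; rewrite quadE. Qed.

Lemma quad_le n (M : 'M[R]_n) u : `|quad M u| <= fro M * fro u ^+ 2.
Proof.
apply: le_trans (inn_norm_le _ _) _.
rewrite expr2 mulrA mulrC ler_wpM2r ?fro_ge0//; exact: fro_mul.
Qed.

Lemma inn_sym n (M : 'M[R]_n) (u v : 'cV[R]_n) : M^T = M -> inn u (M *m v) = inn v (M *m u).
Proof. by move=> MT; rewrite innC inn_mull MT. Qed.

Lemma quadD n (M : 'M[R]_n) (u v : 'cV[R]_n) : M^T = M ->
  quad M (u + v) = quad M u + 2 * inn u (M *m v) + quad M v.
Proof.
move=> MT; rewrite /quad mulmxDr !innE (inn_sym v u MT); ring.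
Qed.

Lemma quadZ n (M : 'M[R]_n) a u : quad M (a *: u) = a ^+ 2 * quad M u.
Proof. by rewrite /quad -scalemxAr !innE mulrA. Qed.

(** Otherwise the form would be negative at [u - t *: (M *m u)] for a small
  [t > 0]. *)
Lemma psd_quad0 n (M : 'M[R]_n) u : psd M -> quad M u = 0 -> M *m u = 0.
Proof.
move=> /psdP[MT M0] u0; apply: inn_eq0; rewrite innMM.
set v := M *m u.
have vE : inn v (M *m u) = fro v ^+ 2 by rewrite innMM.
set q := fro v ^+ 2 in vE *; have q0 : 0 <= q by rewrite sqr_ge0.
pose b := quad M v; have b0 : 0 <= b by exact: M0.
have := M0 (u + (- (q / (b + 1))) *: v).
rewrite quadD// u0 quadZ -scalemxAr innZr (inn_sym u v MT) vE -/b.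
have b1 : 0 < b + 1 by lra.
have := divfK (lt0r_neq0 b1) q.
set t := q / (b + 1) => tq h.
have t0 : 0 <= t by rewrite divr_ge0// ltW.
have : t * (2 * q - t * b) <= 0 by lra.
nra.
Qed.

(** Let [u] maximise the form of [M] on the unit sphere and [l] be the maximum:
  [l - M] is semidefinite and its form vanishes at [u], so it annihilates [u]. *)
Lemma eigenvector_max n (M : 'M[R]_n.+1) : M^T = M ->
  exists (l : R) (u : 'cV[R]_n.+1), [/\ fro u = 1, M *m u = l *: u & forall v, quad M v <= l * fro v ^+ 2].
Proof.
move=> MT; pose C : set (fmx R n.+1 1) := [set u | `|u| = 1].
pose Ml : {linear fmx R n.+1 1 -> fmx R n.+1 1} := mulmx M.
(* minus twice the quadratic form, written with norms *)
pose F (u : fmx R n.+1 1) : R := `|u| ^+ 2 + `|Ml u| ^+ 2 - `|u + Ml u| ^+ 2.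
have FE u : F u = - (2 * dotp u (Ml u)) by rewrite /F normDsq; ring.
have dc : continuous (fun u : fmx R n.+1 1 => `|u| : R) by exact: norm_continuous.
have Fc : continuous F.
  apply: continuous_sub; [apply: continuous_add|]; apply: continuous_normsq.
  - by move=> x; exact: cvg_id.
  - exact: euclid_linear_continuous.
  - apply: continuous_add; [by move=> x; exact: cvg_id|exact: euclid_linear_continuous].
have [||u uC|u _|u Cu umin] := @exists_argmin R (fmx R n.+1 1) C 1 F.
- pose e : fmx R n.+1 1 := delta_mx 0 0; exists e; rewrite /C/=.
  apply/eqP; rewrite -(@eqrXn2 _ 2%N)// expr1n; apply/eqP.
  rewrite [LHS](fro_sq (e : 'M[R]_(_, _))) (bigD1 0)//= big_ord1 !mxE/= expr1n big1 ?addr0// => i i0.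
  by rewrite big_ord1 mxE (negPf i0) expr0n.
- rewrite (_ : C = (fun u => `|u|) @^-1` [set x | x = 1])//.
  by apply: (preimage_closed _ (@closed_eq _ 1)) => x _; exact: dc.
- by rewrite uC.
- exact: Fc.
have uQ : forall v : 'cV[R]_n.+1, quad M v <= quad M u * fro v ^+ 2.
  move=> v; have [v0|v0] := eqVneq (fro v) 0.
    by rewrite (fro0_eq0 v0) /quad mulmx0 inn0r fro0 expr0n mulr0.
  have vp : 0 < fro v by rewrite lt_def v0 fro_ge0.
  have : F u <= F ((fro v)^-1 *: v).
    apply: umin; rewrite /C/= normrZ ger0_norm ?invr_ge0 ?fro_ge0//.
    exact: mulVf.
  rewrite !FE lerN2 ler_pM2l//.
  have -> : dotp ((fro v)^-1 *: (v : fmx R n.+1 1)) (Ml ((fro v)^-1 *: (v : fmx R n.+1 1)))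
    = (fro v)^-1 ^+ 2 * quad M v by exact: quadZ.
  by rewrite exprVn ler_pdivrMl ?exprn_gt0// mulrC.
exists (quad M u), u; split => //.
have : psd ((quad M u)%:M - M).
  apply/psdP; split; first by rewrite linearB/= tr_scalar_mx MT.
  move=> v; rewrite /quad mulmxBl mul_scalar_mx innDr innNr innZr innMM subr_ge0.
  exact: uQ.
move=> /psd_quad0 -/(_ u).
rewrite {1}/quad mulmxBl mul_scalar_mx innDr innNr innZr innMM.
rewrite [X in X ^+ 2](_ : _ = 1)// expr1n mulr1 subrr => /(_ erefl)/eqP.
by rewrite subr_eq0 => /eqP.
Qed.

(** The Householder reflection that exchanges two unit vectors. *)
Lemma exists_reflection n (u e : 'cV[R]_n) : fro u = 1 -> fro e = 1 ->
  exists H : 'M[R]_n, [/\ H^T = H, H *m H = 1%:M & H *m e = u].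
Proof.
move=> u1 e1; have [->|ue] := eqVneq u e.
  by exists 1%:M; rewrite trmx1 !mul1mx.
pose w := u - e; pose c := 2 / fro w ^+ 2.
have w0 : fro w ^+ 2 != 0.
  by rewrite expf_eq0/=; apply: contra ue => /eqP/fro0_eq0/eqP; rewrite /w subr_eq0.
have wE : fro w ^+ 2 = 2 - 2 * inn u e.
  rewrite -innMM !innE !innMM u1 e1 (innC e u); ring.
have ww (x : 'cV[R]_n) : w *m w^T *m x = inn w x *: w.
  rewrite -mulmxA [w^T *m x]mx11_scalar mul_mx_scalar.
  by rewrite /inn /mxtrace big_ord1.
exists (1%:M - c *: (w *m w^T)); split.
- by rewrite linearB/= trmx1 linearZ/= trmx_mul trmxK.
- have wwww : w *m w^T *m (w *m w^T) = fro w ^+ 2 *: (w *m w^T).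
    by rewrite mulmxA ww innMM -scalemxAl.
  have cc : c * (c * fro w ^+ 2) = c + c by rewrite /c; field; move: w0; rewrite expf_eq0.
  rewrite mulmxBl mul1mx mulmxBr mulmx1 -scalemxAl -scalemxAr wwww !scalerA -mulrA cc.
  by rewrite scalerDl opprB addrK subrK.
- rewrite mulmxBl mul1mx -scalemxAl ww scalerA.
  have -> : c * inn w e = -1.
    rewrite /c wE !innE innMM e1; rewrite wE in w0; field.
    by apply: contra w0 => /eqP h; apply/eqP; lra.
  by rewrite scaleN1r opprK /w addrC subrK.
Qed.

(** A reflection takes the first basis vector to an eigenvector, which leaves a
  symmetric block of size [n] for the induction.  Taking the largest eigenvalue
  first makes the list of eigenvalues nonincreasing. *)
Lemma spectral_sorted n (M : 'M[R]_n) : M^T = M ->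
  exists (P : 'M[R]_n) (d : 'rV[R]_n),
   [/\ P^T *m P = 1%:M, M = P *m diag_mx d *m P^T &
       forall i j : 'I_n, (i <= j)%N -> d 0 j <= d 0 i].
Proof.
elim: n M => [|n IH]; last first.
  rewrite -[n.+1]/(1 + n)%N => M MT.
have [l [u [u1 Mu lmax]]] : exists (l : R) (u : 'cV[R]_(1 + n)),
  [/\ fro u = 1, M *m u = l *: u & forall v, quad M v <= l * fro v ^+ 2].
  exact: (@eigenvector_max n M).
pose e : 'cV[R]_(1 + n) := delta_mx 0 0.
have e1 : fro e = 1.
  apply/eqP; rewrite -(@eqrXn2 _ 2%N) ?fro_ge0// expr1n; apply/eqP.
  rewrite fro_sq (bigD1 0)//= big_ord1 !mxE/= expr1n big1 ?addr0// => i i0.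
  by rewrite big_ord1 mxE (negPf i0) expr0n.
have [H [HT HH He]] := exists_reflection u1 e1.
have [N Ndef] : {N : 'M[R]_(1 + n) | N = H *m M *m H} by exists (H *m M *m H).
have NT : N^T = N by rewrite Ndef !trmx_mul HT MT mulmxA.
have Ne : N *m e = l *: e.
  by rewrite Ndef -mulmxA He -mulmxA Mu -scalemxAr -He mulmxA HH mul1mx.
pose N' := drsubmx N.
have N'T : N'^T = N' by rewrite /N' trmx_drsub NT.
have NE : N = block_mx l%:M 0 0 N'.
  have Ncol i : N i 0 = l * (i == 0)%:R.
    by have := congr1 (fun K : 'M[R]_(_, _) => K i 0) Ne; rewrite -colE !mxE eqxx andbT.
  have e0 : lshift n (0 : 'I_1) = 0 :> 'I_(1 + n) by exact/val_inj.
  have ulE : ulsubmx N = l%:M.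
    by apply/matrixP => i j; rewrite !ord1 !mxE e0 Ncol !eqxx mulr1.
  have dlE : dlsubmx N = 0.
    by apply/matrixP => i j; rewrite !ord1 !mxE e0 Ncol (_ : (_ == 0) = false) ?mulr0.
  rewrite -[LHS]submxK ulE dlE; congr block_mx.
  by rewrite -[LHS]trmxK trmx_ursub NT dlE trmx0.
have [P [d [PP N'E dd]]] := IH N' N'T.
pose Q : 'M[R]_(1 + n) := block_mx 1%:M 0 0 P.
have QT : Q^T = block_mx 1%:M 0 0 P^T by rewrite tr_block_mx !trmx0 trmx1.
have QQ : Q^T *m Q = 1%:M.
  rewrite QT mulmx_block !mulmx0 !mul0mx !addr0 !add0r mul1mx PP.
  by rewrite -scalar_mx_block.
exists (H *m Q), (row_mx (\row_(i < 1) l) d); split.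
- by rewrite trmx_mul HT mulmxA -(mulmxA Q^T) HH mulmx1.
- rewrite trmx_mul HT.
  have -> : M = H *m N *m H by rewrite Ndef !mulmxA HH mul1mx -mulmxA HH mulmx1.
  rewrite -!mulmxA; congr (_ *m _); rewrite !mulmxA; congr (_ *m _).
  rewrite NE QT diag_mx_row !mulmx_block !mulmx0 !mul0mx !addr0 !add0r mul1mx mulmx1.
  rewrite N'E !mul0mx; congr block_mx.
  by apply/matrixP => i j; rewrite !ord1 !mxE.
have dl j : d 0 j <= l.
  pose v := H *m Q *m delta_mx (rshift 1 j) 0 : 'cV[R]_(1 + n).
  have v1 : fro v ^+ 2 = 1.
    rewrite -innMM /v -mulmxA inn_mull HT mulmxA mulmxA HH mul1mx inn_mull mulmxA QQ mul1mx.
    rewrite innMM fro_sq (bigD1 (rshift 1 j))//= big_ord1 !mxE !eqxx expr1n big1 ?addr0//.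
    by move=> i /negPf ij; rewrite big_ord1 mxE ij expr0n.
  have := lmax v; rewrite v1 mulr1; apply: le_trans.
  rewrite le_eqVlt; apply/orP; left; apply/eqP.
  have -> : quad M v = quad (diag_mx d) (delta_mx j 0).
    have -> : M = H *m N *m H by rewrite Ndef !mulmxA HH mul1mx -mulmxA HH mulmx1.
    rewrite /quad /v -!mulmxA (mulmxA H H) HH mul1mx.
    rewrite inn_mull HT mulmxA HH mul1mx NE.
    have -> : Q *m delta_mx (rshift 1 j) 0 = col_mx 0 (P *m delta_mx j 0) :> 'cV[R]_(1 + n).
      have -> : delta_mx (rshift 1 j) 0 = col_mx 0 (delta_mx j 0) :> 'cV[R]_(1 + n).
        apply/matrixP => i k; rewrite !ord1 -[i](@splitK 1 n).
        case: (fintype.split i) => t; rewrite /= ?col_mxEu ?col_mxEd !mxE ?eq_rshift//.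
        by rewrite eq_lrshift.
      by rewrite /Q mul_block_col !mulmx0 !mul0mx !add0r.
    rewrite mul_block_col !mulmx0 !mul0mx addr0 add0r /inn tr_col_mx mul_row_col.
    rewrite mulmx0 add0r N'E -!/(inn _ _) inn_mull !mulmxA PP mul1mx -!mulmxA.
    by rewrite (mulmxA P^T) PP mul1mx.
  rewrite /quad /inn /mxtrace big_ord1 mul_diag_mx mxE (bigD1 j)//= !mxE !eqxx mul1r mulr1.
  by rewrite big1 ?addr0// => i /negPf ij; rewrite !mxE ij mul0r.
move=> i j ij; rewrite !mxE.
case: (splitP j) => j' jj; case: (splitP i) => i' ii; rewrite ?mxE//.
- by have := ltn_ord j'; rewrite -jj ltnNge (leq_trans _ ij)// ii.
- by apply: dd; move: ij; rewrite ii jj leq_add2l.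
by move=> M _; exists 1%:M, 0; split=> [||[]//]; apply/matrixP => -[].
Qed.

End Spectral.


(** * The cone of positive semidefinite matrices *)

Section Semidefinite.
Context {R : realType}.

Lemma psd_tr n (M : 'M[R]_n) : psd M -> M^T = M.
Proof. by move=> /psdP[]. Qed.

Lemma psd_quad n (M : 'M[R]_n) u : psd M -> 0 <= quad M u.
Proof. by move=> /psdP[_]; apply. Qed.

Lemma quad_addl n (M N : 'M[R]_n) u : quad (M + N) u = quad M u + quad N u.
Proof. by rewrite /quad mulmxDl innDr. Qed.

Lemma quad_scalel n a (M : 'M[R]_n) u : quad (a *: M) u = a * quad M u.
Proof. by rewrite /quad -scalemxAl innZr. Qed.

Lemma quad_oppl n (M : 'M[R]_n) u : quad (- M) u = - quad M u.
Proof. by rewrite /quad mulNmx innNr. Qed.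

Lemma quad_scalar n a (u : 'cV[R]_n) : quad a%:M u = a * fro u ^+ 2.
Proof. by rewrite /quad mul_scalar_mx innZr innMM. Qed.

Lemma psd_add n (M N : 'M[R]_n) : psd M -> psd N -> psd (M + N).
Proof.
move=> /psdP[MT M0] /psdP[NT N0]; apply/psdP; split; first by rewrite linearD/= MT NT.
by move=> u; rewrite quad_addl addr_ge0.
Qed.

Lemma psd_scale n a (M : 'M[R]_n) : 0 <= a -> psd M -> psd (a *: M).
Proof.
move=> a0 /psdP[MT M0]; apply/psdP; split; first by rewrite linearZ/= MT.
by move=> u; rewrite quad_scalel mulr_ge0.
Qed.

Lemma psd0 n : psd (0 : 'M[R]_n).
Proof. by apply/psdP; split=> [|u]; rewrite ?trmx0// /quad mul0mx inn0r. Qed.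

Lemma psd_conj n p (M : 'M[R]_n) (U : 'M[R]_(p, n)) : psd M -> psd (U *m M *m U^T).
Proof.
move=> /psdP[MT M0]; apply/psdP; split; first by rewrite !trmx_mul MT trmxK mulmxA.
by move=> u; rewrite /quad -!mulmxA innC inn_mull innC; exact: M0.
Qed.

Lemma psd_gram n p (F : 'M[R]_(n, p)) : psd (F *m F^T).
Proof.
apply/psdP; split; first by rewrite trmx_mul trmxK.
by move=> u; rewrite /quad -mulmxA innC inn_mull innMM sqr_ge0.
Qed.

Lemma psd_spectral n (M : 'M[R]_n) : psd M ->
  exists (P : 'M[R]_n) (d : 'rV[R]_n),
   [/\ P^T *m P = 1%:M, M = P *m diag_mx d *m P^T & forall i, 0 <= d 0 i].
Proof.
move=> Mp; have [P [d [PP ME _]]] := spectral_sorted (psd_tr Mp).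
exists P, d; split=> // i.
have := psd_quad (P *m delta_mx i 0) Mp.
rewrite /quad ME -!mulmxA (mulmxA P^T) PP mul1mx inn_mull mulmxA PP mul1mx.
rewrite /inn /mxtrace big_ord1 mul_diag_mx mxE (bigD1 i)//= !mxE !eqxx mul1r mulr1.
by rewrite big1 ?addr0// => j /negPf ji; rewrite !mxE ji mul0r.
Qed.

Lemma diag_gram n (P : 'M[R]_n) (d : 'rV[R]_n) : (forall i, 0 <= d 0 i) ->
  exists F : 'M[R]_n, P *m diag_mx d *m P^T = F *m F^T.
Proof.
move=> d0; exists (P *m diag_mx (map_mx Num.sqrt d)); rewrite trmx_mul tr_diag_mx.
rewrite -!mulmxA; congr (_ *m _); rewrite !mulmxA; congr (_ *m _).
rewrite mul_diag_mx; apply/matrixP => i j; rewrite !mxE.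
by case: eqVneq => [->|_]; rewrite ?mulr0n ?mulr0// !mulr1n -expr2 sqr_sqrtr.
Qed.

Lemma psd_diag n (P : 'M[R]_n) (d : 'rV[R]_n) : (forall i, 0 <= d 0 i) ->
  psd (P *m diag_mx d *m P^T).
Proof. by move=> /(diag_gram P)[F ->]; exact: psd_gram. Qed.

Lemma psd_factor n (M : 'M[R]_n) : psd M -> exists F : 'M[R]_n, M = F *m F^T.
Proof. by move=> /psd_spectral[P [d [_ -> /(diag_gram P)]]]. Qed.

(** Writing [S = E E^T] and [T = F F^T], the trace of [S T] is the squared norm
  of [E^T F], and [S T = E (E^T F) F^T]. *)
Lemma psd_inn_ge n (S T : 'M[R]_n) : psd S -> psd T ->
  fro (S *m T) ^+ 2 <= \tr S * \tr T * inn S T.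
Proof.
move=> /psd_factor[E SE] /psd_factor[F TE].
have -> : \tr S = fro E ^+ 2 by rewrite SE mxtrace_mulC -innMM.
have -> : \tr T = fro F ^+ 2 by rewrite TE mxtrace_mulC -innMM.
have -> : inn S T = fro (E^T *m F) ^+ 2.
  by rewrite -innMM SE TE inn_mull inn_mulr !mulmxA.
have -> : S *m T = E *m (E^T *m F) *m F^T by rewrite SE TE !mulmxA.
rewrite -!exprMn ler_pXn2r ?nnegrE ?mulr_ge0 ?fro_ge0//.
apply: le_trans (fro_mul _ _) _; rewrite fro_tr mulrAC ler_wpM2r ?fro_ge0//.
exact: fro_mul.
Qed.

Lemma psd_trace_ge0 n (S : 'M[R]_n) : psd S -> 0 <= \tr S.
Proof. by move=> /psd_factor[E ->]; rewrite mxtrace_mulC -[\tr _]/(inn E E) innMM sqr_ge0. Qed.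

Lemma psd_inn_ge0 n (S T : 'M[R]_n) : psd S -> psd T -> 0 <= inn S T.
Proof.
move=> /psd_factor[E ->] /psd_factor[F ->].
have -> : inn (E *m E^T) (F *m F^T) = fro (E^T *m F) ^+ 2.
  by rewrite -innMM inn_mull inn_mulr !mulmxA.
exact: sqr_ge0.
Qed.

Lemma psd_inn_eq0 n (S T : 'M[R]_n) : psd S -> psd T -> inn S T = 0 -> S *m T = 0.
Proof.
move=> Sp Tp ST0; have := psd_inn_ge Sp Tp; rewrite ST0 mulr0 => h.
by apply/inn_eq0/eqP; rewrite innMM eq_le h sqr_ge0.
Qed.

(** The Moore-Penrose inverse [G] of [M]; the bound is the gap between [0] and
  the positive eigenvalues. *)
Lemma psd_pinv n (M : 'M[R]_n) : psd M -> exists (G : 'M[R]_n) (l : R),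
  [/\ G^T = G /\ 0 < l, M *m G = G *m M, M *m G *m M = M, G *m M *m G = G &
      forall u, l * fro (M *m G *m u) ^+ 2 <= quad M u].
Proof.
move=> Mp; have [P [d [PP ME d0]]] := psd_spectral Mp.
pose g : 'rV[R]_n := map_mx (fun x => x^-1) d.
have PDD (a b : 'rV[R]_n) : (P *m diag_mx a *m P^T) *m (P *m diag_mx b *m P^T) =
    P *m diag_mx (\row_i (a 0 i * b 0 i)) *m P^T.
  by rewrite -!mulmxA (mulmxA P^T) PP mul1mx (mulmxA (diag_mx a)) mulmx_diag.
exists (P *m diag_mx g *m P^T).
have gap : exists2 l : R, 0 < l & forall i, d 0 i != 0 -> l <= d 0 i.
  exists (\big[Num.min/1]_(i | d 0 i != 0) d 0 i).
    elim/big_ind : _ => // [x y x0 y0|i di]; first by rewrite lt_min x0.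
    by rewrite lt_def di d0.
  by move=> i di; exact: bigmin_le_cond.
have [l l0 ld] := gap.
have PTP : P *m P^T = 1%:M by exact: mulmx1C.
exists l; rewrite ME; split.
- by split=> //; rewrite !trmx_mul trmxK tr_diag_mx mulmxA.
- rewrite !PDD; congr (_ *m diag_mx _ *m _); apply/rowP => i.
  by rewrite !mxE mulrC.
- rewrite !PDD; congr (_ *m diag_mx _ *m _); apply/rowP => i; rewrite !mxE.
  by have [->|?] := eqVneq (d 0 i) 0; rewrite ?mulr0// divff// mul1r.
- rewrite !PDD; congr (_ *m diag_mx _ *m _); apply/rowP => i; rewrite !mxE.
  by have [->|?] := eqVneq (d 0 i) 0; rewrite ?invr0 ?mulr0// mulVf// mul1r.
move=> u; rewrite PDD; set b : 'rV[R]_n := \row_i _.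
have bb : b = \row_i (b 0 i * b 0 i).
  apply/rowP => i; rewrite !mxE.
  by have [->|?] := eqVneq (d 0 i) 0; rewrite ?mul0r// divff// mul1r.
have -> : fro (P *m diag_mx b *m P^T *m u) ^+ 2 = quad (P *m diag_mx b *m P^T) u.
  have bT : (P *m diag_mx b *m P^T)^T = P *m diag_mx b *m P^T.
    by rewrite !trmx_mul trmxK tr_diag_mx mulmxA.
  by rewrite -innMM inn_mull bT mulmxA PDD -bb.
rewrite -quad_scalel -subr_ge0 -quad_oppl -quad_addl; apply: psd_quad.
have -> : P *m diag_mx d *m P^T - l *: (P *m diag_mx b *m P^T) =
    P *m diag_mx (d - l *: b) *m P^T.
  have -> : diag_mx (d - l *: b) = diag_mx d - l *: diag_mx b.
    by apply/matrixP => i j; rewrite !mxE mulrnBl mulrnAr.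
  by rewrite mulmxBr mulmxBl -scalemxAr -scalemxAl.
apply: psd_diag => i; rewrite !mxE.
have [->|di] := eqVneq (d 0 i) 0; first by rewrite mul0r mulr0 subr0.
by rewrite divff// mulr1 subr_ge0 ld.
Qed.

End Semidefinite.


(** * Perturbation of a semidefinite matrix on two scales *)

Section TwoScale.
Context {R : realType}.

(** The mixed products are absorbed by the squares (Young's inequality): in the
  variables [A], [sqrt s * B] and [s * C] they have coefficients that tend to
  zero with [s]. *)
Lemma three_scale_form_ge0 (l mu dl K : R) : 0 < l -> 0 < mu -> 0 < dl -> 0 < K ->
  exists2 s0, 0 < s0 & forall s A B C, 0 < s < s0 ->
  0 <= (l - s * K) * A ^+ 2 + s * (mu - s * K) * B ^+ 2 + s ^+ 2 * (dl - s * K) * C ^+ 2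
    - 2 * s * K * (A * B) - 2 * s ^+ 2 * K * ((A + B) * C).
Proof.
move=> l0 mu0 dl0 K0.
pose k1 := K + 4 * K ^+ 2 / l; pose k2 := K + 4 * K ^+ 2 / l + 4 * K ^+ 2 / mu.
have k10 : 0 < k1 by rewrite addr_gt0 ?divr_gt0 ?mulr_gt0.
have k20 : 0 < k2 by rewrite addr_gt0 ?divr_gt0 ?mulr_gt0.
exists (Num.min 1 (Num.min (l / (2 * K)) (Num.min (mu / (2 * k1)) (dl / k2)))).
  by rewrite !lt_min ltr01 !divr_gt0 ?mulr_gt0.
move=> s A B C /andP[s0]; rewrite !lt_min => /and4P[s1 sl smu sdl].
have h1 : 2 * (s * K) <= l.
  by move: sl; rewrite ltr_pdivlMr ?mulr_gt0// mulrCA => /ltW.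
have h2 : 2 * (s * k1) <= mu.
  by move: smu; rewrite ltr_pdivlMr ?mulr_gt0// mulrCA => /ltW.
have h3 : s * k2 <= dl by move: sdl; rewrite ltr_pdivlMr// => /ltW.
have e1 : 0 <= l / 4 * (A - 4 * s * K / l * B) ^+ 2.
  by rewrite mulr_ge0 ?sqr_ge0 ?divr_ge0 ?ltW.
have e2 : 0 <= l / 4 * (A - 4 * s ^+ 2 * K / l * C) ^+ 2.
  by rewrite mulr_ge0 ?sqr_ge0 ?divr_ge0 ?ltW.
have e3 : 0 <= s * mu / 4 * (B - 4 * s * K / mu * C) ^+ 2.
  by rewrite mulr_ge0 ?sqr_ge0 ?divr_ge0 ?mulr_ge0 ?ltW.
have e4 : 0 <= (l / 2 - s * K) * A ^+ 2 by rewrite mulr_ge0 ?sqr_ge0//; lra.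
have e5 : 0 <= s * (3 * mu / 4 - s * k1) * B ^+ 2.
  by rewrite mulr_ge0 ?sqr_ge0// mulr_ge0 ?ltW//; lra.
have e6 : 0 <= s ^+ 2 * (dl - s * k2 + s * (1 - s) * (4 * K ^+ 2 / l)) * C ^+ 2.
  rewrite mulr_ge0 ?sqr_ge0// mulr_ge0 ?sqr_ge0// addr_ge0 ?subr_ge0//.
  by rewrite !mulr_ge0 ?subr_ge0 ?ltW ?invr_gt0 ?exprn_gt0.
have := addr_ge0 e1 (addr_ge0 e2 (addr_ge0 e3 (addr_ge0 e4 (addr_ge0 e5 e6)))).
rewrite /k1 /k2; congr (0 <= _); field.
by rewrite !gt_eqF.
Qed.

(** [X], [G] is a semidefinite matrix with its Moore-Penrose inverse, and the
  identity splits as [X G + Pb + Pg].  The perturbation [s V + s^2 Y] is of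
  order [s] and positive on the range of [Pb], and on the range of [Pg] its
  Schur complement with respect to [X] is [s^2 dl + O(s^3)]. *)
Lemma psd_two_scale n (X G Pb Pg V Y : 'M[R]_n) (l mu dl : R) :
  X^T = X -> V^T = V -> Y^T = Y -> G^T = G -> Pg^T = Pg ->
  X *m G = G *m X -> X *m G *m X = X -> G *m X *m G = G ->
  0 < l -> (forall u, l * fro (X *m G *m u) ^+ 2 <= quad X u) ->
  X *m G + Pb + Pg = 1%:M -> X *m Pb = 0 -> X *m Pg = 0 -> Pg *m Pg = Pg ->
  V *m Pg = X *m G *m V *m Pg ->
  Pg *m Y *m Pg = Pg *m V *m G *m V *m Pg + dl *: Pg ->
  0 < mu -> (forall u, mu * fro (Pb *m u) ^+ 2 <= quad V (Pb *m u)) ->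
  0 < dl ->
  exists s0 C : R, [/\ 0 < s0, 0 <= C & forall s, 0 < s < s0 ->
    let M := X + s *: V + s ^+ 2 *: Y in
    let U := 1%:M - s *: (G *m V) in
    psd M /\ fro (Pg *m U^T *m M *m U *m Pg) <= s ^+ 2 * (dl * fro Pg + C * s)].
Proof.
move=> XT VT YT GT PgT XG XGX GXG l0 lX PE XPb XPg PgPg VPg PgYPg mu0 muV dl0.
pose r s := Y - V *m G *m V - s *: (Y *m G *m V).
pose Cr := fro (Y - V *m G *m V) + fro (Y *m G *m V).
have Cr0 : 0 <= Cr by rewrite addr_ge0 ?fro_ge0.
have rC s : 0 < s <= 1 -> fro (r s) <= Cr.
  move=> /andP[s0 s1]; apply: le_trans (froB _ _) _; rewrite lerD2l froZ gtr0_norm//.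
  by rewrite -[leRHS]mul1r ler_wpM2r ?fro_ge0.
have MU s : (X + s *: V + s ^+ 2 *: Y) *m (1%:M - s *: (G *m V)) *m Pg = s ^+ 2 *: (r s *m Pg).
  rewrite mulmxBr mulmx1 !(mulmxDl, mulmxDr, mulNmx) XPg add0r.
  rewrite -!scalemxAr -!scalemxAl !mulmxA VPg.
  rewrite /r !(mulmxDl, mulmxDr, mulNmx, scalerDr, scalerN) -?scalemxAl ?scalerA.
  rewrite -!mulmxA.
  set a := X *m _; set b := Y *m _; set c := V *m _; set d := Y *m _.
  have -> : s * s = s ^+ 2 by rewrite expr2.
  have -> : s * s ^+ 2 = s ^+ 2 * s by rewrite mulrC.
  by rewrite !opprD !addrA (addrAC (s *: a)) subrr add0r.
pose C1 := fro (Y *m G *m V) + fro (G *m V) * Cr.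
have C10 : 0 <= C1 by rewrite addr_ge0 ?mulr_ge0 ?fro_ge0.
have [s0 s00 sform] := @three_scale_form_ge0 l mu dl (1 + fro V + fro Y + C1 + Cr)
  l0 mu0 dl0 ltac:(have := fro_ge0 V; have := fro_ge0 Y; lra).
set K := 1 + _ + _ + _ + _ in sform.
pose C2 := fro Pg * (fro (Y *m G *m V) + fro (V *m G) * Cr) * fro Pg.
exists (Num.min s0 1), C2; split.
- by rewrite lt_min s00 ltr01.
- by rewrite !mulr_ge0 ?addr_ge0 ?mulr_ge0 ?fro_ge0.
move=> s /andP[sgt0]; rewrite lt_min => /andP[ss0 s1] M U.
have s01 : 0 < s <= 1 by rewrite sgt0 ltW.
have UT : U^T = 1%:M - s *: (V *m G).
  by rewrite /U linearB/= trmx1 linearZ/= trmx_mul GT VT.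
have PrP : Pg *m (Y - V *m G *m V) *m Pg = dl *: Pg.
  by rewrite mulmxBr mulmxBl PgYPg !mulmxA addrAC subrr add0r.
split; last first.
  have -> : Pg *m U^T *m M *m U *m Pg = s ^+ 2 *: (dl *: Pg -
      s *: (Pg *m (Y *m G *m V + V *m G *m r s) *m Pg)).
    rewrite -!mulmxA (mulmxA M) MU -scalemxAr -scalemxAr; congr (_ *: _).
    rewrite UT -PrP mulmxBl mul1mx mulmxBr -scalemxAl -scalemxAr.
    have : r s = Y - V *m G *m V - s *: (Y *m G *m V) by [].
    move: (r s) (Y - V *m G *m V) => rr Z rE.
    rewrite {1}rE [(Z - _) *m Pg]mulmxBl mulmxBr -scalemxAl -scalemxAr mulmxDl mulmxDr scalerDr.
    by rewrite opprD !mulmxA addrA.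
  rewrite froZ ger0_norm ?sqr_ge0// ler_wpM2l ?sqr_ge0//.
  apply: le_trans (froB _ _) _; rewrite !froZ !gtr0_norm// lerD2l mulrC.
  apply: ler_wpM2r; first exact: ltW.
  apply: le_trans (fro_mul _ _) _; rewrite ler_wpM2r ?fro_ge0//.
  apply: le_trans (fro_mul _ _) _; rewrite ler_wpM2l ?fro_ge0//.
  apply: le_trans (froD _ _) _; rewrite lerD2l.
  by apply: le_trans (fro_mul _ _) _; rewrite ler_wpM2l ?fro_ge0// rC.
have MT : M^T = M by rewrite !linearD/= !linearZ/= XT VT YT.
apply/psdP; split=> // u.
pose g := Pg *m u; pose b := Pb *m u; pose a := X *m G *m u + s *: (G *m V *m g).
(* In this decomposition the blocks of [M] between [a + b] and [U *m g] are
  of order [s ^+ 2]. *)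
have uE : u = a + b + U *m g.
  rewrite /a /U mulmxBl mul1mx -scalemxAl; set h := s *: _.
  have -> : X *m G *m u + h + b + (g - h) = X *m G *m u + b + g.
    by rewrite -!addrA; congr (_ + _); rewrite addrCA; congr (_ + _); rewrite addrC subrK.
  by rewrite -[in LHS](mul1mx u) -PE !mulmxDl.
have aE : X *m G *m a = a.
  have e1 : X *m G *m (X *m G *m u) = X *m G *m u by rewrite !mulmxA XGX.
  have e2 : X *m G *m (G *m V *m g) = G *m V *m g by rewrite XG !mulmxA GXG.
  by rewrite /a mulmxDr -scalemxAr e1 e2.
have gE : Pg *m g = g by rewrite /g mulmxA PgPg.
have Xb : X *m b = 0 by rewrite /b mulmxA XPb mul0mx.
have MUg : M *m (U *m g) = s ^+ 2 *: (r s *m g).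
  by rewrite /g !mulmxA MU -!scalemxAl.
set v := fro V; set y := fro Y.
have v0 : 0 <= v by exact: fro_ge0.
have y0 : 0 <= y by exact: fro_ge0.
set A := fro a; set B := fro b; set Gn := fro g.
have A0 : 0 <= A by exact: fro_ge0.
have B0 : 0 <= B by exact: fro_ge0.
have Gn0 : 0 <= Gn by exact: fro_ge0.
have s2 : s ^+ 2 <= s by rewrite expr2 ler_piMl ?ltW.
have qUg : s ^+ 2 * (dl - s * C1) * Gn ^+ 2 <= quad M (U *m g).
  rewrite /quad MUg innZr -mulrA ler_wpM2l ?sqr_ge0//.
  rewrite /U mulmxBl mul1mx -scalemxAl innDl innNl innZl.
  have -> : inn g (r s *m g) = dl * Gn ^+ 2 - s * inn g (Y *m G *m V *m g).
    rewrite /r mulmxBl -scalemxAl innDr innNr innZr; congr (_ - _).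
    have -> : inn g ((Y - V *m G *m V) *m g) = inn u (dl *: Pg *m u).
      by rewrite -PrP {1}/g inn_mull PgT /g !mulmxA.
    by rewrite -scalemxAl innZr /Gn -innMM /g inn_mull PgT mulmxA PgPg.
  have h1 : inn g (Y *m G *m V *m g) <= fro (Y *m G *m V) * Gn ^+ 2.
    by apply: le_trans (quad_le _ _); exact: ler_norm.
  have h2 : inn (G *m V *m g) (r s *m g) <= fro (G *m V) * Cr * Gn ^+ 2.
    apply: le_trans (inn_le _ _) _; rewrite expr2 mulrACA ler_pM ?fro_ge0//.
      exact: fro_mul.
    by apply: le_trans (fro_mul _ _) _; rewrite ler_wpM2r ?fro_ge0// rC.
  have := ler_wpM2l (ltW sgt0) (lerD h1 h2); rewrite /C1; lra.
have qa : (l - s * (v + y)) * A ^+ 2 <= quad M a.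
  rewrite !quad_addl !quad_scalel.
  have h1 := lX a; rewrite aE -/A in h1.
  have := quad_le V a; rewrite -/A -/v ler_norml => /andP[h2 _].
  have := quad_le Y a; rewrite -/A -/y ler_norml => /andP[h3 _].
  have := ler_wpM2l (ltW sgt0) h2.
  have := ler_wpM2l (sqr_ge0 s) h3.
  have := ler_wpM2r (mulr_ge0 y0 (sqr_ge0 A)) s2; lra.
have qb : s * (mu - s * y) * B ^+ 2 <= quad M b.
  rewrite !quad_addl !quad_scalel {1}/quad Xb inn0r add0r.
  have := ler_wpM2l (ltW sgt0) (muV u); rewrite -/b -/B.
  have := quad_le Y b; rewrite -/B -/y ler_norml => /andP[h3 _].
  have := ler_wpM2l (sqr_ge0 s) h3; rewrite expr2; lra.
have qab : - (s * (v + y) * (A * B)) <= inn a (M *m b).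
  rewrite !mulmxDl Xb add0r -!scalemxAl innDr !innZr.
  have := inn_norm_le a (V *m b); rewrite ler_norml => /andP[h1 _].
  have := inn_norm_le a (Y *m b); rewrite ler_norml => /andP[h2 _].
  have h3 := ler_wpM2l A0 (fro_mul V b).
  have h4 := ler_wpM2l A0 (fro_mul Y b).
  rewrite -/v -/y -/A -/B in h1 h2 h3 h4.
  have h5 : - (v * (A * B)) <= inn a (V *m b) by lra.
  have h6 : - (y * (A * B)) <= inn a (Y *m b) by lra.
  have := ler_wpM2l (ltW sgt0) h5.
  have := ler_wpM2l (sqr_ge0 s) h6.
  have := ler_wpM2r (mulr_ge0 y0 (mulr_ge0 A0 B0)) s2; lra.
have qabg : - (s ^+ 2 * Cr * ((A + B) * Gn)) <= inn (a + b) (M *m (U *m g)).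
  rewrite MUg innZr -mulrA -mulrN ler_wpM2l ?sqr_ge0//.
  have := inn_norm_le (a + b) (r s *m g); rewrite ler_norml => /andP[+ _].
  apply: le_trans; rewrite lerN2 mulrCA ler_pM ?fro_ge0//; first exact: froD.
  by apply: le_trans (fro_mul _ _) _; rewrite ler_wpM2r ?fro_ge0// rC.
rewrite uE (quadD _ _ MT) (quadD _ _ MT).
have KE : K = 1 + v + y + C1 + Cr by [].
have ss : 0 < s < s0 by rewrite sgt0.
have := sform s A B Gn ss.
have bnd (k x : R) : 0 <= x -> k <= K -> k * x <= K * x by move=> x0 kK; rewrite ler_wpM2r.
have i1 := ler_wpM2l (ltW sgt0) (bnd (v + y) (A ^+ 2) (sqr_ge0 _) ltac:(lra)).
have i2 := ler_wpM2l (sqr_ge0 s) (bnd y (B ^+ 2) (sqr_ge0 _) ltac:(lra)).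
have i3 := ler_wpM2l (mulr_ge0 (sqr_ge0 s) (ltW sgt0)) (bnd C1 (Gn ^+ 2) (sqr_ge0 _) ltac:(lra)).
have i4 := ler_wpM2l (ltW sgt0) (bnd (v + y) (A * B) (mulr_ge0 A0 B0) ltac:(lra)).
have i5 := ler_wpM2l (sqr_ge0 s) (bnd Cr ((A + B) * Gn) (mulr_ge0 (addr_ge0 A0 B0) Gn0) ltac:(lra)).
rewrite !expr2 in i1 i2 i3 i4 i5 qUg qa qb qab qabg *.
lra.
Qed.

(** The case of [psd_two_scale] in which the whole kernel of [X] is lifted at
  first order. *)
Lemma psd_perturb n (X V : 'M[R]_n) (mu : R) : psd X -> V^T = V -> 0 < mu ->
  (forall k, X *m k = 0 -> mu * fro k ^+ 2 <= quad V k) ->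
  exists2 s0, 0 < s0 & forall s, 0 < s < s0 -> psd (X + s *: V).
Proof.
move=> Xp VT mu0 muV.
have [G [l [[GT l0] XG XGX GXG lX]]] := psd_pinv Xp.
have XK : X *m (1%:M - X *m G) = 0 by rewrite mulmxBr mulmx1 XG mulmxA XGX subrr.
have PE : X *m G + (1%:M - X *m G) + 0 = 1%:M by rewrite addr0 addrC subrK.
pose z : 'M[R]_n := 0.
have PgY : z *m z *m z = z *m V *m G *m V *m z + 1 *: z.
  by rewrite /z !mulmx0 scaler0 addr0.
have PgV : V *m z = X *m G *m V *m z by rewrite !mulmx0.
have [u|s0 [C [s00 _ pert]]] := psd_two_scale (psd_tr Xp) VT (trmx0 _ _ _) GT (trmx0 _ _ _) XG
  XGX GXG l0 lX PE XK (mulmx0 _ _) (mulmx0 _ _) PgV PgY mu0 _ ltr01.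
  by apply: muV; rewrite mulmxA XK mul0mx.
exists s0 => // s /pert[+ _]; by rewrite scaler0 addr0.
Qed.

End TwoScale.


(** * Normal cones *)

Section SymmetricValues.
Context {R : realType} {n : nat}.
Implicit Types S T : symmx R n.

Lemma symvalD S T : symval (S + T) = symval S + symval T. Proof. by []. Qed.
Lemma symvalN S : symval (- S) = - symval S. Proof. exact: linearN. Qed.
Lemma symvalB S T : symval (S - T) = symval S - symval T. Proof. exact: linearB. Qed.
Lemma symvalZ a S : symval (a *: S) = a *: symval S. Proof. exact: linearZ. Qed.
Lemma symval0 : symval (0 : symmx R n) = 0. Proof. exact: linear0. Qed.

Lemma symval_inj : injective (@symval R n).
Proof. exact: val_inj. Qed.

Lemma psd_coneE S : psd_cone S = psd (S : 'M[R]_n). Proof. by []. Qed.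

End SymmetricValues.

Section NormalCone.
Context {R : realType}.

Section General.
Context {U : euclideanType R}.
Implicit Types (Om : set U) (x : U).

Lemma normal_cone0 Om x : normal_cone Om x 0.
Proof. by move=> x' _; rewrite dotp0l. Qed.

Lemma normal_coneD Om x u v :
  normal_cone Om x u -> normal_cone Om x v -> normal_cone Om x (u + v).
Proof. by move=> hu hv x' Ox'; rewrite dotpDl; have := hu _ Ox'; have := hv _ Ox'; lra. Qed.

Lemma normal_coneZ Om x a u :
  0 <= a -> normal_cone Om x u -> normal_cone Om x (a *: u).
Proof. by move=> a0 hu x' Ox'; rewrite dotpZl mulr_ge0_le0 ?hu. Qed.

Lemma dotp_continuous (d : U) : continuous (fun v : U => dotp v d : R).
Proof.
rewrite (_ : (fun v => _) = (fun v => (2^-1 : R) *: (`|v + d| ^+ 2 - `|v| ^+ 2 - `|d| ^+ 2))).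
  move=> v; apply: cvgZl_tmp.
  suff : continuous (fun v : U => `|v + d| ^+ 2 - `|v| ^+ 2 - `|d| ^+ 2) by apply.
  apply: continuous_sub; last by move=> ?; exact: cvg_cst.
  apply: continuous_sub; apply: continuous_normsq; last by move=> ?; exact: cvg_id.
  by apply: continuous_add; move=> ?; [exact: cvg_id|exact: cvg_cst].
by apply/funext => v; rewrite normDsq /GRing.scale/=; field.
Qed.

Lemma closed_normal_cone Om x : closed (normal_cone Om x).
Proof.
rewrite (_ : normal_cone Om x = \bigcap_(x' in Om) [set v | dotp v (x' - x) <= 0]).
  by apply: closed_bigI => x' _; apply: closed_fun_le; exact: dotp_continuous.
by apply/seteqP; split.
Qed.

End General.

(** The inequality of normality is tested at [X + u u^T], at [0] and at [2 X]. *)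
Lemma normal_psdP n (X S : symmx R n) : psd X ->
  normal_cone (@psd_cone R n) X S <-> psd (- (S : 'M[R]_n)) /\ (X : 'M[R]_n) *m S = 0.
Proof.
move=> Xp; split=> [SN|[Sp XS] T Tp]; last first.
  rewrite symmx_dotp symvalB innDr innNr.
  have -> : inn (S : 'M[R]_n) X = 0.
    by rewrite innC /inn symval_tr XS linear0.
  have := psd_inn_ge0 Sp Tp; rewrite innNl; lra.
have Sneg : psd (- (S : 'M[R]_n)).
  apply/psdP; split; first by rewrite linearN/= symval_tr.
  move=> u; have uuT : (u *m u^T)^T = u *m u^T by rewrite trmx_mul trmxK.
  have [D DE] := symmx_exists uuT.
  have := SN (X + D); rewrite addrC addrK symmx_dotp DE => h.
  have : inn (S : 'M[R]_n) (u *m u^T) <= 0.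
    by apply: h; rewrite psd_coneE symvalD DE; apply: psd_add => //; exact: psd_gram.
  by rewrite quad_oppl oppr_ge0 /quad innC inn_mulr trmxK.
split=> //; apply/eqP; rewrite -oppr_eq0 -mulmxN; apply/eqP.
apply: psd_inn_eq0 => //; rewrite innNr innC.
have h1 : dotp S (0 - X) <= 0 by apply: SN; rewrite psd_coneE symval0; exact: psd0.
have h2 : dotp S (2 *: X - X) <= 0.
  by apply: SN; rewrite psd_coneE symvalZ; apply: psd_scale.
move: h1 h2; rewrite !dotpE !symmx_dotp => h1 h2.
by apply/eqP; rewrite oppr_eq0 eq_le; apply/andP; split; lra.
Qed.

(** The positive and negative parts of [Y] are opposite to normals. *)
Lemma cone_span_normal_psd n (X Y : symmx R n) : psd X ->
  (X : 'M[R]_n) *m Y = 0 -> cone_span (normal_cone (@psd_cone R n) X) Y.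
Proof.
move=> Xp XY; have [P [d [PP YE _]]] := spectral_sorted (symval_tr Y).
pose part (f : R -> R) := P *m diag_mx (\row_i f (d 0 i)) *m P^T.
have partT f : (part f)^T = part f by rewrite /part !trmx_mul trmxK tr_diag_mx mulmxA.
have XPd i j : ((X : 'M[R]_n) *m P) i j * d 0 j = 0.
  have : (X : 'M[R]_n) *m P *m diag_mx d = 0.
    have := congr1 (fun M => M *m P) XY.
    by rewrite YE mul0mx -!mulmxA PP mulmx1 !mulmxA.
  by move=> /matrixP/(_ i j); rewrite mul_mx_diag !mxE.
have Xpart f : f 0 = 0 -> (X : 'M[R]_n) *m part f = 0.
  move=> f0; rewrite /part !mulmxA (_ : _ *m diag_mx _ = 0) ?mul0mx//.
  apply/matrixP => i j; rewrite mul_mx_diag mxE [RHS]mxE [X in _ * X]mxE.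
  have /eqP := XPd i j; rewrite mulf_eq0 => /orP[/eqP->|/eqP->].
    by rewrite mul0r.
  by rewrite f0 mulr0.
have N f : f 0 = 0 -> (forall x, 0 <= f x) -> exists2 S : symmx R n,
    (S : 'M[R]_n) = part f & normal_cone (@psd_cone R n) X (- S).
  move=> f0 fge0; have [S SE] := symmx_exists (partT f); exists S => //.
  apply/normal_psdP => //; rewrite symvalN opprK SE mulmxN Xpart// oppr0.
  by split=> //; apply: psd_diag => i; rewrite mxE.
have mge (x : R) : 0 <= Num.max x 0 by rewrite le_max lexx orbT.
have m0 : Num.max (- 0) 0 = 0 :> R by rewrite oppr0 maxxx.
have [Sp SpE SpN] := N (fun x => Num.max x 0) (maxxx 0) mge.
have [Sm SmE SmN] := N (fun x => Num.max (- x) 0) m0 (fun x => mge (- x)).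
exists 1, (- Sm), (- Sp); split => //; rewrite scale1r opprK; apply: symval_inj.
rewrite symvalD symvalN SmE SpE YE.
rewrite addrC -mulmxBl -mulmxBr; congr (_ *m _ *m _).
apply/matrixP => i j; rewrite !mxE; case: eqP => [->|_]; rewrite ?mulr0n ?subr0// !mulr1n.
by rewrite /Num.max; do 2!case: ltP => ?; lra.
Qed.

End NormalCone.


(** * Metric regularity and multipliers *)

Section Constraints.
Context {R : realType} {X : euclideanType R} {m n : nat}.
Variables (A : {linear X -> evec R m}) (B : {linear X -> symmx R n}).
Variables (b : evec R m) (B0 : symmx R n).
Variable xs : X.
Hypothesis xs_feasible : feasible A B b B0 xs.
Local Notation g := (constraint B B0).
Local Notation Gamma := (feasible A B b B0).
Hypothesis regular : metrically_regular (constraint_map A B b B0) xs (0, 0).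

Lemma constraintD x d : g (x + d) = g x + B d.
Proof. by rewrite /constraint linearD addrAC. Qed.

Lemma constraintB x y : B (x - y) = g x - g y.
Proof. by rewrite /constraint linearB opprB addrA subrK. Qed.

Lemma edist_le_norm {V : normedModType R} (x y : V) (e : R) :
  `|x - y| < e -> (edist (x, y) <= e%:E)%E.
Proof.
move=> xye; apply: edist_fin; first exact: le_lt_trans xye.
by rewrite /= -ball_normE.
Qed.

(** The distance from [xs] to the solution set is finite, and the distance to an
  empty set is infinite. *)
Lemma regular_solvable : exists2 r, 0 < r &
  forall p H, `|p| <= r -> `|H| <= r -> exists x, A x - b = p /\ psd (g x - H : symmx R n).
Proof.
have [_ [dl [K [dl0 K0 reg]]]] := regular.
exists dl => // p H pr Hr.
have := reg xs (p, H); rewrite !closed_ballE// /closed_ball_ /= subrr normr0.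
rewrite sub0r normrN prod_normE/= ge_max pr Hr => /(_ (ltW dl0) isT) h.
have fin : (edist_inf (constraint_map A B b B0 xs) (p, H) <= (2 * dl + 1)%:E)%E.
  apply: (@le_trans _ _ (edist ((p, H), (0, 0)))).
    apply: ereal_inf_lbound; exists (0, 0) => //.
    by have [? _] := regular.
  by apply: edist_le_norm; rewrite subr0 prod_normE/= gt_max; apply/andP; split; lra.
have [N0|[x [S Sp [E1 E2]]]] :
    [set y | constraint_map A B b B0 y (p, H)] = set0 \/ exists x, constraint_map A B b B0 x (p, H).
    have [->|/set0P[x ?]] := eqVneq [set y | constraint_map A B b B0 y (p, H)] set0; first by left.
    by right; exists x.
  move: h; rewrite N0 /edist_inf image_set0 ereal_inf0 leye_eq => /eqP E.
  have : (K%:E * edist_inf (constraint_map A B b B0 xs) (p, H) <= K%:E * (2 * dl + 1)%:E)%E.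
    by apply: lee_wpmul2l => //; rewrite lee_fin ltW.
  by rewrite [X in (X <= _)%E]E -EFinM.
exists x; split => //; rewrite -E2 opprB addrC subrK; exact: Sp.
Qed.

Lemma regular_error_bound : exists r K, [/\ 0 < r, 0 < K &
  forall x S e, `|x - xs| <= r -> A x = b -> psd (S : symmx R n) -> `|g x - S| < e ->
  exists2 x', Gamma x' & `|x' - x| < K * e].
Proof.
have [_ [dl [K [dl0 K0 reg]]]] := regular.
exists dl, (K + 1); split=> //; first by rewrite addr_gt0.
move=> x S e xr Ax Sp xSe.
have e0 : 0 < e by exact: le_lt_trans xSe.
have := reg x (0, 0); rewrite !closed_ballE// /closed_ball_ /= subrr normr0.
rewrite distrC => /(_ xr (ltW dl0)) h.
have fin : (edist_inf (constraint_map A B b B0 x) (0%R, 0%R) <= e%:E)%E.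
  apply: (@le_trans _ _ (edist ((0, 0) : (evec R m * symmx R n)%type, (0, g x - S)))).
    by apply: ereal_inf_lbound; exists (0, g x - S) => //; exists S; rewrite // Ax subrr.
  apply: edist_le_norm; rewrite -normrN opprB subr0 prod_normE/= normr0 gt_max e0/=.
  by [].
have : (edist_inf [set y | constraint_map A B b B0 y (0%R, 0%R)] x < ((K + 1) * e)%:E)%E.
  apply: le_lt_trans h _; apply: (@le_lt_trans _ _ ((K * e)%R%:E)).
    by rewrite EFinM; apply: lee_wpmul2l => //; rewrite lee_fin ltW.
  by rewrite lte_fin ltr_pM2r// ltrDl.
move=> /ereal_inf_lt[_ [x' [T Tp E] <-]] /edist_lt_ball; rewrite -ball_normE/= => h'.
exists x'; last by rewrite distrC.
have gT : g x' = T by apply: subr0_eq; exact: (congr1 snd E).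
by split; [apply: subr0_eq; exact: (congr1 fst E)|rewrite gT].
Qed.

(** Robinson's condition in dual form.  As every small right-hand side [(p, H)]
  is attained, the linear form [dotp y p + dotp S H] is nonnegative near the
  origin, hence zero. *)
Lemma regular_multiplier_zero y S : normal_cone (@psd_cone R n) (g xs) S ->
  adjoint A y + adjoint B S = 0 -> y = 0 /\ S = 0.
Proof.
move=> SN yS0; have [Axs gxs] := xs_feasible.
have [r r0 solv] := regular_solvable.
have key p H : `|p| <= r -> `|H| <= r -> 0 <= dotp y p + dotp S H.
  move=> pr Hr; have [x [xp xH]] := solv p H pr Hr.
  have h : dotp S (g x - H - g xs) <= 0 by exact: SN.
  have : dotp (adjoint A y + adjoint B S) (x - xs) = 0 by rewrite yS0 dotp0l.
  rewrite dotpDl !dotp_adjoint constraintB linearB/= Axs xp.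
  by move: h; rewrite !dotpE; lra.
pose a := r / (1 + `|y| + `|S|).
have den : 0 < 1 + `|y| + `|S| by rewrite !ltr_pwDl.
have a0 : 0 < a by exact: divr_gt0.
have aE : a * (1 + `|y| + `|S|) = r by rewrite divfK ?gt_eqF.
have := normr_ge0 y; have := normr_ge0 S => S0 y0.
have ay : `|- a *: y| <= r by rewrite normrZ normrN gtr0_norm// -aE ler_pM2l//; lra.
have aS : `|- a *: S| <= r by rewrite normrZ normrN gtr0_norm// -aE ler_pM2l//; lra.
have := key _ _ ay aS; rewrite !dotpZr !dotpvv => h.
have : `|y| ^+ 2 + `|S| ^+ 2 <= 0.
  rewrite -(ler_pM2l a0) mulr0; lra.
have := sqr_ge0 `|y|; have := sqr_ge0 `|S| => h1 h2 h3.
by split; apply: dotpvv_eq0; rewrite dotpvv; lra.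
Qed.

(** Under metric regularity the second alternative forces the normal cone at
  [xs] to be trivial, so that both give the same nondegeneracy. *)
Lemma nondegeneracy :
  cone_span (normal_cone (@psd_cone R n) (g xs)) `&`
    [set S | range (adjoint A) (adjoint B S)] = [set 0] \/
  adjoint B @` cone_span (normal_cone (@psd_cone R n) (g xs)) `<=` range (adjoint A) ->
  forall y (S : symmx R n), (g xs : 'M[R]_n) *m S = 0 -> adjoint A y + adjoint B S = 0 -> y = 0 /\ S = 0.
Proof.
move=> H y S XS E; have [_ gxs] := xs_feasible.
have Sspan := cone_span_normal_psd gxs XS.
suff S0 : S = 0.
  by apply: regular_multiplier_zero => //; rewrite S0; exact: normal_cone0.
case: H => [H|H].
  suff : [set 0] S by [].
  rewrite -H; split => //=; exists (- y) => //.
  by rewrite linearN/=; apply/eqP; rewrite eq_sym -addr_eq0 addrC E.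
have N0 T : normal_cone (@psd_cone R n) (g xs) T -> T = 0.
  move=> TN; have /normal_psdP-/(_ gxs)[_ XT] := TN.
  have [z _ zE] : range (adjoint A) (adjoint B T).
    by apply: H; exists T => //; exact: cone_span_normal_psd.
  have [] := @regular_multiplier_zero (- z) T TN; last by [].
  by rewrite linearN/= zE addNr.
have [t [u [v [t0 uN vN ->]]]] := Sspan.
by rewrite (N0 u uN) (N0 v vN) subrr scaler0.
Qed.

Hypothesis nondegenerate : forall y (S : symmx R n), (g xs : 'M[R]_n) *m S = 0 ->
  adjoint A y + adjoint B S = 0 -> y = 0 /\ S = 0.

(** The map from [(y, S)] to the two terms on the right is linear and
  injective. *)
Lemma multiplier_bound : exists2 C, 0 < C & forall y (S : symmx R n),
  `|y| + `|S| <= C * (`|adjoint A y + adjoint B S| + fro ((g xs : 'M[R]_n) *m S)).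
Proof.
pose L (p : eprod (evec R m) (symmx R n)) : eprod X (fmx R n n) :=
  (adjoint A p.1 + adjoint B p.2, (g xs : 'M[R]_n) *m symval p.2).
have Ll : linear L.
  move=> a [y S] [y' S']; rewrite /L /=; congr pair.
    by rewrite !linearP/= scalerDr !addrA; congr (_ + _); rewrite addrAC.
  by rewrite -[X in _ *m X = _]/(a *: symval S + symval S') mulmxDr -scalemxAr.
pose LL := GRing.isLinear.Build R _ _ *:%R L Ll.
pose L' : {linear eprod (evec R m) (symmx R n) -> eprod X (fmx R n n)} := HB.pack L LL.
have [p|C C0 LC] := linear_bounded_below (f := L').
  case: p => y S /= [E1 E2]; have [-> ->//] := @nondegenerate y S E2 E1.
exists (2 * C); first by rewrite mulr_gt0.
move=> y S; have h := LC (y, S).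
have := @eprod_norm1 _ _ _ ((y, S) : eprod (evec R m) (symmx R n)).
have := @eprod_norm2 _ _ _ ((y, S) : eprod (evec R m) (symmx R n)).
have /= := ler_wpM2l (ltW C0) (@eprod_norm_le _ _ _ (L' (y, S))).
move: h; rewrite /fro; lra.
Qed.

(** If [(g x1) S = 0] then [(g xs) S = (g xs - g x1) S], which the left-hand side
  absorbs when [x1] is close to [xs]. *)
Lemma multiplier_bound_near : exists r C, [/\ 0 < r, 0 < C & forall x1 y (S : symmx R n),
  `|x1 - xs| <= r -> (g x1 : 'M[R]_n) *m S = 0 ->
  `|y| + `|S| <= C * `|adjoint A y + adjoint B S|].
Proof.
have [C C0 bnd] := multiplier_bound.
have [K K0 BK] := linear_bound B.
exists (2 * C * K)^-1, (2 * C); split; rewrite ?invr_gt0 ?mulr_gt0//.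
move=> x1 y S x1r X1S; have := bnd y S.
have : fro ((g xs : 'M[R]_n) *m S) <= (2 * C)^-1 * `|S|.
  have -> : (g xs : 'M[R]_n) *m S = ((g xs - g x1 : symmx R n) : 'M[R]_n) *m S.
    by rewrite symvalB (mulmxBl (symval (g xs)) (symval (g x1))) X1S subr0.
  apply: le_trans (fro_mul _ _) _; rewrite -!symmx_norm ler_wpM2r//.
  rewrite -constraintB; apply: le_trans (BK _) _.
  rewrite distrC; apply: le_trans (ler_wpM2l (ltW K0) x1r) _.
  by rewrite invfM mulrCA mulfV ?gt_eqF// mulr1.
move=> /(ler_wpM2l (ltW C0)); rewrite invfM mulrA mulrCA mulfV ?gt_eqF// mulr1.
by have := normr_ge0 y; lra.
Qed.

(** The same bound for a difference of multipliers, of which only the second is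
  complementary to [g xs]: the multiplier at [xs] is Lipschitz stable. *)
Lemma multiplier_stability y0 (S0 : symmx R n) : (g xs : 'M[R]_n) *m S0 = 0 ->
  exists r C, [/\ 0 < r, 0 < C & forall x1 y (S : symmx R n),
  `|x1 - xs| <= r -> (g x1 : 'M[R]_n) *m S = 0 ->
  `|S - S0| <= C * (`|adjoint A y + adjoint B S - (adjoint A y0 + adjoint B S0)| + `|x1 - xs|)].
Proof.
move=> XS0; have [C C0 bnd] := multiplier_bound.
have [K K0 BK] := linear_bound B.
exists (2 * C * K)^-1, (2 * C * (1 + K * `|S0|)); split.
- by rewrite invr_gt0 !mulr_gt0.
- have : 0 <= K * `|S0| by rewrite mulr_ge0// ltW.
  by move=> KS; rewrite mulr_gt0 ?mulr_gt0//; lra.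
move=> x1 y S x1r X1S; have := bnd (y - y0) (S - S0).
rewrite !(linearB (adjoint _)).
set u := adjoint A y + adjoint B S; set u0 := adjoint A y0 + adjoint B S0.
have -> : adjoint A y - adjoint A y0 + (adjoint B S - adjoint B S0) = u - u0.
  by rewrite addrACA -opprD.
have : fro ((g xs : 'M[R]_n) *m symval (S - S0)) <= K * `|x1 - xs| * (`|S - S0| + `|S0|).
  have -> : (g xs : 'M[R]_n) *m symval (S - S0) = ((g xs - g x1 : symmx R n) : 'M[R]_n) *m S.
    by rewrite symvalB (mulmxBl (symval (g xs)) (symval (g x1))) X1S subr0 symvalB mulmxBr XS0 subr0.
  apply: le_trans (fro_mul _ _) _; rewrite -!symmx_norm ler_pM//.
    by rewrite -constraintB distrC; exact: BK.
  by rewrite -[X in `|X| <= _](subrK S0); exact: ler_normD.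
move=> /(ler_wpM2l (ltW C0)) h1 h2.
have h3 : C * (K * `|x1 - xs| * `|S - S0|) <= 2^-1 * `|S - S0|.
  rewrite !mulrA ler_wpM2r//.
  apply: (le_trans (ler_wpM2l (ltW (mulr_gt0 C0 K0)) x1r)).
  by rewrite le_eqVlt; apply/orP; left; apply/eqP; field; rewrite !gt_eqF.
have := normr_ge0 (y - y0).
have h4 : 0 <= C * (K * `|S0|) * `|u - u0| by rewrite !mulr_ge0// ltW.
have h5 : 0 <= C * `|x1 - xs| by rewrite !mulr_ge0// ltW.
lra.
Qed.

(** The multiplier rule at every feasible point near [xs].  The cone of all
  [A^* y + B^* S] is closed by the previous bound; the residual [d] of the
  projection of [u] onto it satisfies [A d = 0] and [B d] is semidefinite on the
  kernel of [g x1], hence, by metric regularity, [d] is tangent to the feasible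
  set. *)
Lemma normal_multiplier : exists2 r, 0 < r & forall x1 u,
  Gamma x1 -> `|x1 - xs| <= r -> normal_cone Gamma x1 u ->
  exists y (S : symmx R n), normal_cone (@psd_cone R n) (g x1) S /\ adjoint A y + adjoint B S = u.
Proof.
have [r1 [C [r10 C0 bnd]]] := multiplier_bound_near.
have [r2 [K [r20 K0 err]]] := regular_error_bound.
exists (Num.min r1 (r2 / 2)); first by rewrite lt_min r10 divr_gt0.
move=> x1 u [Ax1 gx1]; rewrite le_min => /andP[x1r1 x1r2] uN.
pose E := eprod (evec R m) (symmx R n).
pose L (p : E) : X := adjoint A p.1 + adjoint B p.2.
have Ll : linear L.
  move=> a [y S] [y' S']; rewrite /L /= !linearP/= scalerDr !addrA.
  by congr (_ + _); rewrite addrAC.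
pose LL := GRing.isLinear.Build R _ _ *:%R L Ll.
pose L' : {linear E -> X} := HB.pack L LL.
have sl : linear (fun p : E => p.2 : symmx R n) by [].
pose sL := GRing.isLinear.Build R E (symmx R n) *:%R _ sl.
pose s' : {linear E -> symmx R n} := HB.pack (fun p : E => p.2 : symmx R n) sL.
pose Cn := [set p : E | normal_cone (@psd_cone R n) (g x1) p.2].
have [||||||p Cp [dLp dLq]] := @cone_image_projection R E X Cn L' C u.
- apply: (preimage_closed (f := s') _ (@closed_normal_cone _ _ _ _)) => x _.
  exact: euclid_linear_continuous.
- exact: normal_cone0.
- by move=> p q; exact: normal_coneD.
- by move=> a p; exact: normal_coneZ.
- by [].
- move=> [y S] SN; apply: le_trans (eprod_norm_le _) _ => /=.
  by apply: bnd x1r1 _; have /normal_psdP-/(_ gx1)[] := SN.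
set d := u - L' p in dLp dLq.
suff d0 : d = 0.
  exists p.1, p.2; split; first exact: Cp.
  by apply/eqP; rewrite eq_sym -subr_eq0; apply/eqP.
have Ad : A d = 0.
  apply: dotpvv_eq0; apply/eqP; rewrite eq_le dotpvv sqr_ge0 andbT -dotpvv.
  rewrite -dotp_adjoint dotpC.
  have Cy : Cn (A d, 0) by exact: normal_cone0.
  by have := dLq _ Cy; rewrite /L'/= /L/= linear0 addr0.
have Bd (k : 'cV[R]_n) : (g x1 : 'M[R]_n) *m k = 0 -> 0 <= quad (symval (B d)) k.
  move=> k0; have kkT : (- (k *m k^T))^T = - (k *m k^T) by rewrite linearN/= trmx_mul trmxK.
  have [T TE] := symmx_exists kkT.
  have := dLq (0, T); rewrite /L'/= /L/= linear0 add0r dotpC dotp_adjoint symmx_dotp TE.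
  rewrite innNl inn_mulr trmxK oppr_le0; apply.
  apply/(normal_psdP _ gx1); rewrite TE opprK mulmxN mulmxA k0 mul0mx oppr0; split=> //.
  exact: psd_gram.
have ud : dotp u d <= 0.
  apply/ler_addgt0Pr => e e0; rewrite add0r.
  pose c := `|u| * K * (1 + fro (1%:M : 'M[R]_n)).
  have c0 : 0 <= c by rewrite !mulr_ge0 ?addr_ge0 ?fro_ge0// ltW.
  pose ep := e / (c + 1).
  have ep0 : 0 < ep by rewrite divr_gt0// ltr_wpDl.
  have VT : (symval (B d) + ep%:M)^T = symval (B d) + ep%:M.
    by rewrite linearD/= symval_tr tr_scalar_mx.
  have Vpos (k : 'cV[R]_n) : (g x1 : 'M[R]_n) *m k = 0 ->
      ep * fro k ^+ 2 <= quad (symval (B d) + ep%:M) k.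
    by move=> k0; rewrite quad_addl quad_scalar lerDr; exact: Bd.
  have [s0 s00 pert] := psd_perturb gx1 VT ep0 Vpos.
  pose s := Num.min (s0 / 2) (r2 / 2 / (`|d| + 1)).
  have d1 : 0 < `|d| + 1 by rewrite ltr_wpDl.
  have sgt0 : 0 < s by rewrite lt_min !divr_gt0.
  have ss0 : s < s0 by rewrite gt_min ltr_pdivrMr// mulr2n mulrDr mulr1 ltrDl s00.
  have sd : s * (`|d| + 1) <= r2 / 2 by rewrite -ler_pdivlMr// ge_min lexx orbT.
  have Mp := pert s ltac:(by rewrite sgt0).
  have [T TE] := symmx_exists (psd_tr Mp).
  rewrite -TE in Mp.
  have gT : `|g (x1 + s *: d) - T| < s * ep * (1 + fro (1%:M : 'M[R]_n)).
    have Bs : B (s *: d) = s *: B d by exact: linearZ.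
    rewrite symmx_norm symvalB constraintD Bs symvalD symvalZ TE.
    rewrite scalerDr addrA opprD addrA subrr sub0r froN -scalemx1 scalerA froZ.
    by rewrite (gtr0_norm (mulr_gt0 sgt0 ep0)) (ltr_pM2l (mulr_gt0 sgt0 ep0)) ltrDr.
  have [||x' Gx' x'x] := err _ _ _ _ _ Mp gT.
  - rewrite -addrAC; apply: le_trans (ler_normD _ _) _.
    rewrite normrZ gtr0_norm//.
    have : s * `|d| <= s * (`|d| + 1) by rewrite ler_wpM2l ?ltW// ltrDl.
    by lra.
  - by rewrite linearD linearZ/= Ad scaler0 addr0.
  have : dotp u (x' - x1) <= 0 by exact: uN.
  have -> : x' - x1 = s *: d + (x' - (x1 + s *: d)) 
    by rewrite -[x' in LHS](subrK (x1 + s *: d)) (addrC x1) -addrA addrK addrC.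
  rewrite dotpDr dotpZr.
  have := dotp_ge u (x' - (x1 + s *: d)).
  have := ler_wpM2l (normr_ge0 u) (ltW x'x) => h1 h2 h3.
  have : s * dotp u d <= s * (c * ep) by rewrite /c; lra.
  rewrite ler_pM2l// => /le_trans; apply.
  have : ep * (c + 1) = e by rewrite divfK// gt_eqF// ltr_wpDl.
  by lra.
apply: dotpvv_eq0; apply/eqP; rewrite eq_le dotpvv sqr_ge0 andbT -dotpvv.
by rewrite {2}/d dotpBr dLp subr0 dotpC.
Qed.

End Constraints.


(** * Second-order calculus *)

Section Calculus.
Context {R : realType} {U : euclideanType R}.
Implicit Types (F : U -> R) (x y d e h : U).

Lemma dotp_grad F x h : dotp (grad F x) h = 'd F x h.
Proof. by apply: dotp_riesz => a y z; rewrite linearP. Qed.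

Lemma hess_linear F x : linear (hess F x).
Proof. by move=> a y z; rewrite /hess linearP. Qed.

Lemma hessD F x y z : hess F x (y + z) = hess F x y + hess F x z.
Proof. by rewrite /hess linearD. Qed.

Lemma hessZ F x a y : hess F x (a *: y) = a *: hess F x y.
Proof. by rewrite /hess linearZ. Qed.

Lemma is_derive_line {W : normedModType R} (f : U -> W) x d (t : R) :
  differentiable f (x + t *: d) ->
  is_derive t 1 (fun s : R => f (x + s *: d)) ('d f (x + t *: d) d).
Proof.
move=> fd.
have ld : is_diff (t : R) (fun s : R => x + s *: d) ( *:%R ^~ d).
  rewrite (_ : (fun s => _) = cst x + ( *:%R ^~ d))//.
  by apply: is_diff_eq; rewrite add0r.
have lex : differentiable (fun s : R => x + s *: d) t.
  by have [] := ld.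
have cd : differentiable (f \o (fun s : R => x + s *: d)) t.
  exact: differentiable_comp.
have -> : (fun s : R => f (x + s *: d)) = f \o (fun s : R => x + s *: d) by [].
apply: DeriveDef; first exact: diff_derivable.
rewrite deriveE// diff_comp//=.
have [_ ->] := ld.
by rewrite scale1r.
Qed.

Lemma is_derive_dotp (f : R -> U) (df e : U) (t : R) :
  is_derive t 1 f df -> is_derive t 1 (fun s => dotp (f s) e : R) (dotp df e).
Proof.
move=> fd; have fdiff : differentiable f t.
  by apply/derivable1_diffP; exact: ex_derive.
have ll : linear ((fun v => dotp v e) : U -> R^o) by move=> a y z; rewrite dotpDl dotpZl.
pose lL := GRing.isLinear.Build R U R^o *:%R _ ll.
pose l : {linear U -> R^o} := HB.pack ((fun v => dotp v e) : U -> R^o) lL.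
have lc : continuous l by exact: dotp_continuous.
have ld : differentiable l (f t) by exact: linear_differentiable.
have cd : differentiable (l \o f) t by exact: differentiable_comp.
rewrite (_ : (fun s => dotp (f s) e) = l \o f)//.
apply: DeriveDef; first exact: diff_derivable.
rewrite deriveE//.
have -> : 'd (l \o f) t 1 = 'd l (f t) ('d f t 1) by rewrite diff_comp.
rewrite [LHS](congr1 (fun k => k ('d f t 1)) (diff_lin (f t) lc)).
by rewrite -deriveE// derive_val.
Qed.

Lemma mean_value (f df : R -> R) : (forall t : R, 0 <= t <= 1 -> is_derive (t : R) 1 f (df t)) ->
  exists2 t, 0 < t < 1 & f 1 - f 0 = df t.
Proof.
move=> fd.
have [||t t01 ->] := @MVT R f df 0 1 ltr01.
- by move=> t; rewrite in_itv/= => /andP[t0 t1]; apply: fd; rewrite !ltW.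
- apply: derivable_within_continuous => t; rewrite in_itv/= => t01.
  by have := fd t t01 => ?; exact: ex_derive.
- by exists t; [rewrite in_itv/= in t01|rewrite subr0 mulr1].
Qed.

Lemma segment_ball x0 (r : R) x y t : `|x - x0| < r -> `|y - x0| < r -> 0 <= t <= 1 ->
  `|x + t *: (y - x) - x0| < r.
Proof.
move=> xr yr /andP[t0 t1].
have -> : x + t *: (y - x) - x0 = (1 - t) *: (x - x0) + t *: (y - x0).
  have -> : y - x = (y - x0) - (x - x0) by rewrite opprB addrA subrK.
  by rewrite scalerBl (scalerBr t) scale1r [LHS]addrAC [RHS]addrAC addrA.
apply: le_lt_trans (ler_normD _ _) _; rewrite !normrZ !ger0_norm ?subr_ge0//.
have h1 : (1 - t) * `|x - x0| <= (1 - t) * r by rewrite ler_wpM2l ?subr_ge0// ltW.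
have [->|tpos] := eqVneq t 0; first by rewrite subr0 mul1r mul0r addr0.
have h2 : t * `|y - x0| < t * r by rewrite ltr_pM2l// lt_def tpos.
by lra.
Qed.

Section C2.
Variables (F : U -> R) (N : set U) (x0 : U).
Hypothesis N_open : open N.
Hypothesis N_x0 : N x0.
Hypothesis F_diff : forall x, N x -> differentiable F x.
Hypothesis gradF_diff : forall x, N x -> differentiable (grad F) x.
Hypothesis hessF_cont : forall x, N x -> forall h, {for x, continuous (fun y => hess F y h)}.
Local Notation H := (hess F x0).

Lemma ball_in_N : exists2 r, 0 < r & forall x, `|x - x0| < r -> N x.
Proof.
have : nbhs x0 N by exact: open_nbhs_nbhs.
move=> /nbhs_ballP[r r0 rN]; exists r => // x xr; apply: rN.
by rewrite -ball_normE/= distrC.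
Qed.

(** The Hessian is continuous in each direction, and finitely many directions
  control it uniformly. *)
Lemma hess_close eps : 0 < eps -> exists2 r, 0 < r & forall x, `|x - x0| < r ->
  N x /\ forall h, `|hess F x h - H h| <= eps * `|h|.
Proof.
move=> eps0; pose e := vbasis {:U}.
pose c i : U := riesz (fun x => coord e i x).
have cE i x : dotp (c i) x = coord e i x.
  by apply: dotp_riesz => a y z; rewrite linearP.
pose S := 1 + \sum_i `|c i|.
have S0 : 0 < S by rewrite ltr_pwDl// sumr_ge0.
have near_e : \forall x \near x0, forall i : 'I_(\dim {:U}), `|H e`_i - hess F x e`_i| < eps / S.
  apply: filter_forall => i.
  have /cvgrPdist_lt -/(_ _ (divr_gt0 eps0 S0)) := @hessF_cont x0 N_x0 e`_i.
  exact.
have [r1 r10 r1N] := ball_in_N.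
move: near_e => /nbhs_ballP[r r0 rP].
exists (Num.min r r1); first by rewrite lt_min r0.
move=> x; rewrite lt_min => /andP[xr xr1]; split; first exact: r1N.
have {}rP := rP x; rewrite -ball_normE/= distrC in rP.
move=> h; rewrite (coord_vbasis (memvf h)).
have lin T : linear T -> forall f : 'I_(\dim {:U}) -> R, T (\sum_i f i *: e`_i) = \sum_i f i *: (T e`_i) :> U.
  move=> Tl f; pose TL := GRing.isLinear.Build R U U *:%R T Tl.
  pose T' : {linear U -> U} := HB.pack T TL.
  rewrite -[T]/(T' : U -> U) linear_sum; apply: eq_bigr => i _; exact: linearZ.
rewrite (lin _ (@hess_linear F x)) (lin _ (@hess_linear F x0)) -sumrB -(coord_vbasis (memvf h)).
apply: le_trans (ler_norm_sum _ _ _) _.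
apply: (@le_trans _ _ (\sum_i (`|c i| * `|h| * (eps / S)))).
  apply: ler_sum => i _; rewrite -scalerBr normrZ ler_pM//.
    by rewrite -cE dotp_norm_le.
  by rewrite distrC ltW// rP.
rewrite -!mulr_suml mulrAC ler_wpM2r// mulrA ler_pdivrMr// mulrC.
by rewrite ler_wpM2l ?ltW// /S ltrDr.
Qed.

Lemma grad_mean_value x y (r : R) e : (forall x, `|x - x0| < r -> N x) ->
  `|x - x0| < r -> `|y - x0| < r ->
  exists2 z, `|z - x0| < r & dotp (grad F y - grad F x) e = dotp (hess F z (y - x)) e.
Proof.
move=> rN xr yr.
have [|t t01 E] := @mean_value (fun s => dotp (grad F (x + s *: (y - x))) e)
    (fun s => dotp (hess F (x + s *: (y - x)) (y - x)) e).
  move=> t t01; apply: is_derive_dotp; apply: is_derive_line.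
  by apply: gradF_diff; apply: rN; exact: segment_ball.
exists (x + t *: (y - x)).
  by apply: segment_ball => //; case/andP: t01 => *; rewrite !ltW.
by rewrite -E scale1r scale0r addr0 (addrC x) subrK dotpBl.
Qed.

Lemma fun_mean_value x y (r : R) : (forall x, `|x - x0| < r -> N x) ->
  `|x - x0| < r -> `|y - x0| < r ->
  exists2 t, 0 < t < 1 & F y - F x = dotp (grad F (x + t *: (y - x))) (y - x).
Proof.
move=> rN xr yr.
have [|t t01 E] := @mean_value (fun s => F (x + s *: (y - x)))
    (fun s => dotp (grad F (x + s *: (y - x))) (y - x)).
  move=> t t01; rewrite dotp_grad; apply: is_derive_line.
  by apply: F_diff; apply: rN; exact: segment_ball.
by exists t => //; rewrite -E scale1r scale0r addr0 (addrC x) subrK.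
Qed.

(** The mean value theorem is applied to the inner product of the gradient with
  the error term [e] itself. *)
Lemma grad_taylor eps : 0 < eps -> exists2 r, 0 < r & (forall x, `|x - x0| < r -> N x) /\
  forall x y, `|x - x0| < r -> `|y - x0| < r ->
  `|grad F y - grad F x - H (y - x)| <= eps * `|y - x|.
Proof.
move=> eps0; have [r r0 rP] := hess_close eps0; exists r => //.
split=> [x /rP[]//|x y xr yr].
set e := grad F y - grad F x - H (y - x).
have rN z : `|z - x0| < r -> N z by move=> /rP[].
have [z zr E] := grad_mean_value e rN xr yr.
have : `|e| ^+ 2 <= eps * `|y - x| * `|e|.
  rewrite -dotpvv {1}/e dotpBl E -dotpBl; apply: le_trans (dotp_le _ _) _.
  by rewrite ler_wpM2r//; have [_] := rP z zr; apply.
have [->|e0] := eqVneq `|e| 0; first by rewrite mulr_ge0// ltW.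
by rewrite expr2 ler_pM2r// lt_def e0 normr_ge0.
Qed.

Lemma fun_taylor eps : 0 < eps -> exists2 r, 0 < r & forall x y, `|x - x0| < r -> `|y - x0| < r ->
  `|F y - F x - dotp (grad F x) (y - x) - 2^-1 * dotp (H (y - x)) (y - x)| <= eps * `|y - x| ^+ 2.
Proof.
move=> eps0; have [r r0 [rN rP]] := grad_taylor eps0; exists r => // x y xr yr.
set d := y - x.
pose q := dotp (H d) d; pose p := dotp (grad F x) d.
have [|t /andP[t0 t1] E] := @mean_value (fun s => F (x + s *: d) - s * p - 2^-1 * q * s ^+ 2)
   (fun s => dotp (grad F (x + s *: d)) d - p - q * s).
  move=> t t01; have xt := segment_ball xr yr t01.
  have := @is_derive_line _ F x d t (F_diff (rN _ xt)); rewrite -dotp_grad => F1.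
  by apply: is_derive_eq; rewrite /GRing.scale/=; field.
have xt : `|x + t *: d - x0| < r by apply: segment_ball => //; rewrite !ltW.
have -> : F y - F x - p - 2^-1 * q = dotp (grad F (x + t *: d) - grad F x - H (t *: d)) d.
  rewrite 2!dotpBl hessZ dotpZl -/p -/q [t * q]mulrC -E scale1r scale0r addr0.
  rewrite (_ : x + d = y); last by rewrite /d addrC subrK.
  by ring.
apply: le_trans (dotp_norm_le _ _) _.
rewrite expr2 mulrA ler_wpM2r//.
have := rP x (x + t *: d) xr xt; rewrite (addrC x) addrK => /le_trans; apply.
by rewrite normrZ (ger0_norm (ltW t0)) (ler_wpM2l (ltW eps0))// ler_piMl// ltW.
Qed.

(** The values of [F] at [x0], [x0 + d] and [x0 + (d + f)] are compared in two
  ways: directly, and through the expansion at [x0 + d], in which the gradient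
  differs from that at [x0] by [H d].  Rescaling [d] and [f] leaves the equality
  of [dotp (H d) f] and [dotp (H f) d]. *)
Lemma hess_sym u v : dotp (H u) v = dotp (H v) u.
Proof.
have key u' v' : dotp (H u') v' - dotp (H v') u' <= 0.
  apply/ler_addgt0Pr => e e0; rewrite add0r.
  pose c := (`|u'| + `|v'|) ^+ 2.
  have c0 : 0 <= c by rewrite sqr_ge0.
  pose eps := e / (8 * (c + 1)).
  have c1 : 0 < c + 1 by rewrite ltr_wpDl.
  have eps0 : 0 < eps by rewrite divr_gt0// mulr_gt0.
  have [r1 r10 [_ P1]] := grad_taylor eps0.
  have [r2 r20 P2] := fun_taylor eps0.
  pose r := Num.min r1 r2.
  have r0 : 0 < r by rewrite lt_min r10.
  pose w := `|u'| + `|v'|.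
  have w0 : 0 <= w by rewrite addr_ge0.
  pose t := r / (w + 1).
  have w1 : 0 < w + 1 by rewrite ltr_wpDl.
  have t0 : 0 < t by rewrite divr_gt0.
  have tw : t * w < r.
    by rewrite -[X in _ < X](@divfK _ (w + 1)) ?gt_eqF// ltr_pM2l// ltrDl.
  set d := t *: u'; set f := t *: v'.
  have nd : `|d| = t * `|u'| by rewrite normrZ gtr0_norm.
  have nf : `|f| = t * `|v'| by rewrite normrZ gtr0_norm.
  have ndf : `|d + f| <= t * w by rewrite mulrDr -nd -nf ler_normD.
  have du : `|d| <= t * w by rewrite nd (ler_wpM2l (ltW t0))// lerDl.
  have fu : `|f| <= t * w by rewrite nf (ler_wpM2l (ltW t0))// lerDr.
  have B0 : `|x0 - x0| < r by rewrite subrr normr0.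
  have B1 : `|x0 + d - x0| < r by rewrite (addrC x0) addrK (le_lt_trans du).
  have B2 : `|x0 + (d + f) - x0| < r by rewrite (addrC x0) addrK (le_lt_trans ndf).
  have rr1 a : a < r -> a < r1 by rewrite lt_min => /andP[].
  have rr2 a : a < r -> a < r2 by rewrite lt_min => /andP[].
  have T1 := P2 x0 (x0 + d) (rr2 _ B0) (rr2 _ B1).
  have T2 := P2 x0 (x0 + (d + f)) (rr2 _ B0) (rr2 _ B2).
  have T3 := P2 (x0 + d) (x0 + (d + f)) (rr2 _ B1) (rr2 _ B2).
  have T4 := P1 x0 (x0 + d) (rr1 _ B0) (rr1 _ B1).
  have e1 a : x0 + a - x0 = a by rewrite (addrC x0) addrK.
  have e2 : x0 + (d + f) - (x0 + d) = f by rewrite addrA (addrC (x0 + d)) addrK.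
  rewrite ?e1 ?e2 in T1 T2 T3 T4.
  have T5 : `|dotp (grad F (x0 + d) - grad F x0 - H d) f| <= eps * (t * w) ^+ 2.
    apply: le_trans (dotp_norm_le _ _) _; rewrite expr2 (mulrA eps) ler_pM//.
    by apply: le_trans T4 _; apply: ler_wpM2l => //; exact: ltW.
  have sq a : 0 <= a -> a <= t * w -> eps * a ^+ 2 <= eps * (t * w) ^+ 2.
    by move=> a0 aw; rewrite (ler_wpM2l (ltW eps0))// ler_pXn2r ?nnegrE// (le_trans a0).
  have {}T1 := le_trans T1 (sq _ (normr_ge0 _) du).
  have {}T2 := le_trans T2 (sq _ (normr_ge0 _) ndf).
  have {}T3 := le_trans T3 (sq _ (normr_ge0 _) fu).
  move: T1 T2 T3 T5; rewrite hessD !dotpDl !dotpDr !dotpNl.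
  rewrite !ler_norml => /andP[T1 T1'] /andP[T2 T2'] /andP[T3 T3'] /andP[T5 T5'].
  have : dotp (H d) f - dotp (H f) d <= 8 * (eps * (t * w) ^+ 2) by lra.
  rewrite /d /f !hessZ !dotpZl !dotpZr.
  have -> : t * (t * dotp (H u') v') - t * (t * dotp (H v') u') =
     t ^+ 2 * (dotp (H u') v' - dotp (H v') u') by ring.
  have -> : 8 * (eps * (t * w) ^+ 2) = t ^+ 2 * (8 * eps * c) by rewrite /c -/w; ring.
  rewrite ler_pM2l ?exprn_gt0// => /le_trans; apply.
  have eE : 8 * eps * (c + 1) = e by rewrite /eps; field; rewrite gt_eqF.
  have e8 : 0 < 8 * eps by exact: mulr_gt0.
  by rewrite -[leRHS]eE (ler_pM2l e8) lerDl.
by have := key u v; have := key v u; lra.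
Qed.

Lemma convex_below (r : R) : (forall x, `|x - x0| < r -> N x /\ psd_op (hess F x)) ->
  forall x y, `|x - x0| < r -> `|y - x0| < r ->
  F x + dotp (grad F x) (y - x) <= F y.
Proof.
move=> rP x y xr yr; have rN z : `|z - x0| < r -> N z by move=> /rP[].
have [t /andP[t0 t1] E] := fun_mean_value rN xr yr.
have xt : `|x + t *: (y - x) - x0| < r by apply: segment_ball => //; rewrite !ltW.
have [z zr E2] := grad_mean_value (y - x) rN xr xt.
have [_ zp] := rP z zr.
have : 0 <= dotp (grad F (x + t *: (y - x)) - grad F x) (y - x).
  rewrite E2 (addrC x) addrK hessZ dotpZl; apply: mulr_ge0; [exact: ltW|exact: zp].
by rewrite dotpBl -E subr_ge0 lerBrDr addrC.
Qed.

End C2.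

End Calculus.


(** * Tilted minimisation over the feasible set *)

Section FeasibleSet.
Context {R : realType} {X : euclideanType R} {m n : nat}.
Variables (A : {linear X -> evec R m}) (B : {linear X -> symmx R n}).
Variables (b : evec R m) (B0 : symmx R n).
Local Notation g := (constraint B B0).


Lemma feasible_convex x y t : feasible A B b B0 x -> feasible A B b B0 y -> 0 <= t <= 1 ->
  feasible A B b B0 (x + t *: (y - x)).
Proof.
move=> [Ax gx] [Ay gy] /andP[t0 t1]; split.
  by rewrite linearD linearZ/= linearB/= Ax Ay subrr scaler0 addr0.
have Bt : B (t *: (y - x)) = t *: (g y - g x) by rewrite linearZ/= (constraintB B B0).
rewrite constraintD Bt psd_coneE symvalD symvalZ symvalB.
have -> : symval (g x) + t *: (symval (g y) - symval (g x)) =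
    (1 - t) *: symval (g x) + t *: symval (g y).
  by rewrite scalerBr scalerBl scale1r addrA addrAC.
by apply: psd_add; apply: psd_scale; [rewrite subr_ge0|exact: gx|exact: t0|exact: gy].
Qed.

(** The cone of semidefinite matrices is closed because it is opposite to a
  normal cone. *)
Lemma feasible_closed : closed (feasible A B b B0).
Proof.
have -> : feasible A B b B0 = [set x | `|A x - b| ^+ 2 <= 0] `&`
    (fun x => - B x + B0) @^-1` normal_cone (@psd_cone R n) 0.
  have psd00 : psd (symval (0 : symmx R n)) by rewrite symval0; exact: psd0.
  apply/seteqP; split=> x /= [Ax gx]; split=> //.
  - by rewrite Ax subrr normr0 expr0n.
  - apply/(normal_psdP _ psd00); rewrite symval0 mul0mx; split=> //.
    by rewrite -symvalN opprD opprK.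
  - apply/subr0_eq/dotpvv_eq0/eqP; rewrite eq_le dotpvv Ax; exact: sqr_ge0.
  - have /(normal_psdP _ psd00)[+ _] := gx.
    by rewrite -symvalN opprD opprK.
apply: closedI.
  apply: closed_fun_le; apply: continuous_normsq; apply: continuous_sub.
    exact: euclid_linear_continuous.
  by move=> x; exact: cvg_cst.
apply: preimage_closed; last exact: closed_normal_cone.
move=> x _; apply: continuous_add; last by move=> y; exact: cvg_cst.
by move=> y; apply: cvgN; exact: euclid_linear_continuous.
Qed.

End FeasibleSet.

(** The form of [T] is nonnegative at [u - h^-1 *: T u]. *)
Lemma psd_op_sq {R : realType} {U : euclideanType R} (T : {linear U -> U}) (h : R) : 0 < h ->
  (forall u v, dotp (T u) v = dotp (T v) u) -> psd_op T -> (forall u, `|T u| <= h * `|u|) ->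
  forall u, `|T u| ^+ 2 <= h * dotp (T u) u.
Proof.
move=> h0 Tsym Tpsd Th u.
have := Tpsd (u - h^-1 *: T u); rewrite linearB linearZ/= !dotpE (Tsym (T u) u) dotpvv.
have := dotp_le (T (T u)) (T u).
have := ler_wpM2r (normr_ge0 (T u)) (Th (T u)).
set q := dotp (T u) u; set a := `|T u|; set p := dotp (T (T u)) (T u) => h1 h2 h3.
have h4 : p <= h * a ^+ 2 by rewrite expr2 mulrA; exact: le_trans h2 h1.
have hi : 0 < h^-1 by rewrite invr_gt0.
have := ler_wpM2l (ltW hi) (ler_wpM2l (ltW hi) h4).
rewrite (mulrA h^-1 h) mulVf ?gt_eqF// mul1r => h5.
have : h^-1 * a ^+ 2 <= q by lra.
by rewrite ler_pdivrMl.
Qed.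

Section TiltedArgmin.
Context {R : realType} {X : euclideanType R}.
Variables (phi : X -> \bar R) (G : set X) (xs : X).
Hypothesis phi_proper : proper_fun phi.
Hypothesis phi_fin : forall x, G x -> phi x \is a fin_num.
Hypothesis G_xs : G xs.
Local Notation F := (fine \o phi).
Local Notation f := (fun x => phi x + indicator G x)%E.

Lemma constrained_feasible x : G x -> f x = (F x)%:E.
Proof.
move=> Gx; have -> : indicator G x = 0%E by rewrite /indicator (asboolT Gx).
by rewrite adde0 /= fineK// phi_fin.
Qed.

Lemma constrained_infeasible x : ~ G x -> f x = +oo%E.
Proof.
move=> Gx; have [phiN _] := phi_proper.
have -> : indicator G x = +oo%E by rewrite /indicator (asboolF Gx).
by rewrite addey.
Qed.

Lemma tilt_argminP (dl : R) v x : 0 < dl -> tilt_argmin f xs dl v x <->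
  [/\ `|x - xs| <= dl, G x & forall y, `|y - xs| <= dl -> G y ->
      F x - dotp v x <= F y - dotp v y].
Proof.
move=> dl0.
have tE y : G y -> (f y - f xs - (dotp v (y - xs))%:E)%E =
    (F y - F xs - dotp v (y - xs))%:E.
  by move=> Gy; rewrite !constrained_feasible// !EFinB.
have tI y : ~ G y -> (f y - f xs - (dotp v (y - xs))%:E)%E = +oo%E.
  by move=> Gy; rewrite constrained_infeasible// constrained_feasible.
have tle y z : G y -> G z -> ((f y - f xs - (dotp v (y - xs))%:E)%E <=
    (f z - f xs - (dotp v (z - xs))%:E)%E)%E = (F y - dotp v y <= F z - dotp v z).
  by move=> Gy Gz; rewrite (tE y Gy) (tE z Gz) lee_fin !dotpBr; apply/idP/idP; lra.
rewrite /tilt_argmin closed_ballE//; split.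
  rewrite /closed_ball_ => -[/= xr xmin]; rewrite distrC in xr.
  have Gx : G x.
    apply: contrapT => nGx; have := xmin xs.
    rewrite (tI _ nGx) (tE _ G_xs) leye_eq => h; suff : false by [].
    by apply: h; rewrite subrr normr0 ltW.
  split=> // y yr Gy; rewrite -tle//; apply: xmin.
  by rewrite /= distrC.
move=> [xr Gx xmin]; split; first by rewrite /closed_ball_ /= distrC.
move=> y; rewrite /closed_ball_ /= distrC => yr.
have [Gy|nGy] := pselect (G y); last by rewrite (tI _ nGy) leey.
by rewrite tle//; exact: xmin.
Qed.

(** Uniform quadratic growth of the tilted functions at their minimisers makes
  the minimiser unique and Lipschitz in the tilt: add the growth inequalities of
  two tilts. *)
Lemma growth_tilt_stable (c dl rho : R) : 0 < c -> 0 < dl -> 0 < rho ->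
  let P v x := [/\ `|x - xs| <= dl, G x & forall y, `|y - xs| <= dl -> G y ->
    F x - dotp v x + c * `|y - x| ^+ 2 <= F y - dotp v y] in
  P 0 xs -> (forall v, `|v| < rho -> exists x, P v x) -> tilt_stable f xs.
Proof.
move=> c0 dl0 rho0 P P0 Pex.
have Pmono v w x y : P v x -> P w y -> 2 * c * `|x - y| ^+ 2 <= dotp (v - w) (x - y).
  move=> [xr Gx gx] [yr Gy gy]; have := gx y yr Gy; have := gy x xr Gx.
  by rewrite (distrC y x) !dotpBl !dotpBr; lra.
have Puniq v x y : P v x -> P v y -> x = y.
  move=> Px Py; have := Pmono v v x y Px Py; rewrite subrr dotp0l => h.
  apply/eqP; rewrite -subr_eq0; apply/eqP/dotpvv_eq0/eqP.
  rewrite eq_le dotpvv sqr_ge0 andbT.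
  by rewrite -(@pmulr_rle0 _ (2 * c)) ?mulr_gt0.
have Pmin v x : P v x -> tilt_argmin f xs dl v = [set x].
  move=> Px; have [xr Gx gx] := Px; apply/seteqP; split=> [y|_ ->].
    move=> /(tilt_argminP _ _ dl0)[yr Gy ymin]; have := ymin x xr Gx.
    have := gx y yr Gy => h1 h2; apply/eqP; rewrite -subr_eq0; apply/eqP/dotpvv_eq0/eqP.
    rewrite eq_le dotpvv sqr_ge0 andbT -(@pmulr_rle0 _ c) //; lra.
  apply/(tilt_argminP _ _ dl0); split=> // y yr Gy; have := gx y yr Gy.
  by have := mulr_ge0 (ltW c0) (sqr_ge0 `|y - x|); lra.
split.
- split=> [x|].
    have [Gx|nGx] := pselect (G x); first by rewrite constrained_feasible.
    by rewrite constrained_infeasible.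
  by exists xs; rewrite constrained_feasible// ltry.
- by rewrite constrained_feasible// ltry.
exists dl; split=> //; first exact: Pmin.
pose mm v := xget 0 [set x | P v x].
have Pm v : `|v| < rho -> P v (mm v).
  by move=> /Pex[x Px]; rewrite /mm; case: xgetP => [y -> //|/(_ x)].
exists (ball 0 rho), mm, (2 * c)^-1; split.
- exact: nbhsx_ballx.
- by move=> v; rewrite -ball_normE/= sub0r normrN => /Pm; exact: Pmin.
move=> [v w] /= []; rewrite -!ball_normE/= !sub0r !normrN => vr wr.
have := Pmono v w _ _ (Pm v vr) (Pm w wr).
set d := mm v - mm w => h.
rewrite ler_pdivlMl ?mulr_gt0//.
have [->|d0] := eqVneq `|d| 0; first by rewrite mulr0.
have dp : 0 < `|d| by rewrite lt_def d0 normr_ge0.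
rewrite -(ler_pM2r dp) -mulrA -expr2; apply: le_trans h _; exact: dotp_le.
Qed.

(** Conversely, a Lipschitz selection of minimisers forces uniform growth.  The
  conjugate [h v] of the function has the subgradient [m v]; the Lipschitz
  property bounds [h w] above by [h v + dotp (w - v) (m v) + K `|w - v|^2], and
  the Fenchel inequality at [w = v + s (x - m v)] gives growth at [m v]. *)
Lemma tilt_stable_growth : tilt_stable f xs -> exists c dl rho L : R,
  [/\ 0 < c, 0 < dl, 0 < rho, 0 < L & forall v, `|v| < rho ->
   exists x, [/\ `|x - xs| <= dl, G x, `|x - xs| <= L * `|v| &
     forall y, `|y - xs| <= dl -> G y ->
       F x - dotp v x + c * `|y - x| ^+ 2 <= F y - dotp v y]].
Proof.
move=> [_ _ [dl [dl0 min0 [N [mm [k [N0 minN lip]]]]]]].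
have [r r0 rN] : exists2 r, 0 < r & forall v, `|v| < r -> N v.
  move: N0 => /nbhs_ballP[r r0 rN]; exists r => // v vr; apply: rN.
  by rewrite -ball_normE/= sub0r normrN.
pose K := Num.max k 1.
have K0 : 0 < K by rewrite lt_max ltr01 orbT.
have mP v : `|v| < r -> [/\ `|mm v - xs| <= dl, G (mm v) &
    forall y, `|y - xs| <= dl -> G y -> F (mm v) - dotp v (mm v) <= F y - dotp v y].
  by move=> vr; apply/(tilt_argminP _ _ dl0); rewrite minN//; exact: rN.
have lipK v w : `|v| < r -> `|w| < r -> `|mm v - mm w| <= K * `|v - w|.
  move=> vr wr; have := lip (v, w) (conj (rN v vr) (rN w wr)) => /= /le_trans; apply.
  by rewrite ler_wpM2r// le_max lexx.
have m0 : mm 0 = xs.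
  have z0 : `|0 : X| < r by rewrite normr0.
  have : tilt_argmin f xs dl 0 (mm 0) by rewrite minN//; exact: rN.
  by rewrite min0.
pose s := Num.min (2 * K)^-1 (r / 2 / (2 * dl + 1)).
have dl1 : 0 < 2 * dl + 1 by rewrite addr_gt0 ?mulr_gt0.
have s0 : 0 < s by rewrite lt_min invr_gt0 mulr_gt0// !divr_gt0.
have sK : s * (2 * K) <= 1 by rewrite -ler_pdivlMr ?mulr_gt0// mul1r ge_min lexx.
have sr : s * (2 * dl + 1) <= r / 2 by rewrite -ler_pdivlMr// ge_min lexx orbT.
exists (s / 2), dl, (r / 2), K; split; rewrite ?divr_gt0//.
move=> v vr; have vr' : `|v| < r by lra.
have [xr Gx xmin] := mP v vr'.
exists (mm v); split=> //.
  by have := lipK v 0 vr'; rewrite normr0 m0 subr0; apply.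
move=> y yr Gy.
set d := y - mm v; pose w := v + s *: d.
have nd : `|d| <= 2 * dl.
  rewrite /d -(subrKA xs); apply: le_trans (ler_normD _ _) _.
  by rewrite (distrC xs); lra.
have wv : w - v = s *: d by rewrite /w addrC addKr.
have wr : `|w| < r.
  rewrite /w; apply: le_lt_trans (ler_normD _ _) _; rewrite normrZ gtr0_norm//.
  have : s * `|d| <= s * (2 * dl) by rewrite ler_pM2l.
  by lra.
have [zr Gz zmin] := mP w wr.
have := zmin y yr Gy; have := xmin (mm w) zr Gz.
have h1 : dotp (w - v) (mm w - mm v) <= K * s ^+ 2 * `|d| ^+ 2.
  apply: le_trans (dotp_le _ _) _.
  have := lipK w v wr vr'; rewrite wv normrZ gtr0_norm// => h.
  by have := ler_wpM2l (mulr_ge0 (ltW s0) (normr_ge0 d)) h; lra.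
have h2 : dotp (w - v) (y - mm v) = s * `|d| ^+ 2 by rewrite wv dotpZl dotpvv.
have h3 : K * s ^+ 2 * `|d| ^+ 2 <= s / 2 * `|d| ^+ 2.
  rewrite ler_wpM2r ?sqr_ge0//; have := ler_wpM2l (ltW s0) sK; lra.
move: h1 h2; rewrite !dotpBl !dotpBr; lra.
Qed.

End TiltedArgmin.

(** Fermat's rule for a tilted local minimiser over a convex set. *)
Lemma local_min_normal {R : realType} {X : euclideanType R} (F : X -> R) (Ns G : set X)
    (x v : X) (r : R) :
  open Ns -> Ns x -> (forall y, Ns y -> differentiable F y) ->
  (forall y, Ns y -> differentiable (grad F) y) ->
  (forall y, Ns y -> forall h, {for y, continuous (fun z => hess F z h)}) ->
  (forall y z t, G y -> G z -> 0 <= t <= 1 -> G (y + t *: (z - y))) ->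
  G x -> 0 < r ->
  (forall y, `|y - x| <= r -> G y -> F x - dotp v x <= F y - dotp v y) ->
  normal_cone G x (v - grad F x).
Proof.
move=> Ns_open Nx F_diff gradF_diff hessF_cont G_convex Gx r0 xmin x' Gx'.
rewrite leNgt; apply/negP => pos.
have [r1 r10 tay] := fun_taylor Ns_open Nx F_diff gradF_diff hessF_cont ltr01.
set d := x' - x in pos.
pose p := dotp (v - grad F x) d; rewrite -/p in pos.
pose c := 2^-1 * dotp (hess F x d) d + `|d| ^+ 2.
pose q := 1 + `|c|.
have q0 : 0 < q by rewrite ltr_pwDl.
have d1 : 0 < `|d| + 1 by rewrite ltr_wpDl.
pose t := Num.min 1 (Num.min (p / (2 * q)) (Num.min r (r1 / 2) / (`|d| + 1))).
have r2 : 0 < Num.min r (r1 / 2) by rewrite lt_min r0 divr_gt0.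
have t0 : 0 < t by rewrite !lt_min ltr01 !divr_gt0 ?mulr_gt0.
have t1 : t <= 1 by rewrite ge_min lexx.
have tp : t * (2 * q) <= p by rewrite -ler_pdivlMr ?mulr_gt0// !ge_min lexx orbT.
have : t * (`|d| + 1) <= Num.min r (r1 / 2) by rewrite -ler_pdivlMr// !ge_min lexx !orbT.
rewrite le_min => /andP[tr tr1].
have td : t * `|d| <= t * (`|d| + 1) by rewrite ler_pM2l// lerDl.
have nd : `|x + t *: d - x| = t * `|d| by rewrite (addrC x) addrK normrZ gtr0_norm.
have Gxt : G (x + t *: d) by apply: G_convex; rewrite // (ltW t0).
have := xmin (x + t *: d); rewrite nd => /(_ (le_trans td tr) Gxt).
have B1 : `|x - x| < r1 by rewrite subrr normr0.
have B2 : `|x + t *: d - x| < r1 by rewrite nd; lra.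
have := tay x (x + t *: d) B1 B2; rewrite (addrC x) addrK hessZ.
rewrite !dotpDr !dotpZl !dotpZr normrZ (gtr0_norm t0) ler_norml => /andP[_ h1] h2.
have : t * p <= t * (t * c) by rewrite /p /c dotpBl; lra.
rewrite ler_pM2l// => h3.
have : t * c <= t * q by rewrite ler_pM2l// /q; have := ler_norm c; lra.
have : 0 < t * q by rewrite mulr_gt0.
by lra.
Qed.


(** * The second-order condition implies tilt stability *)

Lemma trace_le {R : realType} n (M : 'M[R]_n) : \tr M <= fro (1%:M : 'M[R]_n) * fro M.
Proof. by have := inn_le (1%:M : 'M[R]_n) M; rewrite /inn trmx1 mul1mx. Qed.

Lemma sq_le_half {R : realType} (a d c : R) : 0 <= c -> 0 <= a -> 0 <= d -> c <= a + d ->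
  2^-1 * c ^+ 2 <= a ^+ 2 + d ^+ 2.
Proof.
move=> c0 a0 d0 cad; have : c ^+ 2 <= (a + d) ^+ 2 by rewrite ler_pXn2r ?nnegrE ?addr_ge0.
have := sqr_ge0 (a - d); lra.
Qed.

Section Sufficiency.
Context {R : realType} {X : euclideanType R} {m n : nat}.
Variables (A : {linear X -> evec R m}) (B : {linear X -> symmx R n}).
Variables (b : evec R m) (B0 : symmx R n).
Variable F : X -> R.
Variable xs : X.
Hypothesis xs_feasible : feasible A B b B0 xs.
Variable Ns : set X.
Hypothesis Ns_open : open Ns.
Hypothesis Ns_xs : Ns xs.
Local Notation g := (constraint B B0).
Local Notation Gamma := (feasible A B b B0).
Local Notation H := (hess F xs).
Hypothesis H_psd : psd_op H.
Hypothesis regular : metrically_regular (constraint_map A B b B0) xs (0, 0).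
Hypothesis nondegenerate : forall y (S : symmx R n), (g xs : 'M[R]_n) *m S = 0 ->
  adjoint A y + adjoint B S = 0 -> y = 0 /\ S = 0.
Variables (ys : evec R m) (Ss : symmx R n).
Hypothesis Ss_normal : normal_cone (@psd_cone R n) (g xs) Ss.
Hypothesis stationary : adjoint A ys + adjoint B Ss = - grad F xs.
Hypothesis second_order : forall w, H w = 0 -> A w = 0 -> symval (B w) *m symval Ss = 0 -> w = 0.

Hypothesis F_diff : forall x, Ns x -> differentiable F x.
Hypothesis gradF_diff : forall x, Ns x -> differentiable (grad F) x.
Hypothesis hessF_cont : forall x, Ns x -> forall h, {for x, continuous (fun y => hess F y h)}.

Let Hsym u v : dotp (H u) v = dotp (H v) u.
Proof. exact: (hess_sym Ns_open Ns_xs F_diff gradF_diff hessF_cont). Qed.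

Let Hlin : {linear X -> X} :=
  HB.pack H (GRing.isLinear.Build R X X *:%R H (@hess_linear _ _ F xs)).

(** The linear map from [w] to [H w], [A w] and [(B w) Ss] is injective, hence
  bounded below; for symmetric semidefinite [H] the form [dotp (H w) w] dominates
  the square of the norm of [H w]. *)
Lemma coercive : exists2 C, 0 < C & forall w, A w = 0 ->
  `|w| ^+ 2 <= C * (dotp (H w) w + fro (symval (B w) *m symval Ss) ^+ 2).
Proof.
pose L w : eprod X (eprod (evec R m) (fmx R n n)) := (H w, (A w, symval (B w) *m symval Ss)).
have Ll : linear L.
  move=> a u v; rewrite /L hess_linear !linearP/=; congr (_, (_, _)).
  by rewrite mulmxDl -scalemxAl.
pose L' : {linear X -> eprod X (eprod (evec R m) (fmx R n n))} :=
  HB.pack L (GRing.isLinear.Build R X _ *:%R L Ll).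
have [w|C C0 LC] := linear_bounded_below (f := L').
  by case=> [h1 h2 h3]; exact: second_order.
have [h h0 Hh] := linear_bound Hlin.
have Hsq := psd_op_sq h0 (T := Hlin) Hsym H_psd Hh.
exists (C ^+ 2 * (h + 1)); first by rewrite mulr_gt0 ?exprn_gt0// ltr_wpDl// ltW.
move=> w Aw.
have : `|w| ^+ 2 <= C ^+ 2 * `|L' w| ^+ 2.
  by rewrite -exprMn ler_pXn2r ?nnegrE// mulr_ge0// ltW.
rewrite !eprod_normsq [(L' w).2.1]Aw normr0 expr0n add0r => /le_trans; apply.
rewrite -mulrA ler_pM2l ?exprn_gt0// mulrDl mul1r mulrDr.
have := Hsq w; have := H_psd w.
have := mulr_ge0 (ltW h0) (sqr_ge0 (fro (symval (B w) *m symval Ss))).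
rewrite -[Hlin w]/(H w) -[`|(L' w).1|]/(`|H w|).
rewrite -[`|(L' w).2.2|]/(fro (symval (B w) *m symval Ss)).
by lra.
Qed.

(** By complementarity at [x1] the left-hand matrix is [(g x) S1] and the
  right-hand inner product is the trace of [(g x) (- S1)], so that [psd_inn_ge]
  compares them.  This is how the curvature of the semidefinite cone enters. *)
Lemma complementarity_gap : exists2 K, 0 < K & forall x1 x (S1 : symmx R n),
  Gamma x1 -> Gamma x -> normal_cone (@psd_cone R n) (g x1) S1 ->
  `|x - xs| <= 1 -> `|S1 - Ss| <= 1 ->
  fro (symval (B (x - x1)) *m S1) ^+ 2 <= K * - dotp S1 (B (x - x1)).
Proof.
have [k k0 Bk] := linear_bound B.
pose T : R := fro (1%:M : 'M[R]_n) * (`|Ss| + 1) * (fro (1%:M : 'M[R]_n) * (`|g xs| + k)).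
have T0 : 0 <= T by rewrite !mulr_ge0 ?addr_ge0 ?fro_ge0// ltW.
exists (T + 1); first by rewrite ltr_wpDl.
move=> x1 x S1 [_ gx1] [_ gx] /(normal_psdP _ gx1)[S1p X1S1] xr Sr.
have gxn : `|g x| <= `|g xs| + k.
  rewrite -(subrK (g xs) (g x)) -constraintB; apply: le_trans (ler_normD _ _) _.
  rewrite addrC lerD2l; apply: le_trans (Bk _) _.
  by rewrite -[leRHS]mulr1 ler_pM2l.
have S1n : `|S1| <= `|Ss| + 1.
  by rewrite -(subrK Ss S1) addrC; apply: le_trans (ler_normD _ _) _; rewrite lerD2l.
have dE : - dotp S1 (B (x - x1)) = inn (- symval S1) (symval (g x)).
  rewrite (constraintB B B0) dotpBr !symmx_dotp innNl opprB.
  suff -> : inn (symval S1) (symval (g x1)) = 0 by rewrite sub0r.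
  by rewrite innC /inn symval_tr X1S1 linear0.
have BE : symval (B (x - x1)) *m S1 = symval (g x) *m S1.
  rewrite (constraintB B B0) symvalB (mulmxBl (symval (g x)) (symval (g x1))).
  by rewrite X1S1 subr0.
rewrite dE BE.
have -> : fro (symval (g x) *m S1) = fro (- symval S1 *m symval (g x)).
  by rewrite -fro_tr trmx_mul !symval_tr mulNmx froN.
apply: le_trans (psd_inn_ge S1p gx) _; rewrite ler_wpM2r ?psd_inn_ge0//.
apply: le_trans (_ : T <= _); last by rewrite lerDl.
apply: ler_pM; rewrite ?psd_trace_ge0//.
  apply: le_trans (trace_le _) _; rewrite froN -symmx_norm.
  by rewrite ler_wpM2l ?fro_ge0.
apply: le_trans (trace_le _) _; rewrite -symmx_norm.
by rewrite ler_wpM2l ?fro_ge0.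
Qed.

(** The expansion of [F] at [x1] leaves half of [dotp (H d) d] with [d = x - x1],
  and the multiplier contributes the gap [- dotp S1 (B d)], which bounds the
  square of [(B d) S1].  Stability of the multiplier replaces [S1] by [Ss], and
  [coercive] applies to the sum. *)
Lemma uniform_growth : exists c dl eta : R, [/\ 0 < c, 0 < dl, 0 < eta &
  forall x1 x y1 (S1 : symmx R n), Gamma x1 -> Gamma x ->
  `|x1 - xs| <= dl -> `|x - xs| <= dl ->
  normal_cone (@psd_cone R n) (g x1) S1 ->
  `|adjoint A y1 + adjoint B S1 + grad F xs| <= eta ->
  c * `|x - x1| ^+ 2 <=
    F x - F x1 - dotp (grad F x1 + (adjoint A y1 + adjoint B S1)) (x - x1)].
Proof.
have [C C0 coer] := coercive.
have [K K0 gap] := complementarity_gap.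
have [k k0 Bk] := linear_bound B.
have [_ gxs] := xs_feasible.
have [_ XSs] : psd (- symval Ss) /\ symval (g xs) *m symval Ss = 0.
  by apply/normal_psdP.
have [r1 [D [r10 D0 stab]]] := multiplier_stability nondegenerate ys XSs.
(* Of the coercivity constant [4 * c], the Taylor remainder and the replacement
  of [S1] by [Ss] take [c] each. *)
have [c c0 cE] : exists2 c : R, 0 < c & 4 * c = Num.min 2^-1 (2 * K)^-1 / C.
  exists (Num.min 2^-1 (2 * K)^-1 / C / 4); last by field; rewrite gt_eqF.
  by rewrite !divr_gt0// lt_min invr_gt0 ltr0n invr_gt0 mulr_gt0.
have [r2 r20 tay] := fun_taylor Ns_open Ns_xs F_diff gradF_diff hessF_cont c0.
pose sg := Num.min 1 (c * K / k ^+ 2).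
have sg0 : 0 < sg.
  by rewrite lt_min ltr01; apply: divr_gt0; [exact: mulr_gt0|exact: exprn_gt0].
have sg1 : sg <= 1 by rewrite ge_min lexx.
have sgc : k ^+ 2 * sg ^+ 2 <= c * K.
  have ks : k ^+ 2 * sg <= c * K.
    by rewrite mulrC -ler_pdivlMr ?exprn_gt0// /sg ge_min lexx orbT.
  apply: le_trans ks; apply: ler_wpM2l; first exact: sqr_ge0.
  by rewrite expr2 ler_piMl// ltW.
pose dl := Num.min (Num.min r1 (r2 / 2)) (Num.min 1 (sg / (2 * D))).
exists c, dl, (sg / (2 * D)); split => //.
- by rewrite !lt_min r10 !divr_gt0 ?mulr_gt0// ltr01.
- by rewrite divr_gt0// mulr_gt0.
move=> x1 x y1 S1 Gx1 Gx; rewrite 2!le_min => /andP[/andP[x1r1 x1r2]]; rewrite le_min => /andP[x11 x1s].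
rewrite 2!le_min => /andP[/andP[xr1 xr2]]; rewrite le_min => /andP[x11' xs'] S1N u1.
have [_ gx1] := Gx1.
have [S1p X1S1] : psd (- symval S1) /\ symval (g x1) *m symval S1 = 0.
  by apply/normal_psdP.
have S1Ss : `|S1 - Ss| <= sg.
  have := stab x1 y1 S1 x1r1 X1S1; rewrite stationary opprK => /le_trans; apply.
  have := ler_wpM2l (ltW D0) (lerD u1 x1s).
  by rewrite (_ : D * (sg / (2 * D) + sg / (2 * D)) = sg)//; field; rewrite gt_eqF.
set d := x - x1.
have Ad : A d = 0 by rewrite /d linearB/=; case: Gx1 => -> _; case: Gx => -> _; rewrite subrr.
have gapd := gap x1 x S1 Gx1 Gx S1N x11' (le_trans S1Ss sg1).
have coerd := coer d Ad.
have B1 : `|x1 - xs| < r2 by lra.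
have B2 : `|x - xs| < r2 by lra.
have := tay x1 x B1 B2; rewrite ler_norml -/d => /andP[tayd _].
have frod : fro (symval (B d) *m symval Ss) <=
    fro (symval (B d) *m symval S1) + k * `|d| * sg.
  have -> : symval (B d) *m symval Ss =
      symval (B d) *m symval S1 - symval (B d) *m symval (S1 - Ss).
    by rewrite symvalB mulmxBr opprB addrC subrK.
  apply: le_trans (froB _ _) _; rewrite lerD2l.
  apply: le_trans (fro_mul _ _) _; rewrite -!symmx_norm; apply: ler_pM => //.
have kds0 : 0 <= k * `|d| * sg by rewrite !mulr_ge0// ltW.
have := sq_le_half (fro_ge0 _) (fro_ge0 _) kds0 frod.
rewrite -/d in gapd.
set s2 := fro (symval (B d) *m symval S1) ^+ 2 in gapd *.
set q2 := fro (symval (B d) *m symval Ss) ^+ 2 in coerd *.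
set hd := dotp (H d) d in tayd coerd.
set n2 := `|d| ^+ 2 in tayd coerd *.
set p := dotp S1 (B d) in gapd *.
have -> : (k * `|d| * sg) ^+ 2 = k ^+ 2 * sg ^+ 2 * n2 by rewrite /n2; ring.
have n20 : 0 <= n2 by exact: sqr_ge0.
have h1 := ler_wpM2r n20 sgc.
have hd0 : 0 <= hd by exact: H_psd.
have q20 : 0 <= q2 by exact: sqr_ge0.
move=> h2.
have -> : dotp (grad F x1 + (adjoint A y1 + adjoint B S1)) d = dotp (grad F x1) d + p.
  by rewrite 2!dotpDl !dotp_adjoint Ad dotp0r add0r.
have h3 : 2^-1 * q2 <= K * (- p + c * n2) by lra.
have h4 : (2 * K)^-1 * q2 <= - p + c * n2.
  by rewrite invfM -mulrA mulrCA ler_pdivrMl.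
have h5 : 4 * c * n2 <= 2^-1 * hd + (2 * K)^-1 * q2.
  pose mn := Num.min 2^-1 (2 * K)^-1.
  have mn0 : 0 < mn by rewrite lt_min invr_gt0 ltr0n invr_gt0 mulr_gt0.
  have : mn / C * n2 <= mn * (hd + q2).
    by rewrite -mulrA ler_pM2l// mulrC ler_pdivrMr// mulrC.
  have m1 : mn * hd <= 2^-1 * hd by rewrite ler_wpM2r// ge_min lexx.
  have m2 : mn * q2 <= (2 * K)^-1 * q2 by rewrite ler_wpM2r// ge_min lexx orbT.
  by rewrite cE -/mn; lra.
have cn0 : 0 <= c * n2 by rewrite mulr_ge0// ltW.
move: tayd h4 h5 cn0; rewrite -(mulrA 4 c n2).
by move: ((2 * K)^-1 * q2) (c * n2) (dotp (grad F x1) d) => z cn gd; lra.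
Qed.

(** A minimiser over the ball exists by compactness; growth at [xs] keeps it in
  the interior of the ball, so it has a multiplier, and the previous lemma gives
  growth around it. *)
Lemma tilted_minimizers : exists c dl rho : R, [/\ 0 < c, 0 < dl, 0 < rho &
  let P v x := [/\ `|x - xs| <= dl, Gamma x & forall y, `|y - xs| <= dl -> Gamma y ->
    F x - dotp v x + c * `|y - x| ^+ 2 <= F y - dotp v y] in
  P 0 xs /\ forall v, `|v| < rho -> exists x, P v x].
Proof.
have [c [dl0 [eta [c0 dl00 eta0 growth]]]] := uniform_growth.
have [r1 r10 mult] := normal_multiplier regular nondegenerate.
have [r2 r20 [rN tay]] := grad_taylor Ns_open Ns_xs gradF_diff hessF_cont ltr01.
have [h h0 Hh] := linear_bound Hlin.
pose dl := Num.min (Num.min dl0 r1) (Num.min (r2 / 2) (eta / 2 / (1 + h))).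
have h1 : 0 < 1 + h by rewrite addr_gt0.
have dlgt0 : 0 < dl by rewrite !lt_min dl00 r10 !divr_gt0.
have dlP x : `|x - xs| <= dl -> [/\ `|x - xs| <= dl0, `|x - xs| <= r1, Ns x &
    `|grad F x - grad F xs| <= eta / 2].
  rewrite !le_min => /andP[/andP[xd xr1] /andP[xr2 xe]]; split=> //.
    by apply: rN; lra.
  have xx : `|xs - xs| < r2 by rewrite subrr normr0.
  have xx' : `|x - xs| < r2 by lra.
  have := tay xs x xx xx'; have := Hh (x - xs) => e1 e2.
  have : `|grad F x - grad F xs| <= `|H (x - xs)| + `|grad F x - grad F xs - H (x - xs)|.
    by rewrite -{1}(subrK (H (x - xs)) (grad F x - grad F xs)) addrC ler_normD.
  have : `|x - xs| * (1 + h) <= eta / 2 by rewrite -ler_pdivlMr.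
  have : `|H (x - xs)| <= h * `|x - xs| by exact: e1.
  lra.
pose rho := Num.min (eta / 2) (c * dl / 2).
have rho0 : 0 < rho by rewrite lt_min !divr_gt0 ?mulr_gt0.
pose P v x := [/\ `|x - xs| <= dl, Gamma x & forall y, `|y - xs| <= dl -> Gamma y ->
  F x - dotp v x + c * `|y - x| ^+ 2 <= F y - dotp v y].
have xs0 : `|xs - xs| <= dl by rewrite subrr normr0 ltW.
have P0 : P 0 xs.
  split=> // y yr Gy; have [yd _ _ _] := dlP y yr; have [xd _ _ _] := dlP xs xs0.
  have := growth xs y ys Ss xs_feasible Gy xd yd Ss_normal.
  rewrite stationary addNr normr0 => /(_ (ltW eta0)).
  by rewrite subrr !dotp0l; lra.
have Pex v : `|v| < rho -> exists x, P v x.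
  rewrite lt_min => /andP[ve vc].
  pose D := Gamma `&` [set x | `|x - xs| <= dl].
  have [||||x [Gx xr] xmin] := @exists_argmin R X D (dl + `|xs|) (fun x => F x - dotp v x).
  - by exists xs.
  - apply: closedI; first exact: feasible_closed.
    apply: (@closed_fun_le _ _ (fun x : X => `|x - xs|)).
    move=> x; apply: (@continuous_comp _ _ _ (fun x => x - xs) (fun x => `|x|)).
      by apply: cvgB; [exact: cvg_id|exact: cvg_cst].
    exact: norm_continuous.
  - move=> x [_ /= xr]; rewrite -(subrK xs x); apply: le_trans (ler_normD _ _) _.
    by rewrite lerD2r.
  - move=> x [_ /= xr]; have [_ _ Nx _] := dlP x xr.
    apply: cvgB; first by apply: differentiable_continuous; exact: F_diff.
    suff : continuous (fun x : X => dotp v x : R) by apply.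
    rewrite (_ : (fun x => _) = fun x => dotp x v); last by apply/funext => y; rewrite dotpC.
    exact: dotp_continuous.
  have [xd0 xr1 Nx gx] := dlP x xr.
  have [_ _ g0] := P0.
  have := g0 x xr Gx; have := xmin xs (conj xs_feasible xs0).
  rewrite !dotp0l => m1 m2.
  have m3 : c * `|x - xs| ^+ 2 <= `|v| * `|x - xs|.
    by have := dotp_le v (x - xs); rewrite dotpBr; lra.
  have xlt : `|x - xs| < dl.
    have [->//|xn0] := eqVneq `|x - xs| 0.
    have xp : 0 < `|x - xs| by rewrite lt_def xn0 normr_ge0.
    move: m3; rewrite expr2 mulrA ler_pM2r// => m3.
    have : c * `|x - xs| < c * dl by have := mulr_gt0 c0 dlgt0; lra.
    by rewrite ltr_pM2l.
  have NC : normal_cone Gamma x (v - grad F x).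
    have Gconv := @feasible_convex R X m n A B b B0.
    have rpos : 0 < dl - `|x - xs| by rewrite subr_gt0.
    apply: (local_min_normal Ns_open Nx F_diff gradF_diff hessF_cont Gconv Gx rpos).
    move=> y yr Gy; apply: xmin; split=> //=.
    by rewrite -(subrK x y) -addrA; apply: le_trans (ler_normD _ _) _; lra.
  have [y1 [S1 [S1N u1E]]] := mult x _ Gx xr1 NC.
  exists x; split=> // y yr Gy; have [yd _ _ _] := dlP y yr.
  have := growth x y y1 S1 Gx Gy xd0 yd S1N; rewrite u1E.
  have ueta : `|v - grad F x + grad F xs| <= eta.
    rewrite -addrA; apply: le_trans (ler_normD _ _) _.
    by rewrite addrC (distrC (grad F xs)) || rewrite addrC; rewrite -normrN opprD opprK in gx *; lra.
  move=> /(_ ueta); rewrite (addrC (grad F x)) subrK dotpBr; lra.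
exists c, dl, rho; split=> //; split=> //.
Qed.

End Sufficiency.


(** * Tilt stability implies the second-order condition *)

Section SymmetricCompression.
Context {R : realType} {n : nat}.
Variable P : 'M[R]_n.
Hypothesis PT : P^T = P.

(** A matrix product is not a symmetric matrix by typing, whence the projection
  [vsproj] onto the space of symmetric matrices. *)
Definition compress (Y : symmx R n) : symmx R n := vsproj _ (P *m symval Y *m P).

Lemma symval_compress Y : symval (compress Y) = P *m symval Y *m P.
Proof.
rewrite /symval /compress vsprojK//; apply/fixedSpaceP.
by rewrite lfunE/= !trmx_mul PT -/(symval Y) symval_tr mulmxA.
Qed.

Lemma compress_linear : linear compress.
Proof.
move=> a Y Z; apply: symval_inj.
rewrite symvalD symvalZ !symval_compress symvalD symvalZ.
by rewrite mulmxDr mulmxDl -scalemxAr -scalemxAl.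
Qed.

Lemma compress0 : compress 0 = 0.
Proof. by apply: symval_inj; rewrite symval_compress symval0 mulmx0 mul0mx. Qed.

Lemma compress_self_adjoint Y Z : dotp (compress Y) Z = dotp Y (compress Z).
Proof. by rewrite !symmx_dotp !symval_compress inn_mulr inn_mull PT mulmxA. Qed.

End SymmetricCompression.

Section Necessity.
Context {R : realType} {X : euclideanType R} {m n : nat}.
Variables (A : {linear X -> evec R m}) (B : {linear X -> symmx R n}).

(** Nondegeneracy, dualised: the compression of [B] to the kernel of [Xs] maps
  the kernel of [A] onto all symmetric matrices of that kernel. *)
Lemma compressed_surjective (Xs P : 'M[R]_n) : P^T = P -> P *m P = P -> Xs *m P = 0 ->
  (forall y (S : symmx R n), Xs *m S = 0 ->
     adjoint A y + adjoint B S = 0 -> y = 0 /\ S = 0) ->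
  forall C : 'M[R]_n, C^T = C -> P *m C *m P = C ->
  exists2 z, A z = 0 & P *m symval (B z) *m P = C.
Proof.
move=> PT PP XP nondeg C CT PCP.
pose T (p : eprod X (symmx R n)) : eprod (evec R m) (symmx R n) :=
  (A p.1, B p.1 + (p.2 - compress P p.2)).
have Tl : linear T.
  move=> a [x Y] [x' Y']; rewrite /T /=; congr pair; first by rewrite linearP.
  rewrite (linearP B) (compress_linear PT) opprD (addrACA (a *: Y)) -scalerBr.
  by rewrite addrACA -scalerDr.
pose T' : {linear eprod X (symmx R n) -> eprod (evec R m) (symmx R n)} :=
  HB.pack T (GRing.isLinear.Build R _ _ *:%R T Tl).
have CS := symmx_exists CT; have [D DE] := CS.
have [|[z Y] /= TE] := @linear_surjective _ _ _ T' _ ((0, D) : eprod (evec R m) (symmx R n)).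
  move=> [y S] yS0.
  have E x Y : dotp y (A x) + dotp S (B x + (Y - compress P Y)) = 0.
    have := dotp_adjoint T' (y, S) (x, Y); rewrite yS0 dotp0l eprod_dotp.
    by move=> ->.
  have Sc : S - compress P S = 0.
    apply: dotp_eq0 => Y; have := E 0 Y; rewrite !linear0 dotp0r !add0r => E0.
    by rewrite -[RHS]E0 dotpBl dotpBr -[dotp S (compress P Y)](compress_self_adjoint PT).
  have XS : Xs *m symval S = 0.
    rewrite (subr0_eq Sc) symval_compress// !mulmxA XP !mul0mx//.
  have AB0 : adjoint A y + adjoint B S = 0.
    apply: dotp_eq0 => x; have := E x 0; rewrite (compress0 PT) subrr addr0 => <-.
    by rewrite dotpDl !dotp_adjoint.
  by have [-> ->] := nondeg y S XS AB0.
exists z; first exact: (congr1 fst TE).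
have := congr1 (fun p => symval p.2) TE => /= E2.
have E3 : symval (B z) + (symval Y - P *m symval Y *m P) = C.
  by rewrite -DE -E2 -(symval_compress PT).
have := congr1 (fun M => P *m M *m P) E3; rewrite PCP => <-.
by rewrite mulmxDr mulmxDl mulmxBr mulmxBl !mulmxA PP -(mulmxA _ P P) PP subrr addr0.
Qed.

(** Two curves with the same quadratic term and velocities [z], [z + w] stay
  feasible, while one multiplier [S1], the conjugate of [Ss] by
  [1 - s G (B z)] with [G] the Moore-Penrose inverse of [Xs], is complementary to
  both up to [O(s^2 dl + s^3)].  The velocity [z] pushes the eigenvalues that are
  zero for both [Xs] and [Ss] to positive values, which makes room for any [w]
  with [B w] orthogonal to [Ss]; the quadratic term [q] compensates the Schur
  complement of [B z] up to the margin [dl]. *)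
Lemma complementary_curves (Xs Ss : symmx R n) :
  psd Xs -> psd (- symval Ss) -> symval Xs *m symval Ss = 0 ->
  (forall y (S : symmx R n), symval Xs *m S = 0 ->
     adjoint A y + adjoint B S = 0 -> y = 0 /\ S = 0) ->
  forall w, symval (B w) *m symval Ss = 0 -> fro (symval (B w)) <= 2^-1 ->
  exists2 K : R, 0 <= K & forall dl : R, 0 < dl -> exists (z q : X) (s0 C : R),
   [/\ A z = 0, A q = 0, 0 < s0, 0 <= C & forall s, 0 < s < s0 ->
   exists S1 : symmx R n, [/\ psd (- symval S1), `|S1 - Ss| <= C * s &
   forall u, u = 0 \/ u = w ->
     let M := Xs + s *: B (z + u) + s ^+ 2 *: B q in
     psd (symval M) /\ - dotp S1 M <= s ^+ 2 * (K * dl + C * s)]].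
Proof.
move=> Xp Tp XS nondeg w WS Whalf.
pose Xm : 'M[R]_n := symval Xs; pose T : 'M[R]_n := - symval Ss.
have XT : Xm *m T = 0 by rewrite /T mulmxN XS oppr0.
have XmT : Xm^T = Xm by exact: symval_tr.
have [G [l [[GT l0] XG XGX GXG lX]]] := psd_pinv Xp.
have [J [_ [[JT _] TJ TJT _ _]]] := psd_pinv Tp.
rewrite -/T -/Xm in XG XGX GXG lX TJ TJT.
have TT : T^T = T by exact: psd_tr.
pose Pg := T *m J; pose Pc := 1%:M - Xm *m G; pose Pb := Pc - Pg.
have PgT : Pg^T = Pg by rewrite /Pg trmx_mul JT TT TJ.
have PcT : Pc^T = Pc by rewrite /Pc linearB/= trmx1 trmx_mul GT XmT XG.
have PbT : Pb^T = Pb by rewrite /Pb linearB/= PcT PgT.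
have XPc : Xm *m Pc = 0 by rewrite /Pc mulmxBr mulmx1 XG mulmxA XGX subrr.
have PcX : Pc *m Xm = 0 by rewrite -[Pc]trmxK -[X in _ *m X]trmxK -trmx_mul PcT XmT XPc trmx0.
have XPg : Xm *m Pg = 0 by rewrite /Pg mulmxA XT mul0mx.
have XPb : Xm *m Pb = 0 by rewrite /Pb mulmxBr XPc XPg subrr.
have PcPg : Pc *m Pg = Pg by rewrite /Pc mulmxBl mul1mx XG -mulmxA XPg mulmx0 subr0.
have PgPc : Pg *m Pc = Pg by rewrite -[LHS]trmxK trmx_mul PcT PgT PcPg PgT.
have PgPg : Pg *m Pg = Pg by rewrite /Pg mulmxA TJT.
have PcPc : Pc *m Pc = Pc by rewrite {2}/Pc mulmxBr mulmx1 mulmxA PcX mul0mx subr0.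
have PcPb : Pc *m Pb = Pb by rewrite /Pb mulmxBr PcPc PcPg.
have PbPc : Pb *m Pc = Pb by rewrite -[LHS]trmxK trmx_mul PcT PbT PcPb PbT.
have PbPg : Pb *m Pg = 0 by rewrite /Pb mulmxBl PcPg PgPg subrr.
have PbPb : Pb *m Pb = Pb by rewrite {2}/Pb mulmxBr PbPc PbPg subr0.
have PE : Xm *m G + Pb + Pg = 1%:M by rewrite /Pb /Pc addrA subrK addrC subrK.
have TPg : T *m Pg = T by rewrite TJ || rewrite /Pg; rewrite /Pg TJ mulmxA TJT.
have PgTPg : T = Pg *m T *m Pg.
  by rewrite -mulmxA TPg -[LHS]TT -[in LHS]TPg trmx_mul PgT TT.
pose Wm : 'M[R]_n := symval (B w).
have WmT : Wm^T = Wm by exact: symval_tr.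
have WPg : Wm *m Pg = 0 by rewrite /Pg mulmxA /T mulmxN WS oppr0 mul0mx.
have PgW : Pg *m Wm = 0 by rewrite -[LHS]trmxK trmx_mul PgT WmT WPg trmx0.
have PcE : Pc = 1%:M - Xm *m G by [].
clearbody Pg Pb Pc.
have surj := compressed_surjective PcT PcPc XPc nondeg.
have PbC : Pc *m Pb *m Pc = Pb by rewrite PcPb PbPc.
have [z Az zE] := surj Pb PbT PbC.
pose Z : 'M[R]_n := symval (B z).
have ZT : Z^T = Z by exact: symval_tr.
rewrite -/Z in zE.
exists (fro T * fro Pg); first by rewrite mulr_ge0 ?fro_ge0.
move=> dl dl0.
pose Cq := Pg *m Z *m G *m Z *m Pg + dl *: Pg.
have CqT : Cq^T = Cq by rewrite /Cq linearD/= linearZ/= !trmx_mul PgT ZT GT !mulmxA.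
have PCqP : Pc *m Cq *m Pc = Cq.
  rewrite /Cq mulmxDr mulmxDl -scalemxAr -scalemxAl !mulmxA PcPg PgPc.
  by rewrite -(mulmxA _ Pg Pc) PgPc.
have [q Aq qE] := surj Cq CqT PCqP.
pose Y : 'M[R]_n := symval (B q).
have YT : Y^T = Y by exact: symval_tr.
rewrite -/Y in qE.
have PgYPg : Pg *m Y *m Pg = Cq.
  have := congr1 (fun M => Pg *m M *m Pg) qE.
  rewrite !mulmxA PgPc -(mulmxA _ Pc Pg) PcPg => ->.
  rewrite /Cq mulmxDr mulmxDl !mulmxA PgPg -(mulmxA _ Pg Pg) PgPg.
  by rewrite -scalemxAr -scalemxAl PgPg PgPg.
have ZPg : Z *m Pg = Xm *m G *m Z *m Pg.
  have : Pc *m Z *m Pg = 0.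
    have := congr1 (fun M => M *m Pg) zE.
    by rewrite -(mulmxA _ Pc Pg) PcPg PbPg.
  rewrite PcE mulmxBl mul1mx mulmxBl => /eqP; rewrite subr_eq0 => /eqP ->.
  by [].
have quadZ_b v : quad Z (Pb *m v) = fro (Pb *m v) ^+ 2.
  rewrite /quad -innMM !inn_mull PbT; congr (inn v _).
  have -> : Pb *m (Z *m (Pb *m v)) = Pb *m (Pc *m Z *m Pc) *m (Pb *m v).
    by rewrite !mulmxA PbPc -(mulmxA _ Pc Pb) PcPb.
  by rewrite zE PbPb.
have inst u : u = 0 \/ u = w ->
  [/\ (symval (B (z + u)))^T = symval (B (z + u)),
     symval (B (z + u)) *m Pg = Z *m Pg,
     Pg *m symval (B (z + u)) = Pg *m Z &
     forall v, 2^-1 * fro (Pb *m v) ^+ 2 <= quad (symval (B (z + u))) (Pb *m v)].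
  move=> uw; have E : symval (B (z + u)) = Z + symval (B u) by rewrite linearD symvalD.
  have [u0|u0] : symval (B u) = 0 \/ symval (B u) = Wm.
    by case: uw => ->; [left; rewrite linear0 symval0|right].
    rewrite E u0 addr0; split=> // v; rewrite quadZ_b.
    by have := sqr_ge0 (fro (Pb *m v)); lra.
  rewrite E u0 mulmxDl WPg addr0 mulmxDr PgW addr0; split=> //.
    by rewrite linearD/= ZT WmT.
  move=> v; rewrite quad_addl quadZ_b.
  have := quad_le Wm (Pb *m v); rewrite ler_norml => /andP[h _].
  have := ler_wpM2r (sqr_ge0 (fro (Pb *m v))) Whalf; rewrite -/Wm; lra.
have main u : u = 0 \/ u = w -> exists s0 C : R, [/\ 0 < s0, 0 <= C & forall s, 0 < s < s0 ->
    let M := Xm + s *: symval (B (z + u)) + s ^+ 2 *: Y in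
    let U := 1%:M - s *: (G *m Z) in
    psd M /\ fro (Pg *m U^T *m M *m U *m Pg) <= s ^+ 2 * (dl * fro Pg + C * s)].
  move=> /inst[VT VPg PgV Vpos].
  set V := symval (B (z + u)) in VT VPg PgV Vpos *.
  have VPg' : V *m Pg = Xm *m G *m V *m Pg by rewrite VPg ZPg -(mulmxA _ V Pg) VPg mulmxA.
  have PgYPg' : Pg *m Y *m Pg = Pg *m V *m G *m V *m Pg + dl *: Pg.
    by rewrite PgYPg /Cq PgV -(mulmxA _ V Pg) VPg mulmxA.
  have half0 : 0 < (2^-1 : R) by rewrite invr_gt0.
  have [s0 [C [s00 C0 h]]] := psd_two_scale XmT VT YT GT PgT XG XGX GXG l0 lX PE XPb XPg PgPg
     VPg' PgYPg' half0 Vpos dl0.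
  exists s0, C; split; [exact: s00|exact: C0|move=> s ss].
  have [Mp Mb] := h s ss; split; first exact: Mp.
  have UPg : (1%:M - s *: (G *m Z)) *m Pg = (1%:M - s *: (G *m V)) *m Pg.
    by rewrite !mulmxBl !mul1mx -!scalemxAl -!mulmxA VPg.
  have PgU : Pg *m (1%:M - s *: (G *m Z))^T = Pg *m (1%:M - s *: (G *m V))^T.
    by have := congr1 trmx UPg; rewrite [in LHS]trmx_mul [in RHS]trmx_mul PgT.
  move: Mb; rewrite PgU -(mulmxA _ _ Pg) -UPg mulmxA; apply.
have [s1 [C1 [s10 C10 h1]]] := main 0 (or_introl erefl).
have [s2 [C2 [s20 C20 h2]]] := main w (or_intror erefl).
pose GZ := G *m Z.
pose D := 2 * (fro GZ * fro T) + fro GZ * fro T * fro GZ.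
have D0 : 0 <= D by apply: addr_ge0; rewrite !mulr_ge0 ?fro_ge0.
exists z, q, (Num.min 1 (Num.min s1 s2)), (D + fro T * (C1 + C2)); split=> //.
- by rewrite !lt_min ltr01 s10.
- by apply: addr_ge0 => //; apply: mulr_ge0; rewrite ?fro_ge0// addr_ge0.
move=> s /andP[sgt0]; rewrite !lt_min => /and3P[sl1 ss1 ss2].
pose U := 1%:M - s *: GZ.
have S1T : (U *m symval Ss *m U^T)^T = U *m symval Ss *m U^T.
  by rewrite !trmx_mul trmxK symval_tr mulmxA.
have [S1 S1E] := symmx_exists S1T.
have T0 := fro_ge0 T.
exists S1; split.
- rewrite S1E -mulNmx -mulmxN; exact: psd_conj.
- rewrite symmx_norm symvalB S1E.
  pose N := s *: GZ; have UE : U = 1%:M - N by [].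
  have -> : U *m symval Ss *m U^T - symval Ss =
      N *m symval Ss *m N^T - N *m symval Ss - symval Ss *m N^T.
    rewrite UE linearB/= trmx1 mulmxBl mul1mx mulmxBr mulmx1 mulmxBl.
    move: (N *m symval Ss *m N^T) (N *m symval Ss) (symval Ss *m N^T) => a c e.
    by rewrite opprB addrAC (addrAC (symval Ss)) subrr add0r addrA (addrC (- c)).
  have SsT : fro (symval Ss) = fro T by rewrite froN.
  have NE : fro N = s * fro GZ by rewrite froZ gtr0_norm.
  have b1 : fro (N *m symval Ss) <= s * fro GZ * fro T.
    by rewrite -NE -SsT; exact: fro_mul.
  have b2 : fro (symval Ss *m N^T) <= s * fro GZ * fro T.
    by rewrite -NE -SsT mulrC -[X in _ <= _ * X]fro_tr; exact: fro_mul.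
  have b3 : fro (N *m symval Ss *m N^T) <= s * (fro GZ * fro T * fro GZ).
    apply: le_trans (fro_mul _ _) _; rewrite fro_tr NE.
    apply: (@le_trans _ _ (s * fro GZ * fro T * (1 * fro GZ))); last by rewrite mul1r !mulrA.
    apply: ler_pM => //; rewrite ?fro_ge0 ?mulr_ge0 ?fro_ge0 ?(ltW sgt0)//.
    by rewrite ler_wpM2r ?fro_ge0// ltW.
  apply: le_trans (froB _ _) _; have := froB (N *m symval Ss *m N^T) (N *m symval Ss).
  have : 0 <= s * (fro T * (C1 + C2)) by rewrite !mulr_ge0 ?addr_ge0// ltW.
  by rewrite /D; lra.
- move=> u uw M.
  have ME : symval M = Xm + s *: symval (B (z + u)) + s ^+ 2 *: Y.
    by rewrite /M 2!symvalD 2!symvalZ.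
  have [Mp Mb] : psd (symval M) /\ fro (Pg *m U^T *m symval M *m U *m Pg)
      <= s ^+ 2 * (dl * fro Pg + (C1 + C2) * s).
    have sC (C' : R) : C' <= C1 + C2 -> s ^+ 2 * (dl * fro Pg + C' * s) <=
        s ^+ 2 * (dl * fro Pg + (C1 + C2) * s).
      by move=> CC; rewrite ler_wpM2l ?sqr_ge0// lerD2l ler_wpM2r// ltW.
    rewrite ME; case: uw => ->.
      have [|Mp Mb] := h1 s; first by rewrite sgt0.
      by split=> //; apply: le_trans Mb (sC _ _); rewrite lerDl.
    have [|Mp Mb] := h2 s; first by rewrite sgt0.
    by split=> //; apply: le_trans Mb (sC _ _); rewrite lerDr.
  split=> //.
  have -> : - dotp S1 M = inn T (Pg *m U^T *m symval M *m U *m Pg).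
    have -> : - dotp S1 M = inn (U *m T *m U^T) (symval M).
      by rewrite symmx_dotp S1E -innNl /T mulmxN mulNmx.
    rewrite inn_mulr trmxK inn_mull {1}PgTPg inn_mulr inn_mull PgT.
    by rewrite !mulmxA.
  apply: le_trans (inn_le _ _) _; apply: le_trans (ler_wpM2l T0 Mb) _.
  have := mulr_ge0 (sqr_ge0 s) (mulr_ge0 D0 (ltW sgt0)).
  lra.
Qed.

End Necessity.


Lemma normB_sq_le {R : realType} {V : normedModType R} (x y z : V) :
  `|x - y| ^+ 2 <= 2 * (`|x - z| ^+ 2 + `|y - z| ^+ 2).
Proof.
have h : `|x - y| <= `|x - z| + `|y - z|.
  by rewrite (distrC y) -(subrKA z x (- y)); exact: ler_normD.
have := sq_le_half (normr_ge0 _) (normr_ge0 _) (normr_ge0 _) h.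
by rewrite ler_pdivrMl.
Qed.

Lemma gap_contradiction {R : realType} (p d t1 t2 e : R) : 0 < p ->
  2^-1 * p <= d - t1 - t2 -> d <= p / 8 -> - t1 <= e -> - t2 <= e -> e <= p / 16 -> False.
Proof. by move=> *; suff : false by []; lra. Qed.

Section GrowthNecessity.
Context {R : realType} {X : euclideanType R} {m n : nat}.
Variables (A : {linear X -> evec R m}) (B : {linear X -> symmx R n}).
Variables (b : evec R m) (B0 : symmx R n).
Variable F : X -> R.
Variable xs : X.
Hypothesis xs_feasible : feasible A B b B0 xs.
Variable Ns : set X.
Hypothesis Ns_open : open Ns.
Hypothesis Ns_xs : Ns xs.
Local Notation g := (constraint B B0).
Local Notation Gamma := (feasible A B b B0).
Local Notation H := (hess F xs).
Hypothesis F_diff : forall x, Ns x -> differentiable F x.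
Hypothesis gradF_diff : forall x, Ns x -> differentiable (grad F) x.
Hypothesis hessF_cont : forall x, Ns x -> forall h, {for x, continuous (fun y => hess F y h)}.
Hypothesis hessF_psd : forall x, Ns x -> psd_op (hess F x).
Hypothesis nondegenerate : forall y (S : symmx R n), (g xs : 'M[R]_n) *m S = 0 ->
  adjoint A y + adjoint B S = 0 -> y = 0 /\ S = 0.
Variables (ys : evec R m) (Ss : symmx R n).
Hypothesis Ss_normal : normal_cone (@psd_cone R n) (g xs) Ss.
Hypothesis stationary : adjoint A ys + adjoint B Ss = - grad F xs.
Variables (c dlt rho L : R).
Hypotheses (c0 : 0 < c) (dlt0 : 0 < dlt) (rho0 : 0 < rho) (L0 : 0 < L).
Hypothesis growth : forall v, `|v| < rho -> exists x, [/\ `|x - xs| <= dlt, Gamma x,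
  `|x - xs| <= L * `|v| & forall y, `|y - xs| <= dlt -> Gamma y ->
     F x - dotp v x + c * `|y - x| ^+ 2 <= F y - dotp v y].

(** Two feasible points that almost satisfy complementarity with a common
  multiplier [S1] are both almost minimal for the same tilt, hence close. *)
Lemma near_minimizers_close (r : R) (x1 x2 v : X) (S1 : symmx R n) :
  (forall x, `|x - xs| < r -> Ns x) ->
  `|x1 - xs| < r -> `|x1 - xs| <= dlt -> `|x2 - xs| <= dlt -> `|v| < rho -> L * `|v| < r ->
  Gamma x1 -> Gamma x2 -> psd (- symval S1) ->
  v = grad F x1 + (adjoint A ys + adjoint B S1) ->
  2^-1 * c * `|x2 - x1| ^+ 2 <=
    F x2 - F x1 - dotp (grad F x1) (x2 - x1) - dotp S1 (g x1) - dotp S1 (g x2).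
Proof.
move=> rN x1r x1d x2d vrho Lv Gx1 Gx2 S1p vE.
have [xv [xvd Gxv xvL xvmin]] := growth vrho.
have xvr : `|xv - xs| < r by exact: le_lt_trans xvL Lv.
have vdot x y : Gamma x -> Gamma y -> dotp v x - dotp v y =
    dotp (grad F x1) x - dotp (grad F x1) y + (dotp S1 (g x) - dotp S1 (g y)).
  move=> [Ax _] [Ay _]; rewrite -(dotpBr v) -(dotpBr (grad F x1)) -(dotpBr S1).
  rewrite vE 2!dotpDl !dotp_adjoint (constraintB B B0) (linearB A)/=.
  by rewrite Ax Ay subrr dotp0r add0r.
have conv := convex_below F_diff gradF_diff
  (fun z zr => conj (rN z zr) (hessF_psd (rN z zr))) x1r xvr.
have Sxv : dotp S1 (g xv) <= 0.
  have [_ gxv] := Gxv; have := psd_inn_ge0 S1p gxv.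
  by rewrite innNl -[inn _ _]/(dotp S1 (g xv)); lra.
have e1 := xvmin x1 x1d Gx1; have e2 := xvmin x2 x2d Gx2.
have d1 := vdot x1 xv Gx1 Gxv; have d2 := vdot x2 xv Gx2 Gxv; have d3 := vdot x2 x1 Gx2 Gx1.
have := ler_wpM2l (ltW c0) (normB_sq_le x2 x1 xv).
move: e1 e2 d1 d2 d3 Sxv conv; rewrite !(dotpBr (grad F x1)).
move: (dotp v x1) (dotp v x2) (dotp v xv) (dotp S1 (g x1)) (dotp S1 (g x2)) (dotp S1 (g xv))
  => v1 v2 v3 s1 s2 s3.
move: (dotp (grad F x1) x1) (dotp (grad F x1) x2) (dotp (grad F x1) xv) (F x1) (F x2) (F xv)
  => g1 g2 g3 f1 f2 f3.
move: (`|x2 - x1| ^+ 2) (`|x2 - xv| ^+ 2) (`|x1 - xv| ^+ 2) => n1 n2 n3.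
by lra.
Qed.

Lemma growth_second_order w : H w = 0 -> A w = 0 ->
  symval (B w) *m symval Ss = 0 -> w = 0.
Proof.
have BZ a u : B (a *: u) = a *: B u by exact: linearZ.
have AZ a u : A (a *: u) = a *: A u by exact: linearZ.
have [_ gxs] := xs_feasible.
have [Tp XSs] : psd (- symval Ss) /\ symval (g xs) *m symval Ss = 0.
  by apply/normal_psdP.
(* The velocities [z] and [z + w] must both push the common kernel of [g xs]
  and [Ss] inside the cone, which needs [w] to be short. *)
suff small w' : H w' = 0 -> A w' = 0 -> symval (B w') *m symval Ss = 0 ->
    fro (symval (B w')) <= 2^-1 -> w' = 0.
  move=> Hw Aw BwS; pose a := 2^-1 / (fro (symval (B w)) + 1).
  have f1 : 0 < fro (symval (B w)) + 1 by rewrite ltr_wpDl ?fro_ge0.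
  have a0 : 0 < a by rewrite divr_gt0// invr_gt0.
  have BaE : symval (B (a *: w)) = a *: symval (B w) by rewrite BZ symvalZ.
  have : a *: w = 0.
    apply: small; first by rewrite hessZ Hw scaler0.
    - by rewrite AZ Aw scaler0.
    - by rewrite BaE -scalemxAl BwS scaler0.
    rewrite BaE froZ gtr0_norm// /a mulrAC ler_pdivrMr//.
    by rewrite ler_pM2l ?invr_gt0// lerDl.
  by move/eqP; rewrite scaler_eq0 gt_eqF//= => /eqP.
move=> Hw Aw BwS Bw2; apply/eqP; apply: contraT => w0.
have [K K0 curves] := complementary_curves gxs Tp XSs nondegenerate BwS Bw2.
have n20 : 0 < `|w'| ^+ 2 by rewrite exprn_gt0// normr_gt0.
pose n2 := `|w'| ^+ 2; rewrite -/n2 in n20.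
(* With this margin [K * mg] contributes at most [c * n2 / 32 * s ^+ 2] to each
  of the two gaps of complementarity. *)
pose mg := c * n2 / 32 / (K + 1).
have K1 : 0 < K + 1 by rewrite ltr_wpDl.
have mg0 : 0 < mg by rewrite !divr_gt0// mulr_gt0.
have Kmg : K * mg <= c * n2 / 32.
  have : (K + 1) * mg = c * n2 / 32 by rewrite mulrC divfK ?gt_eqF.
  by move: (ltW mg0); lra.
have [z [q [s0 [C [Az Aq s00 C0 curve]]]]] := curves mg mg0.
have e0 : 0 < c / 8 by rewrite divr_gt0.
have [r1 r10 tay] := fun_taylor Ns_open Ns_xs F_diff gradF_diff hessF_cont e0.
have [r2 r20 [rN gtay]] := grad_taylor Ns_open Ns_xs gradF_diff hessF_cont ltr01.
have [h h0 Hh] := linear_bound (HB.pack H (GRing.isLinear.Build R X X *:%R H (@hess_linear _ _ F xs))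
  : {linear X -> X}).
have [k k0 Bk] := linear_bound (adjoint B : {linear symmx R n -> X}).
pose D := `|z| + `|q| + `|w'|.
have D0 : 0 <= D by rewrite !addr_ge0.
pose E := (h + 1) * D + k * C.
have E0 : 0 <= E by rewrite addr_ge0// mulr_ge0// ?addr_ge0// ltW.
pose r := Num.min (Num.min r1 r2) (Num.min dlt rho).
have r0 : 0 < r by rewrite !lt_min r10 r20 dlt0.
(* Each requirement below on [s] bounds a product [s * y] with [y <= big]. *)
pose big := D + E + L * E + C + 1.
have LE0 : 0 <= L * E by rewrite mulr_ge0// ltW.
have big0 : 0 < big by rewrite /big; move: D0 E0 LE0 C0; lra.
pose t := Num.min (Num.min s0 1) (Num.min r (c * n2 / 32) / big).
pose s := t / 2.
have t0 : 0 < t by rewrite !lt_min s00 ltr01 divr_gt0// lt_min r0 divr_gt0// mulr_gt0.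
have sgt0 : 0 < s by rewrite divr_gt0.
have st : s < t by rewrite /s; lra.
have /and3P[ss0 s1 sb] : [&& s < s0, s < 1 & s < Num.min r (c * n2 / 32) / big].
  by move: st; rewrite /t !lt_min => /andP[/andP[-> ->] ->].
have {}sb : s * big < Num.min r (c * n2 / 32) by rewrite -ltr_pdivlMr.
have {sb}[sr sc] : s * big < r /\ s * big < c * n2 / 32.
  by move: sb; rewrite lt_min => /andP[].
have sbE y : y <= big -> s * y <= s * big by move=> yb; rewrite ler_pM2l.
have sD : s * D < r by apply: le_lt_trans (sbE _ _) sr; rewrite /big; lra.
have sE : s * E < r by apply: le_lt_trans (sbE _ _) sr; rewrite /big; lra.
have sLE : s * (L * E) < r by apply: le_lt_trans (sbE _ _) sr; rewrite /big; lra.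
have sC : s * C < c * n2 / 32 by apply: le_lt_trans (sbE _ _) sc; rewrite /big; lra.
have [S1 [S1p S1Ss gaps]] := curve s ltac:(by rewrite sgt0).
pose x u := xs + (s *: (z + u) + s ^+ 2 *: q).
have gx u : g (x u) = g xs + s *: B (z + u) + s ^+ 2 *: B q.
  by rewrite /x constraintD (linearD B) !BZ addrA.
have Gx u : u = 0 \/ u = w' -> Gamma (x u).
  move=> uw; have [Axs _] := xs_feasible; split.
    rewrite /x (linearD A) (linearD A) !AZ (linearD A) /= Az Aq Axs.
    have -> : A u = 0 by case: uw => ->; rewrite ?linear0.
    by rewrite !addr0 !scaler0 !addr0.
  by rewrite psd_coneE gx; have [] := gaps u uw.
have gap u : u = 0 \/ u = w' -> - dotp S1 (g (x u)) <= s ^+ 2 * (K * mg + C * s).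
  by move=> uw; rewrite gx; have [] := gaps u uw.
have s2 : s ^+ 2 <= s by rewrite expr2; apply: ler_piMl; exact: ltW.
have xn u : u = 0 \/ u = w' -> `|x u - xs| <= s * D.
  move=> uw; have un : `|u| <= `|w'| by case: uw => ->; rewrite ?normr0.
  rewrite /x (addrC xs) addrK; apply: le_trans (ler_normD _ _) _.
  rewrite (normrZ s (z + u)) (normrZ (s ^+ 2) q) (gtr0_norm sgt0) (ger0_norm (sqr_ge0 s)).
  have := ler_wpM2l (ltW sgt0) (ler_normD z u).
  have := ler_wpM2l (ltW sgt0) un.
  have := ler_wpM2r (normr_ge0 q) s2.
  by rewrite /D; lra.
have rmin y : y < r -> [/\ y < r1, y < r2, y < dlt & y < rho].
  by rewrite !lt_min => /andP[/andP[-> ->] /andP[-> ->]].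
have xr u : u = 0 \/ u = w' -> `|x u - xs| < r by move=> /xn/le_lt_trans; apply.
have u0 : (0 : X) = 0 \/ (0 : X) = w' by left.
have uw : w' = 0 \/ w' = w' by right.
pose v := grad F (x 0) + (adjoint A ys + adjoint B S1).
have [x1r1 x1r2 x1d x1rho] := rmin _ (xr _ u0).
have [x2r1 x2r2 x2d x2rho] := rmin _ (xr _ uw).
have vn : `|v| <= s * E.
  have -> : v = (grad F (x 0) - grad F xs - H (x 0 - xs)) + H (x 0 - xs) + adjoint B (S1 - Ss).
    have aE : adjoint A ys = - grad F xs - adjoint B Ss by rewrite -stationary addrK.
    rewrite /v aE (linearB (adjoint B)) subrK -!addrA; congr (_ + (_ + _)).
    exact: addrC.
  apply: le_trans (ler_normD _ _) _.
  have xx : `|xs - xs| < r2 by rewrite subrr normr0.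
  have := gtay xs (x 0) xx x1r2; rewrite mul1r => n1.
  have n2' : `|H (x 0 - xs)| <= h * `|x 0 - xs| by exact: Hh.
  have n3 := le_trans (Bk (S1 - Ss)) (ler_wpM2l (ltW k0) S1Ss).
  have n4 := ler_wpM2l (ltW h0) (xn 0 u0).
  have n5 := xn 0 u0.
  have := ler_normD (grad F (x 0) - grad F xs - H (x 0 - xs)) (H (x 0 - xs)).
  by rewrite /E; lra.
have vrho : `|v| < rho.
  by have [_ _ _ h4] := rmin _ sE; exact: le_lt_trans vn h4.
have Lv : L * `|v| < r2.
  have [_ h4 _ _] := rmin _ sLE; apply: le_lt_trans h4.
  by rewrite mulrCA ler_pM2l.
have := near_minimizers_close rN x1r2 (ltW x1d) (ltW x2d) vrho Lv (Gx _ u0) (Gx _ uw) S1p erefl.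
have xE : x w' - x 0 = s *: w'.
  by rewrite /x addr0 scalerDr opprD addrACA subrr add0r opprD addrACA subrr addr0 (addrC (s *: z)) addrK.
have := tay (x 0) (x w') x1r1 x2r1.
rewrite xE hessZ Hw scaler0 dotp0l mulr0 subr0 normrZ (gtr0_norm sgt0) exprMn -/n2.
rewrite ler_norml => /andP[_ T1] T2.
have p0 : 0 < c * (s ^+ 2 * n2) by rewrite mulr_gt0// mulr_gt0// exprn_gt0.
have gp : s ^+ 2 * (K * mg + C * s) <= c * (s ^+ 2 * n2) / 16.
  rewrite (_ : c * (s ^+ 2 * n2) / 16 = s ^+ 2 * (c * n2 / 32 + c * n2 / 32)); last by field.
  by rewrite (ler_wpM2l (sqr_ge0 s))// lerD// mulrC ltW.
suff : False by [].
apply: (gap_contradiction p0 _ _ (gap 0 u0) (gap w' uw) gp).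
- by rewrite mulrA; exact: T2.
- by rewrite mulrAC; exact: T1.
Qed.

End GrowthNecessity.


(** * Ordered eigenvalues and the set of critical directions *)

Section Eigenvalues.
Context {R : realType} {n : nat}.

Lemma char_poly_diag_conj (P : 'M[R]_n) (d : 'rV[R]_n) : P^T *m P = 1%:M ->
  char_poly (P *m diag_mx d *m P^T) = \prod_i ('X - (d 0 i)%:P).
Proof.
move=> PP; have PPT : P *m P^T = 1%:M by exact: mulmx1C.
have -> : char_poly (P *m diag_mx d *m P^T) = char_poly (diag_mx d).
  rewrite /char_poly /char_poly_mx.
  have -> : 'X%:M - map_mx polyC (P *m diag_mx d *m P^T) =
      map_mx polyC P *m ('X%:M - map_mx polyC (diag_mx d)) *m map_mx polyC P^T.
    rewrite mulmxBr mulmxBl !map_mxM/=; congr (_ - _).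
    by rewrite scalar_mxC -mulmxA -map_mxM PPT map_mx1 mulmx1.
  rewrite !det_mulmx mulrAC -det_mulmx -map_mxM PPT map_mx1 det1 mul1r//.
rewrite char_poly_trig ?diag_mx_is_trig//.
by apply: eq_bigr => i _; rewrite mxE eqxx.
Qed.

(** Both lists are the sorted list of the roots. *)
Lemma sorted_roots_unique (d e : 'rV[R]_n) :
  (forall i j : 'I_n, (i <= j)%N -> d 0 j <= d 0 i) ->
  (forall i j : 'I_n, (i <= j)%N -> e 0 j <= e 0 i) ->
  \prod_i ('X - (d 0 i)%:P) = \prod_i ('X - (e 0 i)%:P) -> d = e.
Proof.
have sortedP (a : 'rV[R]_n) : (forall i j : 'I_n, (i <= j)%N -> a 0 j <= a 0 i) ->
    sorted (fun x y => y <= x) [seq a 0 i | i <- enum 'I_n].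
  move=> asort; rewrite sorted_map.
  have : sorted (relpre val leq) (enum 'I_n) by rewrite -sorted_map val_enum_ord iota_sorted.
  by apply: sub_sorted => i j /=; exact: asort.
move=> dsort esort prodE.
have /prod_XsubC_eq perm : \prod_(x <- [seq d 0 i | i <- enum 'I_n]) ('X - x%:P) =
    \prod_(x <- [seq e 0 i | i <- enum 'I_n]) ('X - x%:P).
  by rewrite !big_map -!enumT !big_enum.
have seqE : [seq d 0 i | i <- enum 'I_n] = [seq e 0 i | i <- enum 'I_n].
  apply: (sorted_eq _ _ (sortedP d dsort) (sortedP e esort) perm).
  - by move=> y x z /= xy zx; exact: le_trans zx xy.
  - by move=> x y /= /andP[yx xy]; apply/eqP; rewrite eq_le xy.
apply/rowP => i; have /eq_in_map := seqE; apply.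
by rewrite mem_enum.
Qed.

Lemma eigvals_spectral (P : 'M[R]_n) (d : 'rV[R]_n) : P^T *m P = 1%:M ->
  (forall i j : 'I_n, (i <= j)%N -> d 0 j <= d 0 i) ->
  eigvals (P *m diag_mx d *m P^T) = d.
Proof.
move=> PP dsort; rewrite /eigvals; case: xgetP => [e _ [esort eE]|/(_ d)].
  apply: sorted_roots_unique => //.
  by rewrite -eE char_poly_diag_conj.
by case; split; rewrite // char_poly_diag_conj.
Qed.

(** The two factors of a complementary pair are the positive and negative parts
  of their sum, by uniqueness of the Moreau decomposition; an ordered
  eigenbasis of the sum is therefore one of both. *)
Lemma complementary_eigenbasis (X S : 'M[R]_n) : psd X -> psd (- S) -> X *m S = 0 ->
  exists P (d : 'rV[R]_n), [/\ (eigbases X `&` eigbases S) P,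
    eigvals X = \row_i Num.max (d 0 i) 0 & eigvals S = \row_i Num.min (d 0 i) 0].
Proof.
move=> Xp Sp XS.
have SNT := psd_tr Sp; have ST : S^T = S.
  by rewrite -[S]opprK linearN/= SNT.
have ZT : (X + S)^T = X + S by rewrite linearD/= (psd_tr Xp) ST.
have [P [d [PP ZE dsort]]] := spectral_sorted ZT.
pose dp : 'rV[R]_n := \row_i Num.max (d 0 i) 0.
pose dm : 'rV[R]_n := \row_i Num.min (d 0 i) 0.
pose X1 := P *m diag_mx dp *m P^T; pose S1 := P *m diag_mx dm *m P^T.
have X1p : psd X1 by apply: psd_diag => i; rewrite mxE le_max lexx orbT.
have S1E : - S1 = P *m diag_mx (- dm) *m P^T by rewrite linearN/= mulmxN mulNmx.
have S1p : psd (- S1).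
  by rewrite S1E; apply: psd_diag => i; rewrite !mxE oppr_ge0 ge_min lexx orbT.
have XS1 : X1 + S1 = X + S.
  rewrite ZE /X1 /S1 -mulmxDl -mulmxDr; congr (_ *m _ *m _).
  apply/matrixP => i j; rewrite !mxE -mulrnDl; congr (_ *+ _).
  by rewrite addr_max_min addr0.
have X1S1 : X1 *m S1 = 0.
  rewrite /X1 /S1 -!mulmxA (mulmxA P^T) PP mul1mx (mulmxA (diag_mx dp)) mulmx_diag.
  rewrite (_ : diag_mx _ = 0) ?mul0mx ?mulmx0//.
  apply/matrixP => i j; rewrite !mxE; case: eqP => [->|]; rewrite ?mulr0n// mulr1n.
  by case: (leP (d 0 j) 0) => _; rewrite ?mul0r ?mulr0.
have inn0 (U V : 'M[R]_n) : U^T = U -> U *m V = 0 -> inn U V = 0.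
  by move=> UT UV; rewrite /inn UT UV linear0.
have XX1 : X = X1.
  apply: subr0_eq; apply: inn_eq0; apply/eqP.
  have dE : X - X1 = S1 - S.
    by apply/eqP; rewrite subr_eq addrAC eq_sym subr_eq addrC XS1.
  rewrite eq_le; apply/andP; split; last by rewrite innMM sqr_ge0.
  rewrite {2}dE innDl !innDr !innNl !innNr.
  rewrite (inn0 X S (psd_tr Xp) XS) (inn0 X1 S1 (psd_tr X1p) X1S1).
  have := psd_inn_ge0 Xp S1p; have := psd_inn_ge0 X1p Sp; rewrite !innNr; lra.
have SS1 : S = S1 by apply: (addrI X); rewrite -XS1 XX1.
have eX : eigvals X = dp.
  rewrite XX1; apply: eigvals_spectral => // i j ij; rewrite !mxE.
  by rewrite ge_max le_max dsort//= le_max lexx orbT.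
have eS : eigvals S = dm.
  rewrite SS1; apply: eigvals_spectral => // i j ij; rewrite !mxE.
  by rewrite le_min ge_min dsort//= ge_min lexx orbT.
exists P, d; split=> //; split; split=> //.
  by rewrite eX.
by rewrite eS.
Qed.

Lemma submatrix_eq0P (I J : {set 'I_n}) (W : 'M[R]_n) :
  submatrix I J W = 0 <-> forall i j, i \in I -> j \in J -> W i j = 0.
Proof.
split=> [W0 i j iI jJ|W0]; last first.
  by apply/matrixP => i j; rewrite !mxE W0// enum_valP.
have := congr1 (fun M : 'M[R]_(_, _) => M (enum_rank_in iI i) (enum_rank_in jJ j)) W0.
by rewrite !mxE !enum_rankK_in.
Qed.

Lemma psd_submatrix0 (W : 'M[R]_n) : psd (submatrix finset.set0 finset.set0 W).
Proof.
have empty (i : 'I_#|(finset.set0 : {set 'I_n})|) : False.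
  by have := ltn_ord i; rewrite [X in (_ < X)%N]cards0.
split=> [|u]; first by apply/matrixP => i; case: (empty i).
by rewrite mxE big1// => i; case: (empty i).
Qed.

(** Distinct blocks are disjoint: the signs of the two eigenvalues at an index
  tell which kind of block contains it. *)
Lemma orthogonal_blkdiag1 (X S : 'M[R]_n) :
  (forall k, ~ (0 < eigvals X 0 k /\ eigvals S 0 k < 0)) ->
  orthogonal_blkdiag (eigblocks X S) (1%:M : 'M[R]_n).
Proof.
move=> compl I J IB JB; split=> IJ.
  subst J; rewrite /orthogonal_mx/=.
  have -> : submatrix I I (1%:M : 'M[R]_n) = 1%:M.
    apply/matrixP => i j; rewrite !mxE; congr (_%:R).
    by rewrite (inj_eq enum_val_inj).
  by rewrite trmx1 mul1mx.
apply/submatrix_eq0P => i j iI jJ; rewrite mxE; case: eqP => // ij; subst j.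
case: IJ.
have classE (M : 'M[R]_n) (a : 'I_n) : i \in eigclass M a -> eigclass M a = eigclass M i.
  by rewrite inE => /eqP ia; apply/setP => k; rewrite !inE ia.
have block K : K \in eigblocks X S -> i \in K ->
    [\/ 0 < eigvals X 0 i /\ K = eigclass X i,
       [/\ eigvals X 0 i = 0, eigvals S 0 i = 0 & K = idx_beta X S] |
       eigvals S 0 i < 0 /\ K = eigclass S i].
  rewrite !inE => /orP[/orP[/imsetP[a aal ->] ia|/eqP -> ib]|/imsetP[a aga ->] ia].
  - by constructor 1; rewrite (classE _ _ ia); move: aal ia; rewrite !inE => ? /eqP ->.
  - by constructor 2; move: ib; rewrite !inE => /andP[/eqP -> /eqP ->].
  - by constructor 3; rewrite (classE _ _ ia); move: aga ia; rewrite !inE => ? /eqP ->.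
case: (block I IB iI) => [[Xi IE]|[Xi Si IE]|[Si IE]];
  case: (block J JB jJ) => [[Xj JE]|[Xj Sj JE]|[Sj JE]].
- by rewrite IE JE.
- by rewrite Xj ltxx in Xi.
- by case: (compl i).
- by rewrite Xi ltxx in Xj.
- by rewrite IE JE.
- by rewrite Si ltxx in Sj.
- by case: (compl i).
- by rewrite Sj ltxx in Si.
- by rewrite IE JE.
Qed.

Section CriticalDirections.
Context {X : euclideanType R}.
Variables (B : {linear X -> symmx R n}).

(** Whatever the index sets are, the columns of [W] indexed by [ga] vanish;
  and this is all that is required when [be_p] is the whole of [be]. *)
Lemma Upsilon_hatE (Xs Ss : symmx R n) : psd Xs -> psd (- symval Ss) ->
  symval Xs *m symval Ss = 0 ->
  Upsilon_hat B Xs Ss = [set w | symval (B w) *m symval Ss = 0].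
Proof.
move=> Xp Sp XS; have [P [d [PXS eX eS]]] := complementary_eigenbasis Xp Sp XS.
apply/seteqP; split=> w /=.
  move=> [be_m [be_p [be_0 [ga_t [P' [Q [gat _ _ [_ PQS] [beE _ W1 W2]]]]]]]].
  move: PQS W1 W2 => [+ +]; move: (P' *m Q) => U UU SE.
  set W := U^T *m symval (B w) *m U => W1 W2.
  have UUT : U *m U^T = 1%:M by exact: mulmx1C.
  have Wcol j i : eigvals Ss 0 i < 0 -> W j i = 0.
    move=> iga; have igat : i \in ga_t by apply: (fintype.subsetP gat); rewrite inE.
    have : j \in (idx_alpha Xs :|: idx_beta Xs Ss :|: idx_gamma Ss)%SET.
      rewrite !inE eX eS !mxE; case: (ltgtP (d 0 j) 0) => dj.
      - by rewrite dj orbT.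
      - by rewrite dj.
      - by rewrite dj eqxx orbT.
    rewrite beE => jin.
    have W1' := (submatrix_eq0P _ _ _).1 W1; have W2' := (submatrix_eq0P _ _ _).1 W2.
    have gj : (j \in idx_gamma Ss) ==> (j \in ga_t) by apply/implyP; exact: (fintype.subsetP gat).
    have [ja|ja] := boolP ((j \in idx_alpha Xs) || (j \in be_p)).
      by apply: W2' => //; rewrite finset.in_setU.
    apply: W1'; rewrite ?(finset.in_setU, igat) ?orbT//.
    move: gj jin ja; rewrite !(finset.in_setU, finset.in_setD).
    case: (j \in idx_alpha Xs); case: (j \in be_m); case: (j \in be_p);
    by case: (j \in be_0); case: (j \in idx_gamma Ss); case: (j \in ga_t).
  have BE : symval (B w) = U *m W *m U^T.
    by rewrite /W !mulmxA UUT mul1mx -mulmxA UUT mulmx1.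
  clearbody W.
  rewrite BE SE -!mulmxA (mulmxA U^T U) UU mul1mx (mulmxA W).
  have -> : W *m diag_mx (eigvals Ss) = 0.
    apply/matrixP => j i; rewrite mul_mx_diag mxE [RHS]mxE.
    have : eigvals Ss 0 i <= 0 by rewrite eS mxE ge_min lexx orbT.
    by rewrite le_eqVlt => /orP[/eqP ->|/Wcol ->]; rewrite ?mulr0 ?mul0r.
  by rewrite mul0mx mulmx0.
move=> BwS; have [[PP XE] [_ SE]] := PXS.
have Wcol j i : i \in idx_gamma Ss -> (P^T *m symval (B w) *m P) j i = 0.
  rewrite inE => iga.
  have SP : symval Ss *m P = P *m diag_mx (eigvals Ss) by rewrite {1}SE -mulmxA PP mulmx1.
  have : P^T *m symval (B w) *m P *m diag_mx (eigvals Ss) = 0.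
    rewrite -(mulmxA _ P (diag_mx _)) -SP (mulmxA _ (symval Ss) P).
    by rewrite -(mulmxA P^T _ (symval Ss)) BwS mulmx0 mul0mx.
  move=> /matrixP/(_ j i); rewrite mul_mx_diag mxE [RHS]mxE => /eqP.
  by rewrite mulf_eq0 (lt_eqF iga) orbF => /eqP.
exists finset.set0, (idx_beta Xs Ss), finset.set0, (idx_gamma Ss), P, (1%:M : 'M[R]_n).
rewrite mulmx1; split=> //.
  apply: orthogonal_blkdiag1 => k [].
  by rewrite eX eS !mxE lt_max gt_min !ltxx !orbF => d1 d2; have := lt_trans d1 d2; rewrite ltxx.
split.
- by rewrite finset.setDv finset.setU0 finset.setU0 finset.set0U.
- exact: psd_submatrix0.
- by apply/submatrix_eq0P => i j _; rewrite finset.set0U => /Wcol.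
- by apply/submatrix_eq0P => i j _ /Wcol.
Qed.

End CriticalDirections.

End Eigenvalues.


(** * Tilt-stable solutions *)

Unset Implicit Arguments.
Theorem corollary3p3 (R : realType) (X : euclideanType R) (m n : nat)
    (A : {linear X -> evec R m}) (B : {linear X -> symmx R n})
    (b : evec R m) (B0 : symmx R n)
    (phi : X -> \bar R) (O : set X)
    (phi_proper : proper_fun phi) (phi_lsc : lower_semicontinuous phi)
    (O_open : open O) (feasible_O : feasible A B b B0 `<=` O)
    (phi_C2 : C2_on O phi)
    (xs : X) (xs_opt : local_solution A B b B0 phi xs)
    (Ns : set X) (Ns_open : open Ns) (Ns_xs : Ns xs) (Ns_O : Ns `<=` O)
    (hess_psd : forall x, Ns x -> psd_op (hess (fine \o phi) x)) :
  let vs := - grad (fine \o phi) xs in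
  let Xs := constraint B B0 xs in
  forall Ss : symmx R n,
  let NX := normal_cone (@psd_cone R n) Xs in
  let Ks := tangent_cone (@psd_cone R n) Xs `&`
            cone_span (normal_cone (@psd_cone R n) (- Ss)) in
  metrically_regular (constraint_map A B b B0) xs (0, 0) ->
  NX Ss ->
  multipliers A B b B0 xs vs =
    [set y | adjoint A y = vs - adjoint B Ss] `*` [set Ss] ->
  Ks `<=` range B ->
  set_inj (B @^-1` Ks) B ->
  cone_span NX `&` [set S | range (adjoint A) (adjoint B S)] = [set 0] \/
    adjoint B @` cone_span NX `<=` range (adjoint A) ->
  tilt_stable_solution A B b B0 phi xs <->
  [set w | hess (fine \o phi) xs w = 0] `&` [set w | A w = 0] `&`
    Upsilon_hat B Xs Ss = [set 0].
Proof.
move=> vs Xs Ss NX Ks reg SsN multE _ _ AB.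
have [xs_feas xs_min] := xs_opt.
have [_ Xp] := xs_feas.
have F_diff x : Ns x -> differentiable (fine \o phi) x by move=> /Ns_O/phi_C2[].
have gradF_diff x : Ns x -> differentiable (grad (fine \o phi)) x by move=> /Ns_O/phi_C2[].
have hessF_cont x : Ns x -> forall h, {for x, continuous (fun y => hess (fine \o phi) y h)}.
  by move=> /Ns_O/phi_C2[].
have phi_fin x : feasible A B b B0 x -> phi x \is a fin_num.
  by move=> /feasible_O/phi_C2[].
have nondeg := nondegeneracy xs_feas reg AB.
have [Sp XS] : psd (- symval Ss) /\ symval Xs *m symval Ss = 0.
  by apply/normal_psdP.
(* The multiplier rule at [xs] provides a multiplier of [vs], whose matrix part
  is [Ss] because [Ss] is the only one. *)
have stationary : exists y, adjoint A y + adjoint B Ss = vs.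
  have vsN : normal_cone (feasible A B b B0) xs vs.
    have [r r0 rmin] : exists2 r, 0 < r & forall y, `|y - xs| <= r -> feasible A B b B0 y ->
        (phi xs <= phi y)%E.
      move: xs_min => /nbhs_ballP[r r0 rmin]; exists (r / 2); first exact: divr_gt0.
      move=> y yr Gy; apply: rmin => //; rewrite -ball_normE/= distrC.
      by apply: le_lt_trans yr _; rewrite ltr_pdivrMr// ltr_pMr// ltr1n.
    have rmin' y : `|y - xs| <= r -> feasible A B b B0 y ->
        (fine \o phi) xs - dotp 0 xs <= (fine \o phi) y - dotp 0 y.
      move=> yr Gy; rewrite !dotp0l !subr0 /=.
      by apply: fine_le; [exact: phi_fin|exact: phi_fin|exact: rmin].
    have := local_min_normal Ns_open Ns_xs F_diff gradF_diff hessF_cont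
      (@feasible_convex R X m n A B b B0) xs_feas r0 rmin'.
    by rewrite sub0r.
  have [r r0 mult] := normal_multiplier reg nondeg.
  have xr : `|xs - xs| <= r by rewrite subrr normr0 ltW.
  have [y [S [SN yE]]] := mult xs vs xs_feas xr vsN.
  have : multipliers A B b B0 xs vs (y, S) by [].
  by rewrite multE => -[_ /= SE]; exists y; rewrite -SE.
have [ys ysE] := stationary.
rewrite (Upsilon_hatE B Xp Sp XS); split.
  move=> tilt.
  have [c [dl [rho [L [c0 dl0 rho0 L0 growth]]]]] :=
    tilt_stable_growth phi_proper phi_fin xs_feas tilt.
  apply/seteqP; split=> [w [[Hw Aw] BwS]|_ ->].
    exact: (growth_second_order xs_feas Ns_open Ns_xs F_diff gradF_diff hessF_cont
      hess_psd nondeg SsN ysE c0 dl0 rho0 L0 growth Hw Aw BwS).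
  split; first split.
  - by rewrite /= /hess linear0.
  - by rewrite /= linear0.
  - by rewrite /= (linear0 B) symval0 mul0mx.
move=> ker0.
have second w : hess (fine \o phi) xs w = 0 -> A w = 0 ->
    symval (B w) *m symval Ss = 0 -> w = 0.
  by move=> Hw Aw BwS; suff : [set 0] w by []; rewrite -ker0.
have [c [dl [rho [c0 dl0 rho0 [P0 Pex]]]]] := tilted_minimizers xs_feas Ns_open Ns_xs
  (hess_psd xs Ns_xs) reg nondeg SsN ysE second F_diff gradF_diff hessF_cont.
exact: (growth_tilt_stable phi_proper phi_fin xs_feas c0 dl0 rho0 P0 Pex).
Qed.
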